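(* Let $b\in(0,1)$. There exist constants $C>0$ and $R_0>1$ such that for all $R\ge R_0$, $$-(-2g(b))^{1/2}\le\frac{\mathcal M_0(b,R)}{R^{3/2}}\le-\Big(\big(1-\tfrac CR\big)(-2g(b))\Big)^{1/2}+\frac CR(-2g(b))^{-1/2}.$$ In particular $g(b)=-\frac12\big(\lim_{R\to\infty}\mathcal M_0(b,R)R^{-3/2}\big)^2$.
   Context: $\mathbf A_0(x_1,x_2)=\frac12(-x_2,x_1)$, $K_R=(-R/2,R/2)^2$. For $b\ge0$, $m_0(b,R)=\inf_{u\in H^1_0(K_R;\mathbb C)}\int_{K_R}\big(b|(\nabla-i\mathbf A_0)u|^2-|u|^2+\frac12|u|^4\big)dx$ and $g(b)=\lim_{R\to\infty}m_0(b,R)/R^2$ (this limit exists; for $b\in[0,1]$ one has $\alpha_0(b-1)^2\le|g(b)|\le\frac12(b-1)^2$ for a universal $\alpha_0>0$, so $g(b)<0$ for $b\in(0,1)$). $\mathbf F(x)=(-x_2/2,x_1/2,0)$, $Q_R=(-R/2,R/2)^3$, $F^{\rm lin}_{b,Q_R}(u)=\int_{Q_R}\big(b|(\nabla-i\mathbf F)u|^2-|u|^2\big)dx$, and $$\mathcal M_0(b,R)=\inf\Big\{\frac{F^{\rm lin}_{b,Q_R}(u)}{\big(\int_{Q_R}|u|^4dx\big)^{1/2}}:\ u\in H^1_0(Q_R;\mathbb C)\setminus\{0\}\Big\}.$$ *)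

(* Defs.v *)
From HB Require Import structures.
From mathcomp Require Import all_boot all_order all_algebra.
From mathcomp Require Import all_classical all_reals all_analysis.
Set Implicit Arguments. Unset Strict Implicit. Unset Printing Implicit Defensive.
Import Order.TTheory GRing.Theory Num.Theory.
Import numFieldNormedType.Exports.
Local Open Scope classical_set_scope.
Local Open Scope ring_scope.

Section Defs.
Variable R : realType.

Fixpoint iterD (V : normedModType R) (vs : seq V) (f : V -> R) : V -> R :=
  if vs is v :: vs' then (fun x => derive (iterD vs' f) x v) else f.

Definition smooth (V : normedModType R) (f : V -> R) :=
  forall (vs : seq V) (x : V), differentiable (iterD vs f) x.

Definition pt2 := (R * R)%type.
Definition leb2 := ((@lebesgue_measure R) \x (@lebesgue_measure R))%E.

Definition K2 (r : R) : set pt2 := [set x | `|x.1| < r / 2 /\ `|x.2| < r / 2].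
(* C_c^infty(K_r): smooth with support in a compact subset of K_r *)
Definition Cc2 (r : R) (f : pt2 -> R) :=
  smooth f /\ exists2 d : R, 0 < d &
    forall x : pt2, ~ (`|x.1| <= r / 2 - d /\ `|x.2| <= r / 2 - d) -> f x = 0.
Definition e21 : pt2 := (1, 0). Definition e22 : pt2 := (0, 1).

(* An element of H^1_0(K_r; C), written u = p + i q, together with its
   (weak) gradient (p1,p2) of p and (q1,q2) of q: the pair (u, grad u) is an
   H^1-limit of (phi_n, grad phi_n) with phi_n in C_c^infty(K_r; C). *)
Definition H10_2 (r : R) (p q p1 p2 q1 q2 : pt2 -> R) :=
  [/\ measurable_fun (K2 r) p, measurable_fun (K2 r) q,
      measurable_fun (K2 r) p1 /\ measurable_fun (K2 r) p2,
      measurable_fun (K2 r) q1 /\ measurable_fun (K2 r) q2 &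
  exists (P Q : nat -> pt2 -> R), (forall n, Cc2 r (P n) /\ Cc2 r (Q n)) /\
    ((fun n => (\int[leb2]_(x in K2 r)
        ((P n x - p x) ^+ 2 + (Q n x - q x) ^+ 2)%:E)%E) @ \oo --> 0%E) /\
    ((fun n => (\int[leb2]_(x in K2 r)
        ((derive (P n) x e21 - p1 x) ^+ 2 + (derive (P n) x e22 - p2 x) ^+ 2
       + (derive (Q n) x e21 - q1 x) ^+ 2 + (derive (Q n) x e22 - q2 x) ^+ 2)%:E)%E)
       @ \oo --> 0%E)].

Definition A01 (x : pt2) : R := - x.2 / 2.
Definition A02 (x : pt2) : R := x.1 / 2.

(* GL energy: b|(grad - iA0)u|^2 - |u|^2 + |u|^4/2, with
   (d_j - i A_j)(p + i q) = (d_j p + A_j q) + i (d_j q - A_j p). *)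
Definition GL2 (b r : R) (p q p1 p2 q1 q2 : pt2 -> R) : R :=
  b * Rintegral leb2 (K2 r) (fun x =>
        (p1 x + A01 x * q x) ^+ 2 + (q1 x - A01 x * p x) ^+ 2
      + (p2 x + A02 x * q x) ^+ 2 + (q2 x - A02 x * p x) ^+ 2)
  - Rintegral leb2 (K2 r) (fun x => p x ^+ 2 + q x ^+ 2)
  + 2^-1 * Rintegral leb2 (K2 r) (fun x => (p x ^+ 2 + q x ^+ 2) ^+ 2).

Definition m0 (b r : R) : R :=
  inf [set E | exists p q p1 p2 q1 q2, H10_2 r p q p1 p2 q1 q2 /\
                 E = GL2 b r p q p1 p2 q1 q2].

Definition gGL (b : R) : R := lim (m0 b r / r ^+ 2 @[r --> +oo]).

Definition pt3 := (R * R * R)%type.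
Definition leb3 := (leb2 \x (@lebesgue_measure R))%E.
Definition c1 (x : pt3) : R := x.1.1.
Definition c2 (x : pt3) : R := x.1.2.
Definition c3 (x : pt3) : R := x.2.

Definition Q3 (r : R) : set pt3 :=
  [set x | `|c1 x| < r / 2 /\ `|c2 x| < r / 2 /\ `|c3 x| < r / 2].
Definition Cc3 (r : R) (f : pt3 -> R) :=
  smooth f /\ exists2 d : R, 0 < d &
    forall x : pt3, ~ (`|c1 x| <= r / 2 - d /\ `|c2 x| <= r / 2 - d
                       /\ `|c3 x| <= r / 2 - d) -> f x = 0.
Definition e31 : pt3 := ((1, 0), 0).
Definition e32 : pt3 := ((0, 1), 0).
Definition e33 : pt3 := ((0, 0), 1).

Definition H10_3 (r : R) (p q p1 p2 p3 q1 q2 q3 : pt3 -> R) :=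
  [/\ measurable_fun (Q3 r) p, measurable_fun (Q3 r) q,
      [/\ measurable_fun (Q3 r) p1, measurable_fun (Q3 r) p2 &
          measurable_fun (Q3 r) p3],
      [/\ measurable_fun (Q3 r) q1, measurable_fun (Q3 r) q2 &
          measurable_fun (Q3 r) q3] &
  exists (P Q : nat -> pt3 -> R), (forall n, Cc3 r (P n) /\ Cc3 r (Q n)) /\
    ((fun n => (\int[leb3]_(x in Q3 r)
        ((P n x - p x) ^+ 2 + (Q n x - q x) ^+ 2)%:E)%E) @ \oo --> 0%E) /\
    ((fun n => (\int[leb3]_(x in Q3 r)
        ((derive (P n) x e31 - p1 x) ^+ 2 + (derive (P n) x e32 - p2 x) ^+ 2
       + (derive (P n) x e33 - p3 x) ^+ 2
       + (derive (Q n) x e31 - q1 x) ^+ 2 + (derive (Q n) x e32 - q2 x) ^+ 2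
       + (derive (Q n) x e33 - q3 x) ^+ 2)%:E)%E)
       @ \oo --> 0%E)].

Definition F1 (x : pt3) : R := - c2 x / 2.
Definition F2 (x : pt3) : R := c1 x / 2.
Definition F3 (x : pt3) : R := 0.

Definition Flin3 (b r : R) (p q p1 p2 p3 q1 q2 q3 : pt3 -> R) : R :=
  b * Rintegral leb3 (Q3 r) (fun x =>
        (p1 x + F1 x * q x) ^+ 2 + (q1 x - F1 x * p x) ^+ 2
      + (p2 x + F2 x * q x) ^+ 2 + (q2 x - F2 x * p x) ^+ 2
      + (p3 x + F3 x * q x) ^+ 2 + (q3 x - F3 x * p x) ^+ 2)
  - Rintegral leb3 (Q3 r) (fun x => p x ^+ 2 + q x ^+ 2).

Definition L4norm3 (r : R) (p q : pt3 -> R) : R :=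
  Num.sqrt (Rintegral leb3 (Q3 r) (fun x => (p x ^+ 2 + q x ^+ 2) ^+ 2)).

Definition M0 (b r : R) : R :=
  inf [set E | exists p q p1 p2 p3 q1 q2 q3,
         [/\ H10_3 r p q p1 p2 p3 q1 q2 q3,
             ~ {ae leb3, forall x, Q3 r x -> p x = 0 /\ q x = 0} &
             E = Flin3 b r p q p1 p2 p3 q1 q2 q3 / L4norm3 r p q]].

End Defs.

(* Main.v *)
From Pilot Require Import Defs.
From HB Require Import structures.
From mathcomp Require Import all_boot all_order all_algebra.
From mathcomp Require Import all_classical all_reals all_analysis.
From mathcomp Require Import measurable_realfun ring lra.

(** Put [G = - 2 g(b)], and let [E(u)] be the energy of a smooth compactly supported [u] on the
    plane.  Magnetic translations preserve [E], so that tiling the plane by translates of [u] gives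
    [g(b) r^2 <= E(u)] when [u] is supported in [K_r].  Conversely, cut a near-minimiser [u] on a
    large square off by all the translates of a fixed cutoff of side [r]; averaging [m_0(b,r)] over
    the translation parameter gives [m_0(b,r) <= g(b) r^2 + C r].  A truncated Gaussian, the ground
    state of the harmonic oscillator, shows that [g(b) < 0] for [b < 1].

    Lower bound in space: almost every horizontal slice of [u] lies in [H^1_0(K_r)].  Discarding the
    vertical derivative and integrating the planar bound for [t u] over the slices gives
    [g(b) r^3 <= t^2 F(u) + t^4/2 |u|_4^4] for all [t]; optimise in [t].  Upper bound: take the
    product of a planar near-minimiser with a cutoff in the vertical variable, and use
    [|E|/c + c/2 >= sqrt (2 |E|)] with [c = |u|_4^2]. *)

Set Implicit Arguments. Unset Strict Implicit. Unset Printing Implicit Defensive.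
Import Order.TTheory GRing.Theory Num.Theory.
Import numFieldNormedType.Exports.
Local Open Scope classical_set_scope.
Import Pilot.Defs.
Local Open Scope ring_scope.

(** * Calculus of smooth functions *)

(** The infima run over H^1_0, whereas cutting, tiling and translating are done on smooth functions.
    The passage between the two needs continuity of the quartic term; in the plane this comes from
    the Ladyzhenskaya inequality, which also makes the energy of almost every slice finite. In space
    no L^4 embedding enters: where the quartic integral is infinite, [Rintegral] returns 0, the
    quotient is 0 by the conventions on square root and inverse, and the lower bound is trivial. The
    limit g(b) is assumed to exist, so a sequence of sizes 2^n r is enough to bound it from above.
    The rate C/r comes from the averaging: terms linear in the gradient of the cutoff integrate to
    0, and its square lives on strips of width 1, hence costs O(r) and not O(r^2). Negativity of
    g(b) comes from the planar Gaussian having kinetic energy equal to its mass: the quadratic part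
    of its energy is (b - 1) times the mass, up to the truncation error. *)

Section smooth_calculus.
Variable R : realType.

(** Every iterated derivative stays inside [S]. In this coinductive form, smoothness is proved by
    exhibiting a class closed under derivation, without formulas for higher derivatives. *)
Lemma smooth_coind (V : normedModType R) (S : (V -> R) -> Prop) :
  (forall f x, S f -> differentiable f x) ->
  (forall f v, S f -> S (fun x => 'D_v f x)) ->
  forall f, S f -> smooth f.
Proof.
move=> dS DS f Sf vs x; apply: (dS).
by elim: vs => [//|v vs IH]; exact: DS.
Qed.

Lemma smooth_differentiable (V : normedModType R) (f : V -> R) x :
  smooth f -> differentiable f x.
Proof. by move=> /(_ [::] x). Qed.

Lemma iterD_cat (V : normedModType R) (f : V -> R) vs ws :
  iterD (vs ++ ws)%SEQ f = iterD vs (iterD ws f).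
Proof. by elim: vs => //= v vs ->. Qed.

Lemma smooth_derive (V : normedModType R) (f : V -> R) v :
  smooth f -> smooth (fun x => 'D_v f x).
Proof. by move=> sf vs x; have := sf (vs ++ [:: v])%SEQ x; rewrite iterD_cat. Qed.

Lemma smooth_continuous (V : normedModType R) (f : V -> R) :
  smooth f -> continuous f.
Proof. by move=> sf x; exact/differentiable_continuous/smooth_differentiable. Qed.

Lemma smooth_cst (V : normedModType R) (a : R) : smooth (fun _ : V => a).
Proof.
apply: (@smooth_coind V (fun f => exists a, f = cst a)); last by exists a.
- by move=> f x [c ->]; exact: differentiable_cst.
- by move=> f v [c ->]; exists 0; apply/funext => x; rewrite derive_cst.
Qed.

(** Sums, products and compositions are treated together: the derivative of a product or of a
    composition is built from the other operations, so the classes are closed under derivation only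
    jointly. *)
Inductive smooth_alg (V : normedModType R) : (V -> R) -> Prop :=
| SA_base f : smooth f -> smooth_alg f
| SA_add f g : smooth_alg f -> smooth_alg g -> smooth_alg (f \+ g)
| SA_mul f g : smooth_alg f -> smooth_alg g -> smooth_alg (f \* g)
| SA_comp (phi : R -> R) f : smooth phi -> smooth_alg f -> smooth_alg (phi \o f).

Lemma smooth_alg_diff (V : normedModType R) (f : V -> R) x :
  smooth_alg f -> differentiable f x.
Proof.
move=> H; elim: H => {f} [f sf|f g _ df _ dg|f g _ df _ dg|phi f sphi _ df].
- exact: smooth_differentiable.
- exact: differentiableD.
- exact: differentiableM.
- by apply: differentiable_comp => //; exact: smooth_differentiable.
Qed.

Lemma derive_comp1 (V : normedModType R) (phi : R -> R) (f : V -> R) x v :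
  differentiable f x -> differentiable phi (f x) ->
  'D_v (phi \o f) x = 'D_1 phi (f x) * 'D_v f x.
Proof.
move=> df dphi; rewrite deriveE; last exact: differentiable_comp.
rewrite diff_comp//= (deriveE _ df) deriveE//.
by rewrite -{1}['d f x v]mulr1 -[_ * 1]/(_ *: 1) linearZ /= mulrC.
Qed.

Lemma smooth_alg_derive (V : normedModType R) (f : V -> R) v :
  smooth_alg f -> smooth_alg (fun x => 'D_v f x).
Proof.
move=> H; elim: H => {f} [f sf|f g Sf IHf Sg IHg|f g Sf IHf Sg IHg|phi f sphi Sf IHf].
- exact/SA_base/smooth_derive.
- rewrite (_ : (fun x => _) = (fun x => 'D_v f x) \+ (fun x => 'D_v g x)).
    exact: SA_add.
  by apply/funext => x /=; rewrite -deriveD//; apply: diff_derivable;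
    exact: smooth_alg_diff.
- rewrite (_ : (fun x => _) = (f \* (fun x => 'D_v g x)) \+ (g \* (fun x => 'D_v f x))).
    by apply: SA_add; apply: SA_mul.
  apply/funext => x /=; rewrite -[f \* g]/(f * g) deriveM//; apply: diff_derivable;
    exact: smooth_alg_diff.
- rewrite (_ : (fun x => _) = ((fun y => 'D_1 phi y) \o f) \* (fun x => 'D_v f x)).
    by apply: SA_mul => //; apply: SA_comp => //; exact: smooth_derive.
  apply/funext => x /=; apply: derive_comp1; first exact: smooth_alg_diff.
  exact: smooth_differentiable.
Qed.

Lemma smooth_algW (V : normedModType R) (f : V -> R) : smooth_alg f -> smooth f.
Proof.
apply: smooth_coind => [g x|g v]; [exact: smooth_alg_diff|exact: smooth_alg_derive].
Qed.

Lemma smoothD (V : normedModType R) (f g : V -> R) :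
  smooth f -> smooth g -> smooth (fun x => f x + g x).
Proof. by move=> sf sg; apply: smooth_algW; apply: SA_add; exact: SA_base. Qed.

Lemma smoothM (V : normedModType R) (f g : V -> R) :
  smooth f -> smooth g -> smooth (fun x => f x * g x).
Proof. by move=> sf sg; apply: smooth_algW; apply: SA_mul; exact: SA_base. Qed.

Lemma smooth_comp (V : normedModType R) (phi : R -> R) (f : V -> R) :
  smooth phi -> smooth f -> smooth (fun x => phi (f x)).
Proof. by move=> sf sg; apply: smooth_algW; apply: SA_comp => //; exact: SA_base. Qed.

Lemma smoothZ (V : normedModType R) (a : R) (f : V -> R) :
  smooth f -> smooth (fun x => a * f x).
Proof. by move=> sf; apply: smoothM => //; exact: smooth_cst. Qed.

Lemma smoothN (V : normedModType R) (f : V -> R) :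
  smooth f -> smooth (fun x => - f x).
Proof.
move=> sf; rewrite (_ : (fun x => _) = (fun x => (-1) * f x)); first exact: smoothZ.
by apply/funext => x; rewrite mulN1r.
Qed.

Lemma smoothB (V : normedModType R) (f g : V -> R) :
  smooth f -> smooth g -> smooth (fun x => f x - g x).
Proof. by move=> sf sg; apply: smoothD => //; exact: smoothN. Qed.

(** [L] is the linear part of [A]. The first clause identifies difference quotients, so
    [derive_affine] holds without any differentiability of [f]. *)
Definition affine_map (V W : normedModType R) (A L : V -> W) :=
  (forall x v h, A (h *: v + x) = h *: L v + A x) /\ (forall x, differentiable A x).

Lemma derive_affine (V W : normedModType R) (A L : V -> W) (f : W -> R) x v :
  affine_map A L -> 'D_v (f \o A) x = 'D_(L v) f (A x).
Proof.
move=> [AL _]; rewrite /derive.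
suff -> : (fun h => h^-1 *: (((f \o A) \o shift x) (h *: v) - (f \o A) x)) =
          (fun h => h^-1 *: ((f \o shift (A x)) (h *: L v) - f (A x))) by [].
by apply/funext => h /=; rewrite AL.
Qed.

Lemma smooth_affine (V W : normedModType R) (A L : V -> W) (f : W -> R) :
  affine_map A L -> smooth f -> smooth (f \o A).
Proof.
move=> AL sf; apply: (@smooth_coind V (fun h => exists2 f, smooth f & h = f \o A)).
- move=> _ x [h sh ->]; apply: differentiable_comp; first exact: AL.2.
  exact: smooth_differentiable.
- move=> _ v [h sh ->]; exists (fun y => 'D_(L v) h y); first exact: smooth_derive.
  by apply/funext => x; rewrite (derive_affine _ _ _ AL).
- by exists f.
Qed.

Lemma differentiable_fst (V W : normedModType R) (x : V * W) :
  differentiable (@fst V W) x.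
Proof.
by apply: (linear_differentiable (f := [the {linear (V * W)%type -> V} of fst])) => y; exact: cvg_fst.
Qed.

Lemma differentiable_snd (V W : normedModType R) (x : V * W) :
  differentiable (@snd V W) x.
Proof.
by apply: (linear_differentiable (f := [the {linear (V * W)%type -> W} of snd])) => y; exact: cvg_snd.
Qed.

Lemma affine_fst (V W : normedModType R) : affine_map (@fst V W) (@fst V W).
Proof. by split=> // x; exact: differentiable_fst. Qed.

Lemma affine_snd (V W : normedModType R) : affine_map (@snd V W) (@snd V W).
Proof. by split=> // x; exact: differentiable_snd. Qed.

Lemma affine_shift (V : normedModType R) (a : V) : affine_map (fun x => x - a) id.
Proof. by split=> [x v h|x]; [rewrite addrA|exact: differentiableB]. Qed.

Lemma affine_pairl (V W : normedModType R) (w : W) :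
  affine_map (fun x : V => (x, w)) (fun x => (x, 0)).
Proof.
split=> [x v h|x]; last exact: differentiable_pair.
by rewrite -[RHS]/(h *: v + x, h *: 0 + w) scaler0 add0r.
Qed.

Lemma affine_pairr (V W : normedModType R) (w : V) :
  affine_map (fun x : W => (w, x)) (fun x => (0, x)).
Proof.
split=> [x v h|x]; last exact: differentiable_pair.
by rewrite -[RHS]/(h *: 0 + w, h *: v + x) scaler0 add0r.
Qed.

(** The functions p(1/x) e^(-1/x), extended by 0. With [p] ranging over all polynomials the family
    is stable under derivation, which settles smoothness at 0. *)
Definition expinv (p : {poly R}) (x : R) : R :=
  if 0 < x then p.[x^-1] * expR (- x^-1) else 0.

(** The term of degree i is controlled by e^y >= y^(i+1)/(i+1)! at y = 1/x, one power more than its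
    own degree; the spare power is the factor |x|. *)
Lemma expinv_le (p : {poly R}) : exists2 C : R, 0 <= C & forall x, `|expinv p x| <= C * `|x|.
Proof.
exists (\sum_(i < size p) `|p`_i| * (i.+1)`!%:R).
  by apply: sumr_ge0 => i _; rewrite mulr_ge0.
move=> x; rewrite /expinv; case: ifPn => [x0|_]; last first.
  by rewrite normr0 mulr_ge0// sumr_ge0// => i _; rewrite mulr_ge0.
rewrite horner_coef normrM (ger0_norm (expR_ge0 _)) (gtr0_norm x0).
rewrite -ler_pdivrMr//.
have xV0 : 0 < x^-1 by rewrite invr_gt0.
have H : `|\sum_(i < size p) p`_i * x^-1 ^+ i| <= \sum_(i < size p) `|p`_i| * x^-1 ^+ i.
  apply: le_trans (ler_norm_sum _ _ _) _; apply: ler_sum => i _.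
  by rewrite normrM (ger0_norm (exprn_ge0 _ (ltW xV0))).
rewrite -mulrA.
apply: le_trans (_ : _ <= (\sum_(i < size p) `|p`_i| * x^-1 ^+ i) * (expR (- x^-1) * x^-1)) _.
  by apply: ler_wpM2r => //; rewrite mulr_ge0 ?expR_ge0// ltW.
rewrite mulr_suml; apply: ler_sum => i _.
rewrite -mulrA; apply: ler_wpM2l => //.
have -> : x^-1 ^+ i * (expR (- x^-1) * x^-1) = x^-1 ^+ i.+1 / expR (x^-1).
  by rewrite expRN exprSr mulrA [RHS]mulrAC.
rewrite ler_pdivrMr ?expR_gt0//.
have := expR_ge1Dxn i (ltW xV0).
rewrite -(ler_pM2r (_ : 0 < (i.+1)`!%:R)); last by rewrite ltr0n fact_gt0.
rewrite mulrDl mulfVK; last by rewrite pnatr_eq0 -lt0n fact_gt0.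
by move=> h; rewrite mulrC; apply: le_trans h; rewrite lerDr mul1r.
Qed.

Lemma expinv_is_derive (p : {poly R}) (x : R) :
  is_derive x 1 (expinv p) (expinv ((p - p^`()) * 'X^2) x).
Proof.
have [x0|x0|->] := ltrgtP x 0.
- apply: (@near_eq_is_derive _ _ _ (cst 0)).
    near=> y; rewrite /expinv /=; case: ifPn => // y0.
    suff : y < 0 by rewrite ltNge (ltW y0).
    by near: y; exact: lt_nbhsl.
  by rewrite {1}/expinv ltNge (ltW x0)/=; exact: is_derive_cst.
- apply: (@near_eq_is_derive _ _ _ ((horner p \o GRing.inv) * (expR \o (-%R \o GRing.inv)))).
    near=> y; rewrite /expinv /=; case: ifPn => // y0.
    suff : 0 < y by rewrite (negbTE y0).
    by near: y; exact: lt_nbhsr.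
  rewrite /expinv x0.
  have dinv : is_derive x 1 (GRing.inv : R -> R) (- x ^- 2).
    have := is_deriveV (lt0r_neq0 x0) (is_derive_id x 1).
    by rewrite scaler1.
  apply: is_derive_eq.
  rewrite !hornerE /= /GRing.scale/= !mulrN opprK.
  by field; exact: lt0r_neq0.
(* At 0 the difference quotient of [expinv p] is again of this form, with p multiplied by the
   indeterminate, and tends to 0 by the linear bound. *)
- have [C C0 HC] := expinv_le (p * 'X).
  have e0 q : expinv q 0 = 0 by rewrite /expinv ltxx.
  suff H : (fun h : R => h^-1 *: ((expinv p \o shift 0) (h *: 1) - expinv p 0)) @ 0^' --> (0 : R).
    split; first by apply/cvg_ex; exists 0.
    by rewrite e0; apply/cvg_lim.
  apply/cvgrPdist_lt => e e0'; near=> h; rewrite sub0r normrN.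
  have h0 : h != 0 by near: h; exact: nbhs_dnbhs_neq.
  rewrite e0 subr0 /= addr0 /GRing.scale/= mulr1.
  have -> : h^-1 * expinv p h = expinv (p * 'X) h.
    by rewrite /expinv; case: ifPn => _; rewrite ?mulr0// hornerM hornerX mulrA [h^-1 * _]mulrC.
  apply: (@le_lt_trans _ R (C * `|h|)); first exact: HC.
  apply: (@le_lt_trans _ R ((C + 1) * `|h|)); first by rewrite ler_wpM2r// lerDl.
  rewrite -ltr_pdivlMl ?ltr_wpDl//.
  by near: h; apply: dnbhs0_lt; rewrite mulr_gt0// invr_gt0 ltr_wpDl.
Unshelve. all: by end_near. Qed.

Lemma smooth_expinv p : smooth (expinv p).
Proof.
apply: (@smooth_coind R^o (fun f => exists q, f = expinv q)); last by exists p.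
- by move=> f x [q ->]; apply/derivable1_diffP; have [] := expinv_is_derive q x.
- move=> f v [q ->]; exists (v *: ((q - q^`()) * 'X^2)); apply/funext => x.
  have [/derivable1_diffP dx e] := expinv_is_derive q x.
  rewrite deriveE// -[v in LHS]mulr1 -[v * 1]/(v *: 1) linearZ/= -deriveE// e.
  rewrite /expinv; case: ifP => _; last exact: scaler0.
  by rewrite [in RHS]hornerZ -mulrA.
Qed.

Definition bump := expinv 1.

Lemma bumpE x : bump x = if 0 < x then expR (- x^-1) else 0.
Proof. by rewrite /bump /expinv hornerC mul1r. Qed.

Lemma bump_ge0 x : 0 <= bump x.
Proof. by rewrite bumpE; case: ifP => // _; exact: expR_ge0. Qed.

Lemma bump_le : {homo bump : x y / x <= y}.
Proof.
move=> x y xy; rewrite [bump x]bumpE; case: ifPn => [x0|_]; last exact: bump_ge0.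
by rewrite bumpE (lt_le_trans x0 xy) ler_expR lerN2 lef_pV2// posrE (lt_le_trans x0 xy).
Qed.

Lemma bump0 x : x <= 0 -> bump x = 0.
Proof. by rewrite bumpE leNgt; case: ifP. Qed.

Lemma bump_gt0 x : 0 < x -> 0 < bump x.
Proof. by move=> x0; rewrite bumpE x0 expR_gt0. Qed.

(* the inner argument is nonpositive as soon as [1 <= x], which makes the step exactly 0 there *)
Definition step x := bump (bump 1 - bump x) / bump (bump 1).

Let bb1 : 0 < bump (bump 1).
Proof. by do 2 apply: bump_gt0. Qed.

Lemma step_ge0 x : 0 <= step x.
Proof. by rewrite divr_ge0// bump_ge0. Qed.

Lemma step_le1 x : step x <= 1.
Proof. by rewrite ler_pdivrMr// mul1r; apply: bump_le; rewrite gerBl bump_ge0. Qed.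

Lemma step_eq1 x : x <= 0 -> step x = 1.
Proof. by move=> x0; rewrite /step (bump0 x0) subr0 divff// gt_eqF. Qed.

Lemma step_eq0 x : 1 <= x -> step x = 0.
Proof. by move=> x1; rewrite /step [X in X / _]bump0 ?mul0r// subr_le0 bump_le. Qed.

Lemma smooth_id : smooth (id : R -> R).
Proof.
apply: (@smooth_coind R^o (fun f => (exists a, f = cst a) \/ f = id)); last by right.
- by move=> f x [[a ->]|->]; [exact: differentiable_cst|exact/derivable1_diffP].
- move=> f v [[a ->]|->]; left; [exists 0|exists v];
  by apply/funext => x; rewrite ?derive_cst ?derive_id.
Qed.

Lemma smooth_step : smooth step.
Proof.
rewrite (_ : step = fun x => (bump (bump 1))^-1 * bump (bump 1 - bump x)); last first.
  by apply/funext => x; rewrite mulrC.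
apply: smoothZ; apply: smooth_comp; first exact: smooth_expinv.
by apply: smoothB; [exact: smooth_cst|exact: smooth_expinv].
Qed.

(** Plateau |s| <= r/2 - 2, transition layers of length 1 whatever [r] is, and a margin of length 1
    left at the ends, so that the support is compact in the open interval. *)
Definition cutoff (r s : R) := step (s - (r / 2 - 2)) * step (- s - (r / 2 - 2)).

Lemma smooth_cutoff r : smooth (cutoff r).
Proof.
by apply: smoothM; apply: smooth_comp => //; try exact: smooth_step;
  apply: smoothB; try exact: smooth_cst; try apply: smoothN; exact: smooth_id.
Qed.

Lemma cutoff_ge0 r s : 0 <= cutoff r s.
Proof. by rewrite mulr_ge0// step_ge0. Qed.

Lemma cutoff_le1 r s : cutoff r s <= 1.
Proof. by rewrite mulr_ile1// ?step_ge0// step_le1. Qed.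

Lemma cutoff_eq1 r s : `|s| <= r / 2 - 2 -> cutoff r s = 1.
Proof.
rewrite ler_norml => /andP[a b]; rewrite /cutoff !step_eq1 ?mul1r//; lra.
Qed.

Lemma cutoff_eq0 r s : ~ (`|s| <= r / 2 - 1) -> cutoff r s = 0.
Proof.
move/negP; rewrite ler_norml negb_and -!ltNge => /orP[|] h; rewrite /cutoff.
  by rewrite [X in _ * X]step_eq0 ?mulr0//; lra.
by rewrite step_eq0 ?mul0r//; lra.
Qed.

End smooth_calculus.

(** * Lebesgue measure on the plane and on space *)

Section measurable_base.

(** Open sets of a product lie in the product sigma-algebra because of second countability, so a
    countable base of measurable sets is carried from the factors to the product. [N] gives the
    neighbourhoods and [M] the measurable sets. *)
Definition countable_base (T : Type) (N : T -> set (set T)) (M : set (set T)) :=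
  exists B : nat -> set T, (forall n, M (B n)) /\
    forall x U, N x U -> exists n, B n x /\ B n `<=` U.

Lemma countable_base_prod T1 T2 (N1 : T1 -> set (set T1)) (N2 : T2 -> set (set T2))
    (N : T1 * T2 -> set (set (T1 * T2))) M1 M2 (M : set (set (T1 * T2))) :
  (forall A B, M1 A -> M2 B -> M (A `*` B)) ->
  (forall x U, N x U -> exists A B, [/\ N1 x.1 A, N2 x.2 B & A `*` B `<=` U]) ->
  countable_base N1 M1 -> countable_base N2 M2 -> countable_base N M.
Proof.
move=> MM NN [B1 [mB1 hB1]] [B2 [mB2 hB2]].
exists (fun n => let p := odflt (0, 0)%N (unpickle n) in B1 p.1 `*` B2 p.2).
split=> [n|[x y] U /NN [A [B [/= /hB1 [n1 [x1 s1]] /hB2 [n2 [y2 s2]] AB]]]].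
  exact: MM.
exists (pickle (n1, n2)); rewrite pickleK/=; split=> // -[a b] [/= /s1 ? /s2 ?].
exact: AB.
Qed.

Lemma countable_base_R (R : realType) :
  countable_base (fun x : R => nbhs x) (measurable : set (set R)).
Proof.
exists (fun n => let p := odflt (0, 0) (unpickle n) : rat * rat in `]ratr p.1, ratr p.2[%classic : set R).
split=> [n|x U]; first exact: measurable_itv.
move=> /nbhs_ballP [e /= e0 xeU].
have [a /itvP ha] : exists q, ratr q \in `]x - e, x[ by apply: rat_in_itvoo; lra.
have [b /itvP hb] : exists q, ratr q \in `]x, x + e[ by apply: rat_in_itvoo; lra.
exists (pickle (a, b)); rewrite pickleK/=; split; first by rewrite in_itv/= ha hb.
move=> y; rewrite /= in_itv/= => /andP[ay yb]; apply: xeU; rewrite /ball/=.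
have := hb; have := ha; rewrite ltr_norml => ha' hb'.
have h1 : x - e < ratr a by rewrite ha.
have h2 : ratr b < x + e by rewrite hb.
by apply/andP; split; lra.
Qed.

Lemma countable_base_measurable d (T : measurableType d) (R : realType)
    (N : T -> set (set T)) (f : T -> R) :
  countable_base N (measurable : set (set T)) ->
  (forall x A, nbhs (f x) A -> N x (f @^-1` A)) -> measurable_fun setT f.
Proof.
move=> [B [mB hB]] cf; apply: (measurability _ (RGenOpens.measurableE R)).
move=> _ [_ [a [b ->] <-]]; rewrite setTI.
(* The preimage of an open interval is the countable union of the base sets that it contains. *)
rewrite (_ : f @^-1` _ = \bigcup_(n in [set n | B n `<=` f @^-1` `]a, b[%classic]) B n).
  by apply: bigcup_measurable => n _; exact: mB.
apply/seteqP; split=> [x /= fx|x [n /= + Bx]]; last by apply.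
have /hB [n [Bx nU]] : N x (f @^-1` `]a, b[%classic).
  by apply: cf; apply: open_nbhs_nbhs; split => //; exact: interval_open.
by exists n.
Qed.

End measurable_base.

Section measurable2.
Variable R : realType.

Lemma countable_base_R2 :
  countable_base (fun x : R * R => nbhs x) (measurable : set (set (R * R))).
Proof.
apply: (countable_base_prod (M1 := measurable) (M2 := measurable) _ _ (countable_base_R R) (countable_base_R R)).
- by move=> A B mA mB; exact: measurableX.
- by move=> x U [[A B] [/= hA hB] AB]; exists A, B.
Qed.

Lemma countable_base_R3 :
  countable_base (fun x : R * R * R => nbhs x) (measurable : set (set (R * R * R))).
Proof.
apply: (countable_base_prod (M1 := measurable) (M2 := measurable) _ _ countable_base_R2 (countable_base_R R)).
- by move=> A B mA mB; exact: measurableX.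
- by move=> x U [[A B] [/= hA hB] AB]; exists A, B.
Qed.

Lemma continuous_measurable2 (f : pt2 R -> R) : continuous f -> measurable_fun setT f.
Proof. by move=> cf; apply: (countable_base_measurable countable_base_R2) => x A /cf. Qed.

Lemma continuous_measurable3 (f : pt3 R -> R) : continuous f -> measurable_fun setT f.
Proof. by move=> cf; apply: (countable_base_measurable countable_base_R3) => x A /cf. Qed.

Definition itv1 (r : R) : set R := `](- (r / 2)), (r / 2)[%classic.

Lemma itv1P r x : itv1 r x <-> `|x| < r / 2.
Proof. by rewrite /itv1/= in_itv/= -ltr_norml. Qed.

Lemma K2E r : K2 r = itv1 r `*` itv1 r.
Proof. by apply/seteqP; split=> -[x y] [/= /itv1P ? /itv1P ?]. Qed.

Lemma Q3E r : Q3 r = K2 r `*` itv1 r.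
Proof.
apply/seteqP; split=> -[[x y] z] /=; rewrite /Q3 /K2 /c1 /c2 /c3 /=.
  by move=> [? [? ?]]; split => //; exact/itv1P.
by move=> [[/= ? ?] /itv1P].
Qed.

Lemma measurable_itv1 r : measurable (itv1 r).
Proof. exact: measurable_itv. Qed.

Lemma measurable_K2 (r : R) : measurable (K2 r).
Proof. by rewrite K2E; apply: measurableX; exact: measurable_itv1. Qed.

Lemma measurable_Q3 (r : R) : measurable (Q3 r).
Proof. by rewrite Q3E; apply: measurableX; [exact: measurable_K2|exact: measurable_itv1]. Qed.

Lemma leb_itv1 r : 0 <= r -> lebesgue_measure (itv1 r) = r%:E.
Proof.
move=> r0; rewrite lebesgue_measure_itv/= lte_fin.
case: ifPn => h; first by rewrite -EFinB; congr EFin; field.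
by have -> : r = 0 by lra.
Qed.

Lemma leb2_K2 (r : R) : 0 <= r -> leb2 (K2 r) = (r ^+ 2)%:E.
Proof.
move=> r0; rewrite K2E /leb2 product_measure1E; try exact: measurable_itv1.
by rewrite /= !leb_itv1.
Qed.

(** The pushforward agrees with Lebesgue measure on half-open intervals, which determine it. *)
Lemma leb_shift (a : R) (A : set R) : measurable A ->
  lebesgue_measure ((fun x => x - a) @^-1` A) = lebesgue_measure A.
Proof.
move=> mA.
have mf : measurable_fun setT (fun x : R => x - a) by apply: measurable_funB.
apply/esym.
apply: (lebesgue_measure_unique (mu := pushforward lebesgue_measure (fun x : measurableTypeR R => (x - a : measurableTypeR R)))) => //= _ [[x y] /= _ <-].
rewrite /pushforward.
rewrite (_ : _ @^-1` _ = `](x + a), (y + a)]%classic).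
  rewrite !lebesgue_measure_itv/= !lte_fin ltrD2r; case: ifP => // _.
  by rewrite -!EFinB; congr EFin; ring.
by apply/seteqP; split=> z /=; rewrite !in_itv/= => /andP[? ?]; apply/andP; split; lra.
Qed.

Local Notation mu1 := (@lebesgue_measure R).
Local Notation mu2 := (@leb2 R).
Local Notation mu3 := (@leb3 R).

(** A product measure is determined by its values on rectangles, and there the invariance on the
    line applies to each side. *)
Lemma leb2_shift (a : pt2 R) (A : set (pt2 R)) : measurable A ->
  mu2 ((fun x => x - a) @^-1` A) = mu2 A.
Proof.
move=> mA.
have mf : measurable_fun setT (fun x : pt2 R => x - a).
  apply/measurable_fun_pairP; split; apply: measurable_funB => //.
apply/esym.
pose T := (measurableTypeR R * measurableTypeR R)%type.
pose m' : {measure set T -> \bar R} := [the {measure set T -> \bar R} of pushforward (mu2 : set T -> \bar R) (fun x : T => ((x : pt2 R) - a : T))].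
rewrite -[RHS]/(m' mf A).
apply: product_measure_unique => // B C mB mC.
rewrite /m' /= /pushforward /=.
rewrite (_ : _ @^-1` _ = ((fun x => x - a.1) @^-1` B) `*` ((fun x => x - a.2) @^-1` C)); last first.
  by apply/seteqP; split=> -[x y].
rewrite /leb2 product_measure1E.
- by congr (_ * _)%E; exact: leb_shift.
- by rewrite -[_ @^-1` _]setTI; apply: measurable_funB.
- by rewrite -[_ @^-1` _]setTI; apply: measurable_funB.
Qed.

Lemma integrable_shift2 (a : pt2 R) (f : pt2 R -> R) :
  mu2.-integrable setT (EFin \o f) ->
  mu2.-integrable setT (EFin \o (fun x => f (x - a))).
Proof.
move=> intf.
have mf : measurable_fun setT (fun x : pt2 R => x - a).
  apply/measurable_fun_pairP; split; apply: measurable_funB => //.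
pose phi (x : pt2 R) : pt2 R := x - a.
pose T := (measurableTypeR R * measurableTypeR R)%type.
pose m0' := [the {measure set T -> \bar R} of pushforward (mu2 : set T -> \bar R) (fun x : T => (phi (x : pt2 R) : T))].
pose m' := m0' mf.
have shE g : (\int[m']_y g y = \int[mu2]_y g y)%E.
  by apply: eq_measure_integral => A mA _; exact: (leb2_shift a mA).
have mff : measurable_fun setT (EFin \o f) by exact: measurable_int intf.
have phiT : (fun x : T => (phi x : T)) @^-1` [set: T] = setT by exact: preimage_setT.
apply/integrableP; split; first exact: (measurableT_comp mff mf).
have /integrableP[_] := intf; rewrite -shE.
have -> := @ge0_integral_pushforward _ _ T T R (fun x : T => (phi x : T)) mf mu2 setT (abse \o (EFin \o f)).
- by rewrite phiT.
- by [].
- exact: measurableT_comp.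
- by move=> y _; exact: abse_ge0.
Qed.

Lemma Rintegral_shift2 (a : pt2 R) (f : pt2 R -> R) :
  mu2.-integrable setT (EFin \o f) ->
  \int[mu2]_x f (x - a) = \int[mu2]_x f x.
Proof.
move=> intf.
have mf : measurable_fun setT (fun x : pt2 R => x - a).
  apply/measurable_fun_pairP; split; apply: measurable_funB => //.
rewrite /Rintegral; congr fine.
pose phi (x : pt2 R) : pt2 R := x - a.
pose T := (measurableTypeR R * measurableTypeR R)%type.
pose m0' := [the {measure set T -> \bar R} of pushforward (mu2 : set T -> \bar R) (fun x : T => (phi (x : pt2 R) : T))].
pose m' := m0' mf.
have shE g : (\int[m']_y g y = \int[mu2]_y g y)%E.
  by apply: eq_measure_integral => A mA _; exact: (leb2_shift a mA).
have mff : measurable_fun setT (EFin \o f) by exact: measurable_int intf.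
have phiT : (fun x : T => (phi x : T)) @^-1` [set: T] = setT by exact: preimage_setT.
have iphi : mu2.-integrable ((fun x : T => (phi x : T)) @^-1` [set: T]) ((EFin \o f) \o (fun x : T => (phi x : T))).
  by rewrite phiT; exact: (integrable_shift2 a intf).
rewrite -[RHS]shE.
have -> := @integral_pushforward _ _ T T R (fun x : T => (phi x : T)) mf mu2 setT (EFin \o f) mff iphi.
  by rewrite phiT.
by [].
Qed.

Lemma leb2_sigma_finite : sigma_finite setT mu2.
Proof.
exists (fun n => K2 n%:R).
  apply/seteqP; split=> // x _; exists (Num.truncn (2 * `|x.1| + 2 * `|x.2|)).+1 => //.
  have := truncnS_gt (2 * `|x.1| + 2 * `|x.2|).
  have := normr_ge0 x.1; have := normr_ge0 x.2; rewrite /K2/=.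
  by split; lra.
move=> n; split; first exact: measurable_K2.
by rewrite leb2_K2// ltry.
Qed.

End measurable2.

HB.instance Definition _ (R : realType) :=
  Measure.copy (@leb2 R) (lebesgue_measure \x lebesgue_measure)%E.
HB.instance Definition _ (R : realType) :=
  Measure_isSigmaFinite.Build _ _ _ (@leb2 R) (@leb2_sigma_finite R).
HB.instance Definition _ (R : realType) :=
  Measure.copy (@leb3 R) (@leb2 R \x lebesgue_measure)%E.

Section bounded_support.
Context d (T : measurableType d) (R : realType) (mu : {measure set T -> \bar R}).

Lemma bounded_support_integrable (D : set T) (f : T -> R) (M : R) :
  measurable D -> (mu D < +oo)%E -> measurable_fun setT f ->
  (forall x, `|f x| <= M) -> (forall x, ~ D x -> f x = 0) ->
  mu.-integrable setT (EFin \o f).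
Proof.
move=> mD fD mf bf f0.
have -> : f = f \_ D.
  by apply/funext => x; rewrite patchE; case: ifPn => // /negP xD; apply: f0 => Dx; apply: xD; rewrite inE.
rewrite -restrict_EFin; apply: (iffLR (integrable_mkcond _ mD)).
apply: measurable_bounded_integrable => //; first exact: measurable_funTS.
exists M; split; first exact: num_real.
by move=> y My x _ /=; apply: le_trans (bf x) _; exact: ltW.
Qed.

Lemma Rintegral_supp (D : set T) (f : T -> R) :
  (forall x, ~ D x -> f x = 0) -> \int[mu]_(x in D) f x = \int[mu]_x f x.
Proof.
move=> f0; rewrite Rintegral_mkcond; congr (Rintegral _ _ _).
by apply/funext => x; rewrite patchE; case: ifPn => // /negP xD; apply/esym/f0 => Dx; apply: xD; rewrite inE.
Qed.

Lemma integrable_cst_fin (D : set T) (c : R) : measurable D -> (mu D < +oo)%E ->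
  mu.-integrable D (EFin \o cst c).
Proof.
move=> mD fD; apply: measurable_bounded_integrable => //.
by exists `|c|; split; [exact: num_real|move=> M cM x _; exact: ltW].
Qed.

Lemma Rintegral_subset_le (D : set T) (f : T -> R) : measurable D -> (forall x, 0 <= f x) ->
  mu.-integrable setT (EFin \o f) -> \int[mu]_(x in D) f x <= \int[mu]_x f x.
Proof.
move=> mD f0 fi; rewrite Rintegral_mkcond; apply: le_Rintegral => //.
- rewrite -restrict_EFin; apply: (iffLR (integrable_mkcond _ mD)).
  exact: integrableS fi.
- by move=> x _; rewrite patchE; case: ifP.
Qed.

End bounded_support.

(** * Integrals of tensor products *)

Section product_integrals.
Context d1 d2 (T1 : measurableType d1) (T2 : measurableType d2) (R : realType).
Variables (m1 : {sigma_finite_measure set T1 -> \bar R}) (m2 : {sigma_finite_measure set T2 -> \bar R}).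

Lemma integrable_tensor (g : T1 -> R) (k : T2 -> R) :
  m1.-integrable setT (EFin \o g) -> m2.-integrable setT (EFin \o k) ->
  (m1 \x m2)%E.-integrable setT (EFin \o (fun x => g x.1 * k x.2)).
Proof.
move=> ig ik.
have mg : measurable_fun setT g by apply/measurable_EFinP; exact: measurable_int ig.
have mk : measurable_fun setT k by apply/measurable_EFinP; exact: measurable_int ik.
apply/integrable12ltyP.
  by apply/measurable_EFinP; apply: measurable_funM; exact: measurableT_comp.
rewrite (eq_integral (fun x => `|(g x)%:E| * \int[m2]_y `|(k y)%:E|)%E); last first.
  move=> x _; rewrite -ge0_integralZl//=.
  - by apply: eq_integral => y _; rewrite normrM EFinM.
  - by apply/measurable_EFinP; exact: measurableT_comp.
rewrite ge0_integralZr//.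
- by apply: lte_mul_pinfty; [exact: integral_ge0| |];
  [rewrite ge0_fin_numE; [have /integrableP[] := ig|exact: integral_ge0]|have /integrableP[] := ik].
- by apply/measurable_EFinP; exact: measurableT_comp.
- exact: integral_ge0.
Qed.

Lemma Rintegral_tensor (g : T1 -> R) (k : T2 -> R) :
  m1.-integrable setT (EFin \o g) -> m2.-integrable setT (EFin \o k) ->
  \int[(m1 \x m2)%E]_x (g x.1 * k x.2) = (\int[m1]_x g x) * \int[m2]_x k x.
Proof.
move=> ig ik; rewrite {1}/Rintegral -integral12_prod_meas1; last exact: integrable_tensor.
rewrite /fubini_F /=.
rewrite (eq_integral (fun x => (g x)%:E * (\int[m2]_y k y)%:E)%E); last first.
  move=> x _; under eq_integral do rewrite EFinM.
  rewrite integralZl//; congr (_ * _)%E.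
  by rewrite /Rintegral fineK//; exact: integrable_fin_num.
by rewrite integralZr// fineM//; exact: integrable_fin_num.
Qed.

End product_integrals.

(** * Continuous functions supported in a square, and their correlation integrals *)

Section plane.
Variable R : realType.
Local Notation mu1 := (@lebesgue_measure R).
Local Notation mu2 := (@leb2 R).
Local Notation mu3 := (@leb3 R).

Definition csupp1 (r : R) (f : R -> R) := continuous f /\ forall x, ~ itv1 r x -> f x = 0.

Definition csupp2 (r : R) (f : pt2 R -> R) := continuous f /\ forall x, ~ K2 r x -> f x = 0.

Lemma csupp1_bounded r f : 0 <= r -> csupp1 r f -> exists M, forall x, `|f x| <= M.
Proof.
move=> r0 [cf f0].
have [||c _ hc] := @EVT_max R (fun x => `|f x|) (- (r / 2)) (r / 2); first by lra.
  by apply: continuous_subspaceT => x; apply: cvg_norm; exact: cf.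
exists `|f c| => x; have [xr|xr] := boolP (x \in `[(- (r / 2)), (r / 2)]); first exact: hc.
rewrite f0 ?normr0// => h; move/negP: xr; apply.
by move: h; rewrite /itv1 /=; apply: subset_itv_oo_cc.
Qed.

Lemma csupp2_bounded r f : 0 <= r -> csupp2 r f -> exists M, forall x, `|f x| <= M.
Proof.
move=> r0 [cf f0].
pose I := `[(- (r / 2)), (r / 2)]%classic : set R.
have IP x : I x <-> `|x| <= r / 2 by rewrite /I /= in_itv/= -ler_norml.
have [|||c _ hc] := @compact_EVT_max _ R (fun x : pt2 R => `|f x|) (I `*` I).
- by exists (0, 0); split; apply/IP; rewrite normr0; lra.
- by apply: compact_setX; exact: segment_compact.
- by apply: continuous_subspaceT => x; apply: cvg_norm; exact: cf.
exists `|f c| => x; have [xr|xr] := pselect ((I `*` I) x); first by apply: hc; rewrite inE.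
by rewrite f0 ?normr0// => -[h1 h2]; apply: xr; split; apply/IP; exact: ltW.
Qed.

Lemma csupp1_integrable r f : 0 <= r -> csupp1 r f -> mu1.-integrable setT (EFin \o f).
Proof.
move=> r0 cf; have [M hM] := csupp1_bounded r0 cf.
apply: (@bounded_support_integrable _ (measurableTypeR R) R mu1 (itv1 r) f M) => //.
- exact: measurable_itv1.
- by apply: (@le_lt_trans _ _ r%:E); [rewrite -(leb_itv1 r0)|exact: ltry].
- by apply: continuous_measurable_fun; case: cf.
- by case: cf.
Qed.

Lemma csupp2_integrable r f : 0 <= r -> csupp2 r f -> mu2.-integrable setT (EFin \o f).
Proof.
move=> r0 cf; have [M hM] := csupp2_bounded r0 cf.
apply: (@bounded_support_integrable _ (measurableTypeR R * measurableTypeR R)%type R mu2 (K2 r) f M) => //.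
- exact: measurable_K2.
- by apply: (@le_lt_trans _ _ (r ^+ 2)%:E); [rewrite -(leb2_K2 r0)|exact: ltry].
- by apply: continuous_measurable2; case: cf.
- by case: cf.
Qed.

Lemma csupp2D r f g : csupp2 r f -> csupp2 r g -> csupp2 r (fun x => f x + g x).
Proof.
move=> [cf f0] [cg g0]; split; first by move=> x; apply: cvgD; [exact: cf|exact: cg].
by move=> x xr; rewrite f0// g0// addr0.
Qed.

Lemma csupp2N r f : csupp2 r f -> csupp2 r (fun x => - f x).
Proof.
move=> [cf f0]; split; first by move=> x; apply: cvgN; exact: cf.
by move=> x xr; rewrite f0// oppr0.
Qed.

Lemma csupp2B r f g : csupp2 r f -> csupp2 r g -> csupp2 r (fun x => f x - g x).
Proof. by move=> cf cg; apply: csupp2D => //; exact: csupp2N. Qed.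

Lemma csupp2M r (f g : pt2 R -> R) : continuous f -> csupp2 r g -> csupp2 r (fun x => f x * g x).
Proof.
move=> cf [cg g0]; split; first by move=> x; apply: cvgM; [exact: cf|exact: cg].
by move=> x xr; rewrite g0// mulr0.
Qed.

Lemma csupp2X r f n : csupp2 r f -> csupp2 r (fun x => f x ^+ n.+1).
Proof.
move=> [cf f0]; split; last by move=> x xr; rewrite f0// expr0n.
move=> x; apply: (@continuous_comp _ _ _ f (fun y => y ^+ n.+1)); [exact: cf|exact: exprn_continuous].
Qed.

Lemma continuous_shift2 (f : pt2 R -> R) (a : pt2 R) :
  continuous f -> continuous (fun x : pt2 R => f (x + a)).
Proof.
move=> cf x; have : {for x, continuous (f \o (fun x : pt2 R => x + a))}; last by [].
apply: continuous_comp; last exact: cf.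
by apply: cvgD; [exact: cvg_id|exact: cvg_cst].
Qed.

(** Integrating first in [a], translation invariance turns the inner integral into that of [e]. This
    is the averaging device: a bound valid for every translation [a] becomes a product of two
    integrals. *)
Lemma Rintegral_conv2 r s (c e : pt2 R -> R) : 0 <= r -> 0 <= s ->
  csupp2 r c -> csupp2 s e ->
  mu2.-integrable setT (EFin \o (fun a => \int[mu2]_x (c x * e (x + a)))) /\
  \int[mu2]_a (\int[mu2]_x (c x * e (x + a))) = (\int[mu2]_x c x) * \int[mu2]_x e x.
Proof.
move=> r0 s0 cc ce.
have ic := csupp2_integrable r0 cc; have ie := csupp2_integrable s0 ce.
have mc : measurable_fun setT c by apply: continuous_measurable2; case: cc.
have me : measurable_fun setT e by apply: continuous_measurable2; case: ce.
pose f (z : pt2 R * pt2 R) := c z.2 * e (z.2 + z.1).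
have mf : measurable_fun setT f.
  apply: measurable_funM; first exact: measurableT_comp.
  apply: (measurableT_comp me); apply/measurable_fun_pairP; split; apply: measurable_funD => /=.
  - exact: (measurableT_comp measurable_fst measurable_snd).
  - exact: (measurableT_comp measurable_fst measurable_fst).
  - exact: (measurableT_comp measurable_snd measurable_snd).
  - exact: (measurableT_comp measurable_snd measurable_fst).
have sh (g : pt2 R -> R) x : mu2.-integrable setT (EFin \o g) -> \int[mu2]_y g (x + y) = \int[mu2]_y g y.
  move=> ig; rewrite -(Rintegral_shift2 (- x) ig); congr (Rintegral _ _ _).
  by apply/funext => y; rewrite opprK addrC.
have shi (g : pt2 R -> R) x : mu2.-integrable setT (EFin \o g) ->
    mu2.-integrable setT (EFin \o (fun y => g (x + y))).
  by move=> ig; have := integrable_shift2 (- x) ig; apply: eq_integrable => // y _ /=; rewrite opprK addrC.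
have ice : mu2.-integrable setT (EFin \o (fun x => `|c x|)) by exact: (integrable_norm ic).
have iee : mu2.-integrable setT (EFin \o (fun x => `|e x|)) by exact: (integrable_norm ie).
have absE x : (\int[mu2]_y `|(f (y, x))%:E| = (`|c x| * \int[mu2]_y `|e y|)%:E)%E.
  transitivity (\int[mu2]_y (`|c x|%:E * `|e (x + y)|%:E))%E.
    by apply: eq_integral => y _; rewrite /f /= normrM EFinM.
  rewrite integralZl//; last exact: (shi (fun x => `|e x|)).
  rewrite EFinM; congr (_ * _)%E; rewrite -(sh (fun x => `|e x|) x)// /Rintegral fineK//.
  by apply: integrable_fin_num => //; exact: (shi (fun x => `|e x|)).
(* Joint integrability is checked in the order where the inner integral of the absolute value is
   [|c x|] times a constant. *)
have intf : (mu2 \x mu2)%E.-integrable setT (EFin \o f).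
  apply/integrable21ltyP; first exact/measurable_EFinP.
  rewrite [ltLHS](_ : _ = \int[mu2]_x (`|c x| * \int[mu2]_y `|e y|)%:E)%E; last first.
    by apply: eq_integral => x _; exact: absE.
  apply: integrable_lty => //; under eq_fun do rewrite EFinM.
  by apply: integrableZr.
have GE : fubini_F mu2 (EFin \o f) = EFin \o (fun a => \int[mu2]_x (c x * e (x + a))).
  apply/funext => a; rewrite /fubini_F /= /Rintegral fineK//.
  apply: integrable_fin_num => //.
  apply: (csupp2_integrable r0).
  rewrite (_ : (fun x => _) = (fun x => e (x + a) * c x)); last by apply/funext => x; rewrite mulrC.
  by apply: csupp2M => //; apply: continuous_shift2; case: ce.
split; first by rewrite -GE; exact: integrable_fubini_F.
rewrite /Rintegral.
transitivity (fine (\int[mu2]_a fubini_F mu2 (EFin \o f) a)%E).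
  by rewrite GE.
rewrite integral12_prod_meas1// -integral21_prod_meas1//.
transitivity (fine (\int[mu2]_x ((c x)%:E * (\int[mu2]_y e y)%:E))%E).
  congr fine; apply: eq_integral => x _; rewrite /fubini_G /= -(sh e x ie) /Rintegral fineK; last first.
    by apply: integrable_fin_num => //; exact: (shi e).
  by rewrite -integralZl//; exact: (shi e).
by rewrite integralZr// fineM//; exact: integrable_fin_num.
Qed.

End plane.

(** * Ladyzhenskaya inequality and the energy on H^1_0 *)

Section one_dim.
Variable R : realType.
Local Notation mu1 := (@lebesgue_measure R).
Local Notation mu2 := (@leb2 R).

Lemma smooth1_is_derive (F : R -> R) (x : R) : smooth F -> is_derive x 1 F ('D_1 F x).
Proof.
by move=> sF; apply/derivableP/derivable1_diffP; exact: smooth_differentiable.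
Qed.

Lemma smooth1_FTC (F : R -> R) (a b : R) : smooth F -> a < b ->
  \int[mu1]_(x in `[a, b]) 'D_1 F x = F b - F a.
Proof.
move=> sF ab; rewrite /Rintegral (@continuous_FTC2 _ _ F)//.
- apply: continuous_subspaceT. exact: (smooth_continuous (smooth_derive (1 : R) sF)).
- split=> [x _||]; first by have [] := smooth1_is_derive x sF.
    by apply: cvg_at_right_filter; exact: smooth_continuous.
  by apply: cvg_at_left_filter; exact: smooth_continuous.
- by move=> x _; rewrite derive1E.
Qed.

Lemma derive_supp (V : normedModType R) (f : V -> R) (U : set V) v :
  open U -> (forall x, U x -> f x = 0) -> forall x, U x -> 'D_v f x = 0.
Proof.
move=> oU f0 x Ux; rewrite -(derive_cst (0 : R) x v); apply: near_eq_derive.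
by apply: filterS (open_nbhs_nbhs (conj oU Ux)) => y Uy; rewrite f0.
Qed.

Definition Cc1 (r : R) (f : R -> R) :=
  smooth f /\ exists2 d : R, 0 < d & forall x, ~ `|x| <= r / 2 - d -> f x = 0.

Lemma Cc1_csupp r f : Cc1 r f -> csupp1 r f.
Proof.
move=> [sf [d d0 f0]]; split; first exact: smooth_continuous.
by move=> x xr; apply: f0 => h; apply: xr; apply/itv1P; lra.
Qed.

Lemma Cc1_derive r f : Cc1 r f -> Cc1 r (fun x => 'D_1 f x).
Proof.
move=> [sf [d d0 f0]]; split; first exact: smooth_derive.
exists d => // x xd; apply: (@derive_supp _ f [set y | r / 2 - d < `|y|]).
- apply: (@open_comp _ _ (fun y : R => `|y|) [set t : R | r / 2 - d < t]); last exact: open_gt.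
  by move=> y _; exact: (@norm_continuous _ R y).
- by move=> y /= h; apply: f0; move=> h'; lra.
- by rewrite /= ltNge; apply/negP.
Qed.

Lemma Cc1D r f g : Cc1 r f -> Cc1 r g -> Cc1 r (fun x => f x + g x).
Proof.
move=> [sf [d d0 f0]] [sg [e e0 g0]]; split; first exact: smoothD.
exists (Num.min d e); first by rewrite lt_min d0.
by move=> x xr; rewrite f0 ?g0 ?addr0// => h; apply: xr; apply: le_trans h _;
  rewrite lerD2l lerN2 ge_min lexx ?orbT.
Qed.

Lemma Cc1M r f g : smooth f -> Cc1 r g -> Cc1 r (fun x => f x * g x).
Proof.
move=> sf [sg [e e0 g0]]; split; first exact: smoothM.
by exists e => // x xr; rewrite g0// mulr0.
Qed.

Lemma Cc1_integrable r f : 0 <= r -> Cc1 r f -> mu1.-integrable setT (EFin \o f).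
Proof. by move=> r0 cf; apply: (csupp1_integrable r0); exact: Cc1_csupp. Qed.

Lemma Cc1_int_derive r f : 0 < r -> Cc1 r f -> \int[mu1]_x 'D_1 f x = 0.
Proof.
move=> r0 cf; have [_ df0] := Cc1_csupp (Cc1_derive cf).
transitivity (\int[mu1]_(x in `[- r, r]) 'D_1 f x).
  apply/esym/Rintegral_supp => x xr; apply: df0 => /itv1P xr2; apply: xr.
  by rewrite /= in_itv/= -ler_norml; lra.
rewrite smooth1_FTC; [|by case: cf|lra].
have [_ f0] := Cc1_csupp cf.
by rewrite !f0 ?subrr// => /itv1P; rewrite ?normrN gtr0_norm//; lra.
Qed.

(** Integrate (f^2)' = 2 f f' <= f^2 + f'^2 from [- r], a point outside the support, up to [x]. *)
Lemma Cc1_sqr_le r f x : 0 < r -> Cc1 r f ->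
  f x ^+ 2 <= \int[mu1]_y (f y ^+ 2 + 'D_1 f y ^+ 2).
Proof.
move=> r0 cf; have cdf := Cc1_derive cf.
have [sf _] := cf; have [sdf _] := cdf.
have C2 : Cc1 r (fun y => f y ^+ 2 + 'D_1 f y ^+ 2).
  by apply: Cc1D; (under eq_fun do rewrite expr2); exact: Cc1M.
have [_ f0] := Cc1_csupp cf.
have I0 : 0 <= \int[mu1]_y (f y ^+ 2 + 'D_1 f y ^+ 2).
  by apply: Rintegral_ge0 => y _; rewrite addr_ge0// sqr_ge0.
have [xr|/f0 ->] := pselect (itv1 r x); last by rewrite expr0n.
have {}xr : - r < x by move: xr => /itv1P; rewrite ltr_norml; lra.
have -> : f x ^+ 2 = \int[mu1]_(y in `[- r, x]) 'D_1 (fun y => f y ^+ 2) y.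
  rewrite smooth1_FTC//; last by under eq_fun do rewrite expr2; exact: smoothM.
  by rewrite (f0 (- r)) ?expr0n/= ?subr0// => /itv1P; rewrite normrN gtr0_norm//; lra.
have dE y : 'D_1 (fun y => f y ^+ 2) y = 2 * (f y * 'D_1 f y).
  rewrite (_ : (fun y => f y ^+ 2) = f * f); last by apply/funext => z; rewrite expr2.
  have [df _] := smooth1_is_derive y sf.
  by rewrite deriveM// /GRing.scale/=; ring.
have smf : Cc1 r (fun y => 'D_1 (fun y => f y ^+ 2) y).
  rewrite (_ : (fun y => _) = (fun y => 2 * (f y * 'D_1 f y))); last by apply/funext.
  by apply: Cc1M; [exact: smooth_cst|exact: Cc1M].
have i2 := Cc1_integrable (ltW r0) C2.
apply: (@le_trans _ _ (\int[mu1]_(y in `[- r, x]) (f y ^+ 2 + 'D_1 f y ^+ 2))).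
  apply: le_Rintegral => //.
  - apply: integrableS (Cc1_integrable (ltW r0) smf) => //.
  - apply: integrableS i2 => //.
  by move=> y _; rewrite dE; have := sqr_ge0 (f y - 'D_1 f y); rewrite sqrrB; lra.
rewrite Rintegral_mkcond; apply: le_Rintegral => //.
- rewrite -restrict_EFin; apply: (iffLR (integrable_mkcond _ _)) => //.
  apply: integrableS i2 => //.
- by move=> y _; rewrite patchE; case: ifP => // _; rewrite addr_ge0// sqr_ge0.
Qed.

End one_dim.

Section compactly_supported2.
Variable R : realType.
Local Notation mu1 := (@lebesgue_measure R).
Local Notation mu2 := (@leb2 R).

Lemma Cc2_csupp r (f : pt2 R -> R) : Cc2 r f -> csupp2 r f.
Proof.
move=> [sf [d d0 f0]]; split; first exact: smooth_continuous.
by move=> x xr; apply: f0 => -[h1 h2]; apply: xr; split; lra.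
Qed.

Lemma Cc2_derive r (f : pt2 R -> R) v : Cc2 r f -> Cc2 r (fun x => 'D_v f x).
Proof.
move=> [sf [d d0 f0]]; split; first exact: smooth_derive.
exists d => // x xd.
have oU (g : pt2 R -> R) : continuous g -> open [set y : pt2 R | r / 2 - d < `|g y|].
  move=> cg; apply: (@open_comp _ _ (fun y => `|g y|) [set t : R | r / 2 - d < t]); last exact: open_gt.
  by move=> y _; apply: (continuous_comp (cg y)); exact: (@norm_continuous _ R).
apply: (@derive_supp R _ f ([set y | r / 2 - d < `|y.1|] `|` [set y | r / 2 - d < `|y.2|])).
- by apply: openU; apply: oU => y; [exact: cvg_fst|exact: cvg_snd].
- by move=> y /= h; apply: f0 => -[h1 h2]; case: h; lra.
- rewrite /=; apply: contrapT => h; apply: xd.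
  by split; rewrite leNgt; apply/negP => h'; apply: h; [left|right].
Qed.

Lemma Cc2D r (f g : pt2 R -> R) : Cc2 r f -> Cc2 r g -> Cc2 r (fun x => f x + g x).
Proof.
move=> [sf [d d0 f0]] [sg [e e0 g0]]; split; first exact: smoothD.
exists (Num.min d e); first by rewrite lt_min d0.
by move=> x xr; rewrite f0 ?g0 ?addr0// => -[h1 h2]; apply: xr; split;
  [apply: le_trans h1 _|apply: le_trans h2 _|apply: le_trans h1 _|apply: le_trans h2 _];
  rewrite lerD2l lerN2 ge_min lexx ?orbT.
Qed.

Lemma Cc2N r (f : pt2 R -> R) : Cc2 r f -> Cc2 r (fun x => - f x).
Proof.
move=> [sg [e e0 g0]]; split; first exact: smoothN.
by exists e => // x xr; rewrite g0// oppr0.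
Qed.

Lemma Cc2B r (f g : pt2 R -> R) : Cc2 r f -> Cc2 r g -> Cc2 r (fun x => f x - g x).
Proof. by move=> cf cg; apply: Cc2D => //; exact: Cc2N. Qed.

Lemma Cc2_0 r : Cc2 r (fun _ : pt2 R => 0).
Proof. by split; [exact: smooth_cst|exists 1]. Qed.

Lemma Cc2_slice1 r (f : pt2 R -> R) y : Cc2 r f -> Cc1 r (fun x => f (x, y)).
Proof.
move=> [sf [d d0 f0]]; split; first exact: (smooth_affine (@affine_pairl R R R y) sf).
by exists d => // x xd; apply: f0 => -[].
Qed.

Lemma Cc2_slice2 r (f : pt2 R -> R) x : Cc2 r f -> Cc1 r (fun y => f (x, y)).
Proof.
move=> [sf [d d0 f0]]; split; first exact: (smooth_affine (@affine_pairr R R R x) sf).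
by exists d => // y xd; apply: f0 => -[].
Qed.

Lemma derive_slice1 (f : pt2 R -> R) x y : 'D_1 (fun x => f (x, y)) x = 'D_(e21 R) f (x, y).
Proof. exact: (derive_affine f x (1 : R) (@affine_pairl R R R y)). Qed.

Lemma derive_slice2 (f : pt2 R -> R) x y : 'D_1 (fun y => f (x, y)) y = 'D_(e22 R) f (x, y).
Proof. exact: (derive_affine f y (1 : R) (@affine_pairr R R R x)). Qed.

(** Both orders of integration are recorded because the Ladyzhenskaya inequality integrates one
    factor in each order. *)
Lemma csupp2_fubini r (h : pt2 R -> R) : 0 <= r -> csupp2 r h ->
  [/\ mu1.-integrable setT (EFin \o (fun x => \int[mu1]_y h (x, y))),
      mu1.-integrable setT (EFin \o (fun y => \int[mu1]_x h (x, y))),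
      \int[mu1]_x (\int[mu1]_y h (x, y)) = \int[mu2]_z h z &
      \int[mu1]_y (\int[mu1]_x h (x, y)) = \int[mu2]_z h z].
Proof.
move=> r0 ch; have ih := csupp2_integrable r0 ch.
have s1 y : csupp1 r (fun x => h (x, y)).
  case: ch => ch h0; split; last by move=> x xr; apply: h0 => -[/itv1P].
  move=> x; apply: (@continuous_comp _ _ _ (fun x : R => (x, y) : pt2 R) h); last exact: ch.
  exact: differentiable_continuous ((@affine_pairl R R R y).2 x).
have s2 x : csupp1 r (fun y => h (x, y)).
  case: ch => ch h0; split; last by move=> y xr; apply: h0 => -[_ /itv1P].
  move=> y; apply: (@continuous_comp _ _ _ (fun y : R => (x, y) : pt2 R) h); last exact: ch.
  exact: differentiable_continuous ((@affine_pairr R R R x).2 y).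
have FE : fubini_F mu1 (EFin \o h) = EFin \o (fun x => \int[mu1]_y h (x, y)).
  apply/funext => x; rewrite /fubini_F /= /Rintegral fineK//.
  by apply: integrable_fin_num => //; exact: csupp1_integrable (s2 x).
have GE : fubini_G mu1 (EFin \o h) = EFin \o (fun y => \int[mu1]_x h (x, y)).
  apply/funext => x; rewrite /fubini_G /= /Rintegral fineK//.
  by apply: integrable_fin_num => //; exact: csupp1_integrable (s1 x).
split.
- by rewrite -FE; exact: integrable_fubini_F.
- rewrite -GE; apply/integrableP; split; first apply: (measurable_fubini_G ih).
  have iha : (mu1 \x mu1)%E.-integrable setT (abse \o (EFin \o h)) by exact: integrable_abse.
  apply: (@le_lt_trans _ _ (\int[mu1]_y fubini_G mu1 (abse \o (EFin \o h)) y)%E).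
    apply: ge0_le_integral => //.
    + by apply: measurableT_comp => //; apply: (measurable_fubini_G ih).
    + by apply: (measurable_fubini_G iha).
    + by move=> y _; apply: le_abse_integral => //; apply/measurable_EFinP;
        apply: continuous_measurable_fun; case: (s1 y).
  by rewrite integral21_prod_meas1//; exact: integrable_lty.
- by rewrite {1}/Rintegral [X in fine X](_ : _ = \int[mu1]_x fubini_F mu1 (EFin \o h) x)%E;
    [rewrite integral12_prod_meas1|rewrite FE].
- by rewrite {1}/Rintegral [X in fine X](_ : _ = \int[mu1]_y fubini_G mu1 (EFin \o h) y)%E;
    [rewrite integral21_prod_meas1|rewrite GE].
Qed.

(* Ladyzhenskaya: |f(x,y)|^2 is bounded by a function of x alone and by a function of y alone *)
Lemma ladyzhenskaya r (f : pt2 R -> R) : 0 < r -> Cc2 r f ->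
  \int[mu2]_x f x ^+ 4 <= (\int[mu2]_x (f x ^+ 2 + 'D_(e21 R) f x ^+ 2)) *
                          (\int[mu2]_x (f x ^+ 2 + 'D_(e22 R) f x ^+ 2)).
Proof.
move=> r0 cf; have r0' := ltW r0.
have c1 := Cc2_csupp cf.
have cs v : csupp2 r (fun x => f x ^+ 2 + 'D_v f x ^+ 2).
  by apply: csupp2D; apply: csupp2X => //; apply: Cc2_csupp; exact: Cc2_derive.
have [_ iA _ EA] := csupp2_fubini r0' (cs (e21 R)).
have [iB _ EB _] := csupp2_fubini r0' (cs (e22 R)).
rewrite -EA -EB mulrC -(Rintegral_tensor iB iA).
apply: le_Rintegral => //.
- exact: csupp2_integrable (csupp2X 3 c1).
- exact: (integrable_tensor iB iA).
move=> [x y] _ /=; rewrite (_ : 4 = 2 + 2)%N// exprD.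
apply: ler_pM; rewrite ?sqr_ge0//.
- under eq_Rintegral do rewrite -derive_slice2.
  exact: (Cc1_sqr_le y r0 (Cc2_slice2 x cf)).
- under eq_Rintegral do rewrite -derive_slice1.
  exact: (Cc1_sqr_le x r0 (Cc2_slice1 y cf)).
Qed.

End compactly_supported2.

(** * Domination, linear combinations, lower semicontinuity of the L^4 norm *)

Section integral_tools.
Context d (T : measurableType d) (R : realType) (mu : {measure set T -> \bar R}).
Variables (D : set T) (mD : measurable D).
Implicit Types f g h : T -> R.

Lemma ge0_integrable f : measurable_fun D f -> (forall x, D x -> 0 <= f x) ->
  (\int[mu]_(x in D) (f x)%:E < +oo)%E -> mu.-integrable D (EFin \o f).
Proof.
move=> mf f0 fi; apply/integrableP; split; first exact/measurable_EFinP.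
rewrite (eq_integral (EFin \o f))//= => x; rewrite inE => Dx.
by rewrite ger0_norm// f0.
Qed.

Lemma dominated_integrable f g : measurable_fun D f ->
  mu.-integrable D (EFin \o g) -> (forall x, D x -> `|f x| <= g x) ->
  mu.-integrable D (EFin \o f).
Proof.
move=> mf ig fg; apply: le_integrable ig => //; first exact/measurable_EFinP.
move=> x Dx; rewrite /= lee_fin (le_trans (fg x Dx))//.
exact: ler_norm.
Qed.

Lemma EFin_Rintegral f : mu.-integrable D (EFin \o f) ->
  (\int[mu]_(x in D) f x)%:E = (\int[mu]_(x in D) (f x)%:E)%E.
Proof. by move=> fi; rewrite /Rintegral fineK//; exact: integrable_fin_num. Qed.

Lemma integrable_lin2 f g a b : mu.-integrable D (EFin \o f) ->
  mu.-integrable D (EFin \o g) -> mu.-integrable D (EFin \o (fun x => a * f x + b * g x)).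
Proof.
move=> fi gi; have := integrableD mD (integrableZl mD a fi) (integrableZl mD b gi).
by apply: eq_integrable.
Qed.

Lemma Rintegral_lin2 f g a b : mu.-integrable D (EFin \o f) ->
  mu.-integrable D (EFin \o g) ->
  \int[mu]_(x in D) (a * f x + b * g x) =
  a * (\int[mu]_(x in D) f x) + b * \int[mu]_(x in D) g x.
Proof.
move=> fi gi; rewrite RintegralD//.
- by rewrite !RintegralZl.
- by have := integrableZl mD a fi; apply: eq_integrable.
- by have := integrableZl mD b gi; apply: eq_integrable.
Qed.

Lemma le_Rintegral_lin2 f g h a b : mu.-integrable D (EFin \o f) ->
  mu.-integrable D (EFin \o g) -> mu.-integrable D (EFin \o h) ->
  (forall x, D x -> f x <= a * g x + b * h x) ->
  \int[mu]_(x in D) f x <= a * (\int[mu]_(x in D) g x) + b * \int[mu]_(x in D) h x.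
Proof.
move=> fi gi hi fgh; rewrite -Rintegral_lin2//; apply: le_Rintegral => //.
exact: integrable_lin2.
Qed.

(* On the part of D where |f| <= n the convexity inequality F^4 >= f^4 + 4 f^3 (F - f) can be
   integrated. *)
Lemma L4_lsc f (C : R) : (mu D < +oo)%E -> measurable_fun D f ->
  (forall e, 0 < e -> exists F : T -> R, [/\ measurable_fun D F,
     (\int[mu]_(x in D) (F x ^+ 4)%:E <= C%:E)%E &
     (\int[mu]_(x in D) ((F x - f x) ^+ 2)%:E < e%:E)%E]) ->
  (\int[mu]_(x in D) (f x ^+ 4)%:E <= C%:E)%E.
Proof.
move=> muD mf H.
pose Dn (n : nat) := D `&` [set x | `|f x| <= n%:R].
have mDn n : measurable (Dn n).
  rewrite (_ : Dn n = D `&` (Num.norm \o f) @^-1` `]-oo, n%:R]%classic); last first.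
    by apply/seteqP; split=> x /=; rewrite /Dn in_itv/=.
  have mn : measurable_fun D (Num.norm \o f) by exact: measurableT_comp.
  by apply: mn => //; exact: measurable_itv.
have DnD n : Dn n `<=` D by move=> x [].
have m4 g : measurable_fun D g -> measurable_fun D (fun x => (g x ^+ 4)%:E).
  by move=> mg; apply/measurable_EFinP; exact: measurable_funX.
have cD : \bigcup_n Dn n = D.
  apply/seteqP; split=> [x [n _ []]//|x Dx]; exists (Num.truncn `|f x|).+1 => //.
  by split => //=; apply/ltW/truncnS_gt.
have Dn_nd : nondecreasing_seq Dn.
  move=> m n mn; apply/subsetPset => x [Dx xm]; split => //=.
  by apply: le_trans xm _; rewrite ler_nat.
suff Hn n : (\int[mu]_(x in Dn n) (f x ^+ 4)%:E <= C%:E)%E.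
  have := @ge0_nondecreasing_set_cvg_integral _ _ _ Dn (fun x => (f x ^+ 4)%:E) mu Dn_nd mDn.
  rewrite cD => cv; apply: cvge_le (cv _ _).
  - by near=> n; exact: Hn.
  - by move=> n; apply: (measurable_funS mD (@DnD _) (m4 _ mf)).
  - by move=> n x _; rewrite lee_fin exprn_even_ge0.
apply/lee_addgt0Pr => e e0.
have muDf : mu D \is a fin_num by rewrite ge0_fin_numE.
set m := fine (mu D).
have m0 : 0 <= m by rewrite fine_ge0.
(* The error [e] is split in two: [lam] integrated over [D] costs at most e/2, and [K] times a
   squared L^2 distance below e/2/(K+1) costs at most e/2. Adding 1 keeps the denominators
   positive. *)
pose lam := e / 2 / (m + 1).
have lam0 : 0 < lam by rewrite /lam; apply: divr_gt0; lra.
pose K := 4 * n%:R ^+ 6 / lam.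
have K0 : 0 <= K by apply: divr_ge0; [apply: mulr_ge0 => //; exact: exprn_ge0|exact: ltW].
have e1 : 0 < e / 2 / (K + 1) by apply: divr_gt0; lra.
have [F [mF F4 F2]] := H _ e1.
have mFf : measurable_fun D (fun x => ((F x - f x) ^+ 2)%:E).
  by apply/measurable_EFinP; apply: measurable_funX; exact: measurable_funB.
apply: (@le_trans _ _ (\int[mu]_(x in Dn n) ((F x ^+ 4)%:E + (lam%:E + K%:E * ((F x - f x) ^+ 2)%:E)))%E).
  apply: ge0_le_integral => //.
  - by move=> x _; rewrite lee_fin exprn_even_ge0.
  - exact: (measurable_funS mD (@DnD _) (m4 _ mf)).
  - apply: emeasurable_funD; first exact: (measurable_funS mD (@DnD _) (m4 _ mF)).
    apply: emeasurable_funD; first exact: measurable_cst.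
    by apply: measurable_funeM; exact: (measurable_funS mD (@DnD _) mFf).
  move=> x [Dx xn]; rewrite -EFinM -!EFinD lee_fin.
  have h1 : f x ^+ 4 + 4 * f x ^+ 3 * (F x - f x) <= F x ^+ 4.
    rewrite -subr_ge0 (_ : _ - _ = (F x - f x) ^+ 2 * ((F x + f x) ^+ 2 + 2 * f x ^+ 2)); last by ring.
    by rewrite mulr_ge0 ?sqr_ge0// addr_ge0 ?sqr_ge0// mulr_ge0// sqr_ge0.
  have h2 : f x ^+ 6 <= n%:R ^+ 6.
    rewrite -[f x ^+ 6]ger0_norm ?exprn_even_ge0// normrX.
    by apply: lerXn2r; rewrite ?nnegrE.
  (* Young's inequality with weight [lam] for the linear term of the convexity inequality. *)
  have h3 : - (4 * f x ^+ 3 * (F x - f x)) <= lam + 4 * f x ^+ 6 / lam * (F x - f x) ^+ 2.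
    rewrite -subr_ge0 (_ : _ - _ = lam^-1 * (lam + 2 * f x ^+ 3 * (F x - f x)) ^+ 2); last first.
      by field; exact: lt0r_neq0.
    by rewrite mulr_ge0 ?sqr_ge0// invr_ge0 ltW.
  have h4 : 4 * f x ^+ 6 / lam * (F x - f x) ^+ 2 <= K * (F x - f x) ^+ 2.
    by apply: ler_wpM2r; rewrite ?sqr_ge0// /K ler_wpM2r ?invr_ge0 ?(ltW lam0)// ler_wpM2l.
  lra.
rewrite ge0_integralD//; last 4 first.
- by move=> x _; rewrite lee_fin exprn_even_ge0.
- exact: (measurable_funS mD (@DnD _) (m4 _ mF)).
- by move=> x _; rewrite -EFinM -!EFinD lee_fin addr_ge0 ?(ltW lam0)// mulr_ge0 ?sqr_ge0.
- apply: emeasurable_funD; first exact: measurable_cst.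
  by apply: measurable_funeM; exact: (measurable_funS mD (@DnD _) mFf).
apply: leeD.
  apply: le_trans F4; apply: ge0_subset_integral => //; first exact: m4.
  by move=> x _; rewrite lee_fin exprn_even_ge0.
rewrite ge0_integralD//; last 3 first.
- by move=> x _; rewrite lee_fin ltW.
- by move=> x _; rewrite -EFinM lee_fin mulr_ge0 ?sqr_ge0.
- by apply: measurable_funeM; exact: (measurable_funS mD (@DnD _) mFf).
rewrite integral_cst// ge0_integralZl_EFin//; last 2 first.
- by move=> x _; rewrite lee_fin sqr_ge0.
- exact: (measurable_funS mD (@DnD _) mFf).
rewrite [e in leRHS](splitr e) EFinD; apply: leeD.
  apply: (@le_trans _ _ (lam%:E * mu D)%E).
    by apply: lee_wpmul2l; [rewrite lee_fin ltW|apply: le_measure; rewrite ?inE].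
  rewrite -(fineK muDf) -EFinM lee_fin -/m /lam mulrAC ler_pdivrMr ?ltr_wpDl//.
  by apply: ler_wpM2l; lra.
apply: (@le_trans _ _ (K%:E * (e / 2 / (K + 1))%:E)%E).
  apply: lee_wpmul2l; first by rewrite lee_fin.
  apply: le_trans (ltW F2); apply: ge0_subset_integral => //.
  by move=> x _; rewrite lee_fin sqr_ge0.
rewrite -EFinM lee_fin mulrA ler_pdivrMr ?ltr_wpDl// mulrC.
by apply: ler_wpM2l; lra.
Unshelve. all: by end_near. Qed.

End integral_tools.

Ltac mfun_with tac := repeat (cbv beta; lazymatch goal with
  | |- measurable_fun _ (fun x => (@?f x + @?g x)%R) => apply: (@measurable_funD _ _ _ _ f g)
  | |- measurable_fun _ (fun x => (- @?f x)%R) => apply: (@measurable_funN _ _ _ _ f)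
  | |- measurable_fun _ (fun x => (@?f x * @?g x)%R) => apply: (@measurable_funM _ _ _ _ f g)
  | |- measurable_fun _ (fun x => (@?f x ^+ _)%R) => apply: (@measurable_funX _ _ _ _ f)
  | |- measurable_fun _ _ => solve [tac | assumption | exact: measurable_cst]
  end).

Section scalar_inequalities.
Variable R : realType.
Implicit Types a b c u v : R.

Lemma sqrB_le a b c : (a - b) ^+ 2 <= 2 * (b - c) ^+ 2 + 2 * (a - c) ^+ 2.
Proof. by have := sqr_ge0 (a + b - 2 * c); lra. Qed.

(** Two approximants [a] and [b] of the same limit [c] are compared; the extra squares stand for the
    other components of [dist0] and, in the next variants, of [dist1]. *)
Lemma sqrB_le_dist0l a b c u v :
  (a - b) ^+ 2 <= 2 * ((b - c) ^+ 2 + u ^+ 2) + 2 * ((a - c) ^+ 2 + v ^+ 2).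
Proof. by have := sqrB_le a b c; have := sqr_ge0 u; have := sqr_ge0 v; lra. Qed.

Lemma sqrB_le_dist0r a b c u v :
  (a - b) ^+ 2 <= 2 * (u ^+ 2 + (b - c) ^+ 2) + 2 * (v ^+ 2 + (a - c) ^+ 2).
Proof. by have := sqrB_le a b c; have := sqr_ge0 u; have := sqr_ge0 v; lra. Qed.

Lemma sqrB_le_dist1l a b c a' b' c' u v u' v' :
  (a - b) ^+ 2 + (a' - b') ^+ 2 <=
  2 * ((b - c) ^+ 2 + (b' - c') ^+ 2 + u ^+ 2 + u' ^+ 2) +
  2 * ((a - c) ^+ 2 + (a' - c') ^+ 2 + v ^+ 2 + v' ^+ 2).
Proof.
have := sqrB_le a b c; have := sqrB_le a' b' c'.
have := sqr_ge0 u; have := sqr_ge0 v; have := sqr_ge0 u'; have := sqr_ge0 v'; lra.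
Qed.

Lemma sqrB_le_dist1r a b c a' b' c' u v u' v' :
  (a - b) ^+ 2 + (a' - b') ^+ 2 <=
  2 * (u ^+ 2 + u' ^+ 2 + (b - c) ^+ 2 + (b' - c') ^+ 2) +
  2 * (v ^+ 2 + v' ^+ 2 + (a - c) ^+ 2 + (a' - c') ^+ 2).
Proof.
have := sqrB_le a b c; have := sqrB_le a' b' c'.
have := sqr_ge0 u; have := sqr_ge0 v; have := sqr_ge0 u'; have := sqr_ge0 v'; lra.
Qed.

End scalar_inequalities.

(** * Approximation in H^1_0 controls the L^4 distance *)

Section H10_2_theory.
Variable R : realType.
Local Notation mu2 := (@leb2 R).
Local Notation D1 f x := (derive f x (e21 R)).
Local Notation D2 f x := (derive f x (e22 R)).

Lemma cvge0_lt (u : nat -> \bar R) (e : R) : u @ \oo --> 0%E -> 0 < e ->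
  \forall n \near \oo, (u n < e%:E)%E.
Proof.
move=> cu e0; apply: (cu [set y | (y < e%:E)%E]).
by apply: open_nbhs_nbhs; split; [exact: open_ereal_lt_ereal|rewrite /= lte_fin].
Qed.

Variable r : R.
Hypothesis r0 : 0 < r.
Let r0' : 0 <= r := ltW r0.
Let mK : measurable (K2 r) := measurable_K2 r.

Lemma leb2_K2_fin : (mu2 (K2 r) < +oo)%E.
Proof. by apply: (@le_lt_trans _ _ (r ^+ 2)%:E); [rewrite -(leb2_K2 r0')|exact: ltry]. Qed.

Lemma csupp2_integrableK (f : pt2 R -> R) : csupp2 r f -> mu2.-integrable (K2 r) (EFin \o f).
Proof. by move=> cf; apply: integrableS (csupp2_integrable r0' cf). Qed.

Lemma Cc2_mfun (D : set (pt2 R)) (f : pt2 R -> R) : Cc2 r f -> measurable_fun D f.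
Proof.
by move=> [sf _]; apply: measurable_funTS; apply: continuous_measurable2; exact: smooth_continuous.
Qed.

Lemma Cc2_mfun_derive (D : set (pt2 R)) (f : pt2 R -> R) v : Cc2 r f ->
  measurable_fun D (fun x => 'D_v f x).
Proof. by move=> /(Cc2_derive v); exact: Cc2_mfun. Qed.

(** Each factor of the Ladyzhenskaya bound is at most [2 * e], being the mass plus one partial
    derivative. *)
Lemma Cc2_L4 (f : pt2 R -> R) (e : R) : Cc2 r f ->
  (\int[mu2]_(x in K2 r) (f x ^+ 2)%:E <= e%:E)%E ->
  (\int[mu2]_(x in K2 r) (D1 f x ^+ 2 + D2 f x ^+ 2)%:E <= e%:E)%E ->
  (\int[mu2]_(x in K2 r) (f x ^+ 4)%:E <= (4 * e ^+ 2)%:E)%E.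
Proof.
move=> cf h0 h1.
have c0 n : csupp2 r (fun x => f x ^+ n.+1) by apply: csupp2X; exact: Cc2_csupp.
have cD v : csupp2 r (fun x => 'D_v f x ^+ 2) by apply: csupp2X; apply: Cc2_csupp; exact: Cc2_derive.
have toK g : csupp2 r g -> \int[mu2]_x g x = \int[mu2]_(x in K2 r) g x.
  by move=> [_ g0]; rewrite Rintegral_supp.
rewrite -EFin_Rintegral//; last exact: csupp2_integrableK.
have hs v : (forall x, 'D_v f x ^+ 2 <= D1 f x ^+ 2 + D2 f x ^+ 2) ->
    \int[mu2]_x (f x ^+ 2 + 'D_v f x ^+ 2) <= 2 * e.
  move=> hv; rewrite toK; last exact: csupp2D.
  rewrite RintegralD//; last 2 first.
  - exact: csupp2_integrableK.
  - exact: csupp2_integrableK.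
  rewrite mulr2n mulrDl mul1r; apply: lerD.
    rewrite -lee_fin EFin_Rintegral//; exact: csupp2_integrableK.
  rewrite -lee_fin EFin_Rintegral//; last exact: csupp2_integrableK.
  apply: le_trans h1; apply: ge0_le_integral => //.
  - by move=> x _; rewrite lee_fin sqr_ge0.
  - by apply/measurable_EFinP; apply: measurable_funX; exact: Cc2_mfun_derive.
  - by apply/measurable_EFinP; apply: measurable_funD; apply: measurable_funX; exact: Cc2_mfun_derive.
  - by move=> x _; rewrite lee_fin hv.
rewrite lee_fin -toK//; apply: le_trans (ladyzhenskaya r0 cf) _.
rewrite (_ : 4 * _ = (2 * e) * (2 * e)); last by ring.
apply: ler_pM.
- by apply: Rintegral_ge0 => x _; rewrite addr_ge0 ?sqr_ge0.
- by apply: Rintegral_ge0 => x _; rewrite addr_ge0 ?sqr_ge0.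
- by apply: hs => x; rewrite lerDl sqr_ge0.
- by apply: hs => x; rewrite lerDr sqr_ge0.
Qed.

Variables p q p1 p2 q1 q2 : pt2 R -> R.
Hypothesis H : H10_2 r p q p1 p2 q1 q2.

Let mp : measurable_fun (K2 r) p. Proof. by case: H. Qed.
Let mq : measurable_fun (K2 r) q. Proof. by case: H. Qed.
Let mp1 : measurable_fun (K2 r) p1. Proof. by case: H => _ _ []. Qed.
Let mp2 : measurable_fun (K2 r) p2. Proof. by case: H => _ _ []. Qed.
Let mq1 : measurable_fun (K2 r) q1. Proof. by case: H => _ _ _ []. Qed.
Let mq2 : measurable_fun (K2 r) q2. Proof. by case: H => _ _ _ []. Qed.

Definition dist0 (P Q : pt2 R -> R) x := (P x - p x) ^+ 2 + (Q x - q x) ^+ 2.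
Definition dist1 (P Q : pt2 R -> R) x :=
  (D1 P x - p1 x) ^+ 2 + (D2 P x - p2 x) ^+ 2 +
  (D1 Q x - q1 x) ^+ 2 + (D2 Q x - q2 x) ^+ 2.

Lemma dist0_mfun P Q : Cc2 r P -> Cc2 r Q -> measurable_fun (K2 r) (dist0 P Q).
Proof.
by move=> cP cQ; rewrite /dist0; mfun_with ltac:(exact: Cc2_mfun).
Qed.

Lemma dist1_mfun P Q : Cc2 r P -> Cc2 r Q -> measurable_fun (K2 r) (dist1 P Q).
Proof.
by move=> cP cQ; rewrite /dist1; mfun_with ltac:(exact: Cc2_mfun_derive).
Qed.

Lemma dist0_ge0 P Q x : 0 <= dist0 P Q x.
Proof. by rewrite addr_ge0 ?sqr_ge0. Qed.

Lemma dist1_ge0 P Q x : 0 <= dist1 P Q x.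
Proof. by rewrite !addr_ge0 ?sqr_ge0. Qed.

Definition approx2 (e : R) P Q := [/\ Cc2 r P, Cc2 r Q,
  (\int[mu2]_(x in K2 r) (dist0 P Q x)%:E < e%:E)%E &
  (\int[mu2]_(x in K2 r) (dist1 P Q x)%:E < e%:E)%E].

Lemma H10_2_approx e : 0 < e -> exists P Q, approx2 e P Q.
Proof.
move=> e0; have [_ _ _ _ [P [Q [cPQ [c0 c1]]]]] := H.
have [n [h0 h1]] := filter_ex (filterI (cvge0_lt c0 e0) (cvge0_lt c1 e0)).
by exists (P n), (Q n); have [? ?] := cPQ n; split.
Qed.

Lemma approx2_integrable e P Q : approx2 e P Q ->
  [/\ mu2.-integrable (K2 r) (EFin \o dist0 P Q), mu2.-integrable (K2 r) (EFin \o dist1 P Q),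
      \int[mu2]_(x in K2 r) dist0 P Q x < e & \int[mu2]_(x in K2 r) dist1 P Q x < e].
Proof.
move=> [cP cQ h0 h1].
have i0 : mu2.-integrable (K2 r) (EFin \o dist0 P Q).
  by apply: ge0_integrable => //; [exact: dist0_mfun|move=> x _; exact: dist0_ge0|exact: lt_trans h0 (ltry _)].
have i1 : mu2.-integrable (K2 r) (EFin \o dist1 P Q).
  by apply: ge0_integrable => //; [exact: dist1_mfun|move=> x _; exact: dist1_ge0|exact: lt_trans h1 (ltry _)].
by split=> //; rewrite -lte_fin EFin_Rintegral.
Qed.

(** The limit is not smooth, so the Ladyzhenskaya inequality is applied instead to the difference of
    [P] and a second smooth approximant, taken closer and closer to the limit, and lower
    semicontinuity of the L^4 norm concludes. The squared distance between the two approximants is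
    at most 2e + 2e, whence 4 (4e)^2 = 64 e^2. *)
Lemma approx2_L4 e P Q : 0 < e -> approx2 e P Q ->
  (\int[mu2]_(x in K2 r) ((P x - p x) ^+ 4)%:E <= (64 * e ^+ 2)%:E)%E /\
  (\int[mu2]_(x in K2 r) ((Q x - q x) ^+ 4)%:E <= (64 * e ^+ 2)%:E)%E.
Proof.
have lin4 (A B e' : R) : A < e' -> B < e' -> 2 * A + 2 * B <= 4 * e' by move=> ? ?; lra.
move=> e0 aPQ; have [cP cQ _ _] := aPQ; have [i0 i1 h0 h1] := approx2_integrable aPQ.
have key P' Q' : approx2 e P' Q' ->
    (\int[mu2]_(x in K2 r) ((P x - P' x) ^+ 4)%:E <= (64 * e ^+ 2)%:E)%E /\
    (\int[mu2]_(x in K2 r) ((Q x - Q' x) ^+ 4)%:E <= (64 * e ^+ 2)%:E)%E.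
  move=> aPQ'; have [cP' cQ' _ _] := aPQ'; have [i0' i1' h0' h1'] := approx2_integrable aPQ'.
  have gen (F F' : pt2 R -> R) : Cc2 r F -> Cc2 r F' ->
      (forall x, (F' x - F x) ^+ 2 <= 2 * dist0 P' Q' x + 2 * dist0 P Q x) ->
      (forall x, (D1 F' x - D1 F x) ^+ 2 + (D2 F' x - D2 F x) ^+ 2 <= 2 * dist1 P' Q' x + 2 * dist1 P Q x) ->
      (\int[mu2]_(x in K2 r) ((F' x - F x) ^+ 4)%:E <= (64 * e ^+ 2)%:E)%E.
    move=> cF cF' hF hDF; have cB := Cc2B cF' cF.
    have dB v x : 'D_v (fun x => F' x - F x) x = 'D_v F' x - 'D_v F x.
      apply: deriveB; apply: diff_derivable; apply: smooth_differentiable; [by case: cF'|by case: cF].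
    rewrite (_ : 64 * e ^+ 2 = 4 * (4 * e) ^+ 2); last by ring.
    apply: (Cc2_L4 cB).
      rewrite -EFin_Rintegral//; last by apply: csupp2_integrableK; apply: csupp2X; exact: Cc2_csupp.
      rewrite lee_fin; apply: (@le_trans _ _ (2 * (\int[mu2]_(x in K2 r) dist0 P' Q' x) + 2 * \int[mu2]_(x in K2 r) dist0 P Q x)).
        apply: le_Rintegral_lin2 => //.
        by apply: csupp2_integrableK; apply: csupp2X; exact: Cc2_csupp.
      exact: lin4 h0' h0.
    have iD : mu2.-integrable (K2 r) (EFin \o (fun x => D1 (fun x => F' x - F x) x ^+ 2 + D2 (fun x => F' x - F x) x ^+ 2)).
      by apply: csupp2_integrableK; apply: csupp2D; apply: csupp2X; apply: Cc2_csupp; exact: Cc2_derive.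
    rewrite -EFin_Rintegral// lee_fin.
    apply: (@le_trans _ _ (2 * (\int[mu2]_(x in K2 r) dist1 P' Q' x) + 2 * \int[mu2]_(x in K2 r) dist1 P Q x)).
      by apply: le_Rintegral_lin2 => // x _; rewrite !dB.
    exact: lin4 h1' h1.
  split; apply: gen => // x; rewrite /dist0 /dist1.
  - exact: sqrB_le_dist0l.
  - exact: sqrB_le_dist1l.
  - exact: sqrB_le_dist0r.
  - exact: sqrB_le_dist1r.
(* Closeness [Num.min e e'] keeps the uniform L^4 bound of [key] while the L^2 distance to the limit
   becomes arbitrarily small. *)
have pick e' : 0 < e' -> exists P' Q', approx2 e P' Q' /\
    (\int[mu2]_(x in K2 r) (dist0 P' Q' x)%:E < e'%:E)%E.
  move=> e'0; have [|P' [Q' [cP' cQ' d0 d1]]] := @H10_2_approx (Num.min e e').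
    by rewrite lt_min e0.
  have mle : (Num.min e e' <= e) && (Num.min e e' <= e') by rewrite !ge_min !lexx orbT.
  case/andP: mle => m1 m2.
  exists P', Q'; split; first by split=> //; apply: lt_le_trans; [exact: d0|by rewrite lee_fin|exact: d1|by rewrite lee_fin].
  by apply: lt_le_trans d0 _; rewrite lee_fin.
split; [apply: (@L4_lsc _ _ _ mu2 _ mK (fun x => P x - p x) _ leb2_K2_fin)|
  apply: (@L4_lsc _ _ _ mu2 _ mK (fun x => Q x - q x) _ leb2_K2_fin)].
- by apply: measurable_funB => //; exact: Cc2_mfun.
- move=> e' /pick [P' [Q' [aPQ' d0]]]; have [cP' cQ' _ _] := aPQ'.
  exists (fun x => P x - P' x); split.
  + by apply: measurable_funB; exact: Cc2_mfun.
  + by case: (key _ _ aPQ').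
  + apply: le_lt_trans d0; apply: ge0_le_integral => //.
    * by move=> x _; rewrite lee_fin sqr_ge0.
    * by apply/measurable_EFinP; mfun_with ltac:(exact: Cc2_mfun).
    * by apply/measurable_EFinP; exact: dist0_mfun.
    * by move=> x _; rewrite lee_fin /dist0 (_ : _ - _ = - (P' x - p x)); [rewrite sqrrN lerDl sqr_ge0|ring].
- by apply: measurable_funB => //; exact: Cc2_mfun.
- move=> e' /pick [P' [Q' [aPQ' d0]]]; have [cP' cQ' _ _] := aPQ'.
  exists (fun x => Q x - Q' x); split.
  + by apply: measurable_funB; exact: Cc2_mfun.
  + by case: (key _ _ aPQ').
  + apply: le_lt_trans d0; apply: ge0_le_integral => //.
    * by move=> x _; rewrite lee_fin sqr_ge0.
    * by apply/measurable_EFinP; mfun_with ltac:(exact: Cc2_mfun).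
    * by apply/measurable_EFinP; exact: dist0_mfun.
    * by move=> x _; rewrite lee_fin /dist0 (_ : _ - _ = - (Q' x - q x)); [rewrite sqrrN lerDr sqr_ge0|ring].
Qed.

End H10_2_theory.

(** * Pointwise inequalities for the energy density *)

Section energy_density.
Variable R : realType.
Implicit Types (x : pt2 R) (b p q : R).

Definition kin x p q (p1 p2 q1 q2 : R) : R :=
  (p1 + A01 x * q) ^+ 2 + (q1 - A01 x * p) ^+ 2
  + (p2 + A02 x * q) ^+ 2 + (q2 - A02 x * p) ^+ 2.

Definition edens b x p q (p1 p2 q1 q2 : R) : R :=
  b * kin x p q p1 p2 q1 q2 - (p ^+ 2 + q ^+ 2) + 2^-1 * (p ^+ 2 + q ^+ 2) ^+ 2.

Lemma kin_ge0 x p q p1 p2 q1 q2 : 0 <= kin x p q p1 p2 q1 q2.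
Proof. by rewrite /kin !addr_ge0 ?sqr_ge0. Qed.

(** With s = |u|^2 the potential part is (s - 1)^2/2 - 1/2, and the kinetic part is nonnegative. *)
Lemma edens_ge b x p q p1 p2 q1 q2 : 0 <= b -> - 2^-1 <= edens b x p q p1 p2 q1 q2.
Proof.
move=> b0; rewrite /edens; have := mulr_ge0 b0 (kin_ge0 x p q p1 p2 q1 q2).
have := sqr_ge0 (p ^+ 2 + q ^+ 2 - 1).
set k := b * _; set s := p ^+ 2 + q ^+ 2; lra.
Qed.

(** On [K2 r] both components of the potential are bounded by r/4, so the magnetic energy is
    controlled by the H^1 norm. *)
Lemma kin_le (r : R) x p q p1 p2 q1 q2 : K2 r x ->
  kin x p q p1 p2 q1 q2 <= 2 * (p1 ^+ 2 + p2 ^+ 2 + q1 ^+ 2 + q2 ^+ 2) + r ^+ 2 * (p ^+ 2 + q ^+ 2).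
Proof.
move=> [x1 x2]; rewrite /kin.
have hA (t : R) : `|t| < r / 2 -> 2 * (t / 2) ^+ 2 <= r ^+ 2 / 2.
  by rewrite ltr_norml => /andP[? ?]; nra.
have hs (u a t : R) : (u + a * t) ^+ 2 <= 2 * u ^+ 2 + 2 * a ^+ 2 * t ^+ 2.
  by have := sqr_ge0 (u - a * t); nra.
have h1 := hA _ x2; have h2 := hA _ x1.
have hA1 t : 2 * A01 x ^+ 2 * t ^+ 2 <= r ^+ 2 / 2 * t ^+ 2.
  by apply: ler_wpM2r; rewrite ?sqr_ge0// /A01 mulNr sqrrN.
have hA2 t : 2 * A02 x ^+ 2 * t ^+ 2 <= r ^+ 2 / 2 * t ^+ 2.
  by apply: ler_wpM2r; rewrite ?sqr_ge0.
have := hs p1 (A01 x) q; have := hs p2 (A02 x) q.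
have := hs q1 (A01 x) (- p); have := hs q2 (A02 x) (- p).
have := hA1 q; have := hA1 (- p); have := hA2 q; have := hA2 (- p).
rewrite !mulrN !sqrrN.
set a1 := 2 * A01 x ^+ 2 * q ^+ 2; set a2 := 2 * A01 x ^+ 2 * p ^+ 2.
set a3 := 2 * A02 x ^+ 2 * q ^+ 2; set a4 := 2 * A02 x ^+ 2 * p ^+ 2.
lra.
Qed.

Lemma young_sqr (lam u w : R) : 0 < lam ->
  w ^+ 2 <= (1 + lam) * u ^+ 2 + (1 + lam^-1) * (w - u) ^+ 2.
Proof.
move=> l0; rewrite -subr_ge0.
rewrite (_ : _ - _ = lam * (u - lam^-1 * (w - u)) ^+ 2); last first.
  by field; exact: lt0r_neq0.
by apply: mulr_ge0; [exact: ltW|exact: sqr_ge0].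
Qed.

Lemma youngN_sqr (lam u w : R) : 0 < lam ->
  - w ^+ 2 <= - u ^+ 2 + lam * u ^+ 2 + lam^-1 * (w - u) ^+ 2.
Proof.
move=> l0; rewrite -subr_ge0.
rewrite (_ : _ - _ = lam * (u + lam^-1 * (w - u)) ^+ 2 + (w - u) ^+ 2); last first.
  by field; exact: lt0r_neq0.
by apply: addr_ge0; [apply: mulr_ge0; [exact: ltW|exact: sqr_ge0]|exact: sqr_ge0].
Qed.

Lemma young_kin (lam : R) x p q p1 p2 q1 q2 P Q P1 P2 Q1 Q2 : 0 < lam ->
  kin x P Q P1 P2 Q1 Q2 <= (1 + lam) * kin x p q p1 p2 q1 q2 +
    (1 + lam^-1) * kin x (P - p) (Q - q) (P1 - p1) (P2 - p2) (Q1 - q1) (Q2 - q2).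
Proof.
move=> l0; rewrite /kin.
have := young_sqr (p1 + A01 x * q) (P1 + A01 x * Q) l0.
have := young_sqr (q1 - A01 x * p) (Q1 - A01 x * P) l0.
have := young_sqr (p2 + A02 x * q) (P2 + A02 x * Q) l0.
have := young_sqr (q2 - A02 x * p) (Q2 - A02 x * P) l0.
set k := 1 + lam^-1; set l := 1 + lam.
rewrite (_ : P1 + A01 x * Q - _ = P1 - p1 + A01 x * (Q - q)); last by ring.
rewrite (_ : Q1 - A01 x * P - _ = Q1 - q1 - A01 x * (P - p)); last by ring.
rewrite (_ : P2 + A02 x * Q - _ = P2 - p2 + A02 x * (Q - q)); last by ring.
rewrite (_ : Q2 - A02 x * P - _ = Q2 - q2 - A02 x * (P - p)); last by ring.
by rewrite !mulrDr; lra.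
Qed.

(** [young_sqr] is used on each component and then on the sum; the resulting factor (1 + lam)^3 is
    at most 1 + 7 lam because lam <= 1. *)
Lemma young_quartic (lam p q P Q : R) : 0 < lam <= 1 ->
  (P ^+ 2 + Q ^+ 2) ^+ 2 <= (1 + 7 * lam) * (p ^+ 2 + q ^+ 2) ^+ 2 +
    (1 + lam^-1) ^+ 3 * ((P - p) ^+ 2 + (Q - q) ^+ 2) ^+ 2.
Proof.
move=> /andP[l0 l1].
set k := lam^-1; have k0 : 0 < k by rewrite invr_gt0.
set A := p ^+ 2 + q ^+ 2; set B := (P - p) ^+ 2 + (Q - q) ^+ 2.
have A0 : 0 <= A by rewrite addr_ge0 ?sqr_ge0.
have B0 : 0 <= B by rewrite addr_ge0 ?sqr_ge0.
have h : P ^+ 2 + Q ^+ 2 <= (1 + lam) * A + (1 + k) * B.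
  have := young_sqr p P l0; have := young_sqr q Q l0.
  by rewrite /A /B -/k !mulrDr; lra.
have S0 : 0 <= P ^+ 2 + Q ^+ 2 by rewrite addr_ge0 ?sqr_ge0.
apply: (@le_trans _ _ (((1 + lam) * A + (1 + k) * B) ^+ 2)).
  by rewrite ler_sqr ?nnegrE// addr_ge0// mulr_ge0//; lra.
have := young_sqr ((1 + lam) * A) ((1 + lam) * A + (1 + k) * B) l0.
rewrite -/k => h2; apply: le_trans h2 _.
rewrite [leLHS](_ : _ = (1 + lam) ^+ 3 * A ^+ 2 + (1 + k) ^+ 3 * B ^+ 2); last by ring.
rewrite lerD2r; apply: ler_wpM2r; first exact: sqr_ge0.
by nra.
Qed.

(** Integrated, this is continuity of the energy in the H^1 and L^4 norms: the first error is small
    with [lam] for a fixed limit, the second is small with the distance once [lam] is fixed. The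
    coefficient with exponent 3 comes from [young_quartic] and dominates those of the quadratic
    terms. *)
Lemma edens_le (lam b : R) x p q p1 p2 q1 q2 P Q P1 P2 Q1 Q2 : 0 < lam <= 1 -> 0 <= b <= 1 ->
  edens b x P Q P1 P2 Q1 Q2 <= edens b x p q p1 p2 q1 q2 +
  (lam * (kin x p q p1 p2 q1 q2 + (p ^+ 2 + q ^+ 2) + 4 * (p ^+ 2 + q ^+ 2) ^+ 2) +
  (1 + lam^-1) ^+ 3 * (kin x (P - p) (Q - q) (P1 - p1) (P2 - p2) (Q1 - q1) (Q2 - q2)
    + ((P - p) ^+ 2 + (Q - q) ^+ 2) + ((P - p) ^+ 2 + (Q - q) ^+ 2) ^+ 2)).
Proof.
move=> l01 /andP[b0 b1]; have /andP[l0 l1] := l01; rewrite /edens.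
have h1 := young_kin x p q p1 p2 q1 q2 P Q P1 P2 Q1 Q2 l0.
have h2 := young_quartic p q P Q l01.
have h3 := youngN_sqr p P l0; have h4 := youngN_sqr q Q l0.
have k0 := kin_ge0 x p q p1 p2 q1 q2.
have k0' := kin_ge0 x (P - p) (Q - q) (P1 - p1) (P2 - p2) (Q1 - q1) (Q2 - q2).
set S := p ^+ 2 + q ^+ 2 in h2 *; set T := (P - p) ^+ 2 + (Q - q) ^+ 2 in h2 *.
have h34 : - (P ^+ 2 + Q ^+ 2) <= - S + lam * S + lam^-1 * T.
  by rewrite /S /T !mulrDr; lra.
have S0 : 0 <= S by rewrite addr_ge0 ?sqr_ge0.
have T0 : 0 <= T by rewrite addr_ge0 ?sqr_ge0.
have li0 : 0 < lam^-1 by rewrite invr_gt0.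
move: h1 h2 h34 k0 k0' T0 S0.
set K := kin x p q p1 p2 q1 q2; set K' := kin x (P - p) _ _ _ _ _.
set KP := kin x P Q P1 P2 Q1 Q2; set SP := P ^+ 2 + Q ^+ 2.
set m := (1 + lam^-1) ^+ 3.
have m1 : 1 + lam^-1 <= m.
  rewrite /m -[leLHS]expr1; apply: ler_weXn2l => //; lra.
clear h3 h4 => h1 h2 h34 k0 k0' T0 S0.
have e1 : b * KP <= b * K + lam * K + m * K'.
  apply: (@le_trans _ _ (b * ((1 + lam) * K + (1 + lam^-1) * K'))).
    exact: ler_wpM2l.
  have : b * (lam * K) <= lam * K.
    by rewrite -[leRHS]mul1r; apply: ler_wpM2r => //; rewrite mulr_ge0// ltW.
  have : b * ((1 + lam^-1) * K') <= m * K'.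
    rewrite mulrA; apply: ler_wpM2r => //; apply: le_trans m1.
    by rewrite -[leRHS]mul1r; apply: ler_wpM2r => //; lra.
  rewrite !mulrDr !mulrDl !mul1r !mulrDr; lra.
have e2 : lam^-1 * T <= m * T by apply: ler_wpM2r => //; lra.
have e3 : 0 <= m * T ^+ 2 by rewrite mulr_ge0 ?sqr_ge0//; lra.
have e4 : 0 <= lam * S ^+ 2 by rewrite mulr_ge0 ?sqr_ge0//; lra.
have h2' : SP ^+ 2 <= S ^+ 2 + 7 * (lam * S ^+ 2) + m * T ^+ 2.
  by rewrite mulrA -[X in X + _ * _ + _]mul1r -mulrDl.
clear h1 h2 m1; move: e1 e2 e3 e4 h2' h34; rewrite !mulrDr.
set u1 := b * KP; set u2 := b * K; set u3 := lam * K; set u4 := m * K'.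
set u5 := lam^-1 * T; set u6 := m * T; set u7 := m * T ^+ 2.
set u9 := SP ^+ 2; set u10 := S ^+ 2; set u11 := lam * S.
rewrite (_ : lam * (4 * u10) = 4 * (lam * u10)); last by ring.
set u8 := lam * u10; lra.
Qed.

End energy_density.

Section more_scalar_inequalities.
Variable R : realType.

Lemma sqr4_le (a b c d a' b' c' d' : R) : a ^+ 2 + b ^+ 2 + c ^+ 2 + d ^+ 2 <=
  2 * a' ^+ 2 + 2 * b' ^+ 2 + 2 * c' ^+ 2 + 2 * d' ^+ 2 + 2 * (a' - a) ^+ 2 +
  2 * (b' - b) ^+ 2 + 2 * (c' - c) ^+ 2 + 2 * (d' - d) ^+ 2.
Proof.
have h (u v : R) : u ^+ 2 <= 2 * v ^+ 2 + 2 * (v - u) ^+ 2.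
  by have := sqr_ge0 (2 * v - u); lra.
have := h a a'; have := h b b'; have := h c c'; have := h d d'; lra.
Qed.

Lemma small_factor (w e : R) : 0 <= w -> 0 < e -> exists2 lam, 0 < lam <= 1 & lam * w <= e.
Proof.
move=> w0 e0; exists (Num.min 1 (e / (w + 1))).
  by rewrite lt_min ltr01 ge_min lexx andbT divr_gt0// ltr_wpDl.
apply: (@le_trans _ _ (e / (w + 1) * w)).
  by apply: ler_wpM2r => //; rewrite ge_min lexx orbT.
rewrite mulrAC ler_pdivrMr ?ltr_wpDl//; apply: ler_wpM2l; lra.
Qed.

Lemma small_factor_lt (w e : R) : 0 <= w -> 0 < e -> exists2 lam, 0 < lam <= 1 & lam * w < e.
Proof.
move=> w0 e0; have [|lam l1 h] := @small_factor w (e / 2) w0; first lra.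
by exists lam => //; lra.
Qed.

Lemma Z_bound (A B C d r : R) : 0 < d <= 1 -> A <= (2 + r ^+ 2) * d -> B <= d -> C <= 256 * d ^+ 2 ->
  A + B + C <= d * (3 + r ^+ 2 + 256).
Proof.
move=> /andP[d0 d1] hA hB hC.
have d2 : d ^+ 2 <= d by rewrite expr2 ger_pMr.
lra.
Qed.

Lemma l01 : 0 < (1 : R) <= 1.
Proof. by rewrite ltr01 lexx. Qed.

Lemma quartic_dist (A p q P Q : R) : A + 8 * ((p - P) ^+ 2 + (q - Q) ^+ 2) ^+ 2 =
  A + 8 * ((P - p) ^+ 2 + (Q - q) ^+ 2) ^+ 2.
Proof. ring. Qed.

Lemma quartic_const_num (A B : R) : (1 + 7 * 1) * A + (1 + 1^-1) ^+ 3 * B = 8 * A + 8 * B.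
Proof. rewrite invr1; ring. Qed.

Lemma lin4' (A B e : R) : A <= 64 * e ^+ 2 -> B <= 64 * e ^+ 2 -> 2 * A + 2 * B <= 256 * e ^+ 2.
Proof. lra. Qed.

End more_scalar_inequalities.

Section magnetic_potential.
Variable R : realType.

Lemma continuous_A01 : continuous (@A01 R).
Proof.
move=> x; rewrite /A01; apply: cvgMl; apply: cvgN; exact: cvg_snd.
Qed.

Lemma continuous_A02 : continuous (@A02 R).
Proof. by move=> x; rewrite /A02; apply: cvgMl; exact: cvg_fst. Qed.

Lemma mfun_A01 D : measurable_fun D (@A01 R).
Proof. by apply: measurable_funTS; apply: continuous_measurable2; exact: continuous_A01. Qed.

Lemma mfun_A02 D : measurable_fun D (@A02 R).
Proof. by apply: measurable_funTS; apply: continuous_measurable2; exact: continuous_A02. Qed.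

End magnetic_potential.

Ltac mfA := mfun_with ltac:(idtac; lazymatch goal with
  | |- context [@A01] => exact: mfun_A01
  | |- context [@A02] => exact: mfun_A02
  | |- context [@derive] => eapply Cc2_mfun_derive; eassumption
  | _ => first [assumption | eapply Cc2_mfun; eassumption] end).

(** * Finiteness of the planar energy on H^1_0 *)

Section H10_2_energy.
Variable R : realType.
Local Notation mu2 := (@leb2 R).
Local Notation D1 f x := (derive f x (e21 R)).
Local Notation D2 f x := (derive f x (e22 R)).

Variable r : R.
Hypothesis r0 : 0 < r.
Let r0' : 0 <= r := ltW r0.
Let mK : @measurable _ (measurableTypeR R * measurableTypeR R)%type (K2 r) := measurable_K2 r.

Variables p q p1 p2 q1 q2 : pt2 R -> R.
Hypothesis H : H10_2 r p q p1 p2 q1 q2.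

Let mp : measurable_fun (K2 r) p. Proof. by case: H. Qed.
Let mq : measurable_fun (K2 r) q. Proof. by case: H. Qed.
Let mp1 : measurable_fun (K2 r) p1. Proof. by case: H => _ _ []. Qed.
Let mp2 : measurable_fun (K2 r) p2. Proof. by case: H => _ _ []. Qed.
Let mq1 : measurable_fun (K2 r) q1. Proof. by case: H => _ _ _ []. Qed.
Let mq2 : measurable_fun (K2 r) q2. Proof. by case: H => _ _ _ []. Qed.

Lemma H10_2_mass_integrable : mu2.-integrable (K2 r) (EFin \o (fun x => p x ^+ 2 + q x ^+ 2)).
Proof.
have [P [Q aPQ]] := H10_2_approx H (@ltr01 R).
have [cP cQ _ _] := aPQ; have [i0 _ _ _] := approx2_integrable H aPQ.
have iPQ : mu2.-integrable (K2 r) (EFin \o (fun x => P x ^+ 2 + Q x ^+ 2)).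
  by apply: (csupp2_integrableK r0); apply: csupp2D; apply: csupp2X; exact: Cc2_csupp.
apply: (dominated_integrable mK _ (integrable_lin2 mK 2 2 iPQ i0)) => //; first by mfA.
move=> x _; rewrite ger0_norm ?addr_ge0 ?sqr_ge0// /dist0.
have := sqrB_le (p x) 0 (P x); have := sqrB_le (q x) 0 (Q x).
by rewrite !subr0 !sub0r !sqrrN -[(p x - P x) ^+ 2]sqrrN -[(q x - Q x) ^+ 2]sqrrN !opprB; lra.
Qed.

Lemma H10_2_grad_integrable :
  mu2.-integrable (K2 r) (EFin \o (fun x => p1 x ^+ 2 + p2 x ^+ 2 + q1 x ^+ 2 + q2 x ^+ 2)).
Proof.
have [P [Q aPQ]] := H10_2_approx H (@ltr01 R).
have [cP cQ _ _] := aPQ; have [_ i1 _ _] := approx2_integrable H aPQ.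
have iPQ : mu2.-integrable (K2 r) (EFin \o (fun x => D1 P x ^+ 2 + D2 P x ^+ 2 + D1 Q x ^+ 2 + D2 Q x ^+ 2)).
  by apply: (csupp2_integrableK r0); do 3 (apply: csupp2D; last by
    apply: csupp2X; apply: Cc2_csupp; exact: Cc2_derive);
  apply: csupp2X; apply: Cc2_csupp; exact: Cc2_derive.
apply: (dominated_integrable mK _ (integrable_lin2 mK 2 2 iPQ i1)) => //; first by mfA.
move=> x _; rewrite ger0_norm ?addr_ge0 ?sqr_ge0// /dist1.
by rewrite !mulrDr !addrA; exact: sqr4_le.
Qed.

Lemma H10_2_kin_integrable :
  mu2.-integrable (K2 r) (EFin \o (fun x => kin x (p x) (q x) (p1 x) (p2 x) (q1 x) (q2 x))).
Proof.
apply: (dominated_integrable mK _ (integrable_lin2 mK 2 (r ^+ 2) H10_2_grad_integrable H10_2_mass_integrable)) => //.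
  by rewrite /kin; mfA.
by move=> x Kx; rewrite ger0_norm ?kin_ge0//; exact: kin_le.
Qed.

Lemma approx2_L4_integrable e P Q : 0 < e -> approx2 r p q p1 p2 q1 q2 e P Q ->
  mu2.-integrable (K2 r) (EFin \o (fun x => dist0 p q P Q x ^+ 2)) /\
  \int[mu2]_(x in K2 r) (dist0 p q P Q x ^+ 2) <= 256 * e ^+ 2.
Proof.
move=> e0 aPQ; have [cP cQ _ _] := aPQ; have [h1 h2] := approx2_L4 r0 H e0 aPQ.
have iP : mu2.-integrable (K2 r) (EFin \o (fun x => (P x - p x) ^+ 4)).
  apply: ge0_integrable => //; [by mfA|by move=> x _; rewrite exprn_even_ge0|].
  exact: le_lt_trans h1 (ltry _).
have iQ : mu2.-integrable (K2 r) (EFin \o (fun x => (Q x - q x) ^+ 4)).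
  apply: ge0_integrable => //; [by mfA|by move=> x _; rewrite exprn_even_ge0|].
  exact: le_lt_trans h2 (ltry _).
have dom x : dist0 p q P Q x ^+ 2 <= 2 * (P x - p x) ^+ 4 + 2 * (Q x - q x) ^+ 4.
  by rewrite /dist0 !(_ : forall u : R, u ^+ 4 = (u ^+ 2) ^+ 2); [|by move=> u; rewrite -exprM|by move=> u; rewrite -exprM]; have := sqr_ge0 ((P x - p x) ^+ 2 - (Q x - q x) ^+ 2); lra.
have iD : mu2.-integrable (K2 r) (EFin \o (fun x => dist0 p q P Q x ^+ 2)).
  apply: (dominated_integrable mK _ (integrable_lin2 mK 2 2 iP iQ)) => //; first by rewrite /dist0; mfA.
  by move=> x Kx; rewrite ger0_norm ?sqr_ge0.
split=> //; apply: (@le_trans _ _ (2 * (\int[mu2]_(x in K2 r) ((P x - p x) ^+ 4)) +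
   2 * \int[mu2]_(x in K2 r) ((Q x - q x) ^+ 4))).
  by apply: le_Rintegral_lin2.
move: h1 h2; rewrite -!EFin_Rintegral// !lee_fin.
by move=> h1' h2'; exact: (lin4' h1' h2').
Qed.

Lemma H10_2_quartic_integrable :
  mu2.-integrable (K2 r) (EFin \o (fun x => (p x ^+ 2 + q x ^+ 2) ^+ 2)).
Proof.
have [P [Q aPQ]] := H10_2_approx H (@ltr01 R).
have [cP cQ _ _] := aPQ; have [iD _] := approx2_L4_integrable ltr01 aPQ.
have iPQ : mu2.-integrable (K2 r) (EFin \o (fun x => (P x ^+ 2 + Q x ^+ 2) ^+ 2)).
  by apply: (csupp2_integrableK r0); apply: csupp2X; apply: csupp2D; apply: csupp2X; exact: Cc2_csupp.
apply: (dominated_integrable mK _ (integrable_lin2 mK 8 8 iPQ iD)) => //; first by mfA.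
move=> x _; rewrite ger0_norm ?sqr_ge0//.
(* Taken at [lam] equal to 1, where both coefficients are 8. *)
apply: le_trans (young_quartic (P x) (Q x) (p x) (q x) (l01 R)) _.
rewrite quartic_const_num quartic_dist; exact: lexx.
Qed.

Lemma H10_2_edens b :
  mu2.-integrable (K2 r) (EFin \o (fun x => edens b x (p x) (q x) (p1 x) (p2 x) (q1 x) (q2 x))) /\
  GL2 b r p q p1 p2 q1 q2 =
    \int[mu2]_(x in K2 r) edens b x (p x) (q x) (p1 x) (p2 x) (q1 x) (q2 x).
Proof.
have iK := H10_2_kin_integrable; have iM := H10_2_mass_integrable.
have i4 := H10_2_quartic_integrable.
have i2 := integrable_lin2 mK b (-1) iK iM.
have e x : edens b x (p x) (q x) (p1 x) (p2 x) (q1 x) (q2 x) =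
   1 * (b * kin x (p x) (q x) (p1 x) (p2 x) (q1 x) (q2 x) + (-1) * (p x ^+ 2 + q x ^+ 2)) +
   2^-1 * (p x ^+ 2 + q x ^+ 2) ^+ 2.
  by rewrite /edens mul1r mulN1r.
split.
  by apply: eq_integrable (integrable_lin2 mK 1 2^-1 i2 i4) => // x _; rewrite /= e.
under eq_Rintegral do rewrite e.
by rewrite Rintegral_lin2// Rintegral_lin2// mul1r mulN1r.
Qed.

Lemma GL2_ge b : 0 <= b -> - 2^-1 * r ^+ 2 <= GL2 b r p q p1 p2 q1 q2.
Proof.
move=> b0; have [ie ->] := H10_2_edens b.
have -> : - 2^-1 * r ^+ 2 = \int[mu2]_(x in K2 r) (- 2^-1).
  by rewrite Rintegral_cst//; congr (_ * _); exact: (esym (congr1 fine (leb2_K2 r0'))).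
apply: le_Rintegral => //; last by move=> x _; exact: edens_ge.
exact: (integrable_cst_fin _ mK (leb2_K2_fin r0)).
Qed.

End H10_2_energy.

Section smooth_H10_2.
Variable R : realType.
Local Notation mu2 := (@leb2 R).
Local Notation D1 f x := (derive f x (e21 R)).
Local Notation D2 f x := (derive f x (e22 R)).

Lemma Cc2_H10_2 (r : R) (P Q : pt2 R -> R) : Cc2 r P -> Cc2 r Q ->
  H10_2 r P Q (fun x => D1 P x) (fun x => D2 P x) (fun x => D1 Q x) (fun x => D2 Q x).
Proof.
move=> cP cQ; split; [exact: Cc2_mfun cP|exact: Cc2_mfun cQ| | |].
- by split; exact: Cc2_mfun_derive cP.
- by split; exact: Cc2_mfun_derive cQ.
exists (fun=> P), (fun=> Q); split=> //; split.
- apply: cvg_near_cst; near=> n; apply: integral0_eq => x _.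
  by rewrite !subrr expr0n addr0.
- apply: cvg_near_cst; near=> n; apply: integral0_eq => x _.
  by rewrite !subrr expr0n !addr0.
Unshelve. all: by end_near. Qed.

End smooth_H10_2.

Section H10_2_density.
Variable R : realType.
Local Notation mu2 := (@leb2 R).
Local Notation D1 f x := (derive f x (e21 R)).
Local Notation D2 f x := (derive f x (e22 R)).
Variable r : R.
Hypothesis r0 : 0 < r.
Let r0' : 0 <= r := ltW r0.
Let mK : @measurable _ (measurableTypeR R * measurableTypeR R)%type (K2 r) := measurable_K2 r.

Variables p q p1 p2 q1 q2 : pt2 R -> R.
Hypothesis H : H10_2 r p q p1 p2 q1 q2.

Let mp : measurable_fun (K2 r) p. Proof. by case: H. Qed.
Let mq : measurable_fun (K2 r) q. Proof. by case: H. Qed.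
Let mp1 : measurable_fun (K2 r) p1. Proof. by case: H => _ _ []. Qed.
Let mp2 : measurable_fun (K2 r) p2. Proof. by case: H => _ _ []. Qed.
Let mq1 : measurable_fun (K2 r) q1. Proof. by case: H => _ _ _ []. Qed.
Let mq2 : measurable_fun (K2 r) q2. Proof. by case: H => _ _ _ []. Qed.

Let dkin (P Q : pt2 R -> R) x := kin x (P x - p x) (Q x - q x) (D1 P x - p1 x)
  (D2 P x - p2 x) (D1 Q x - q1 x) (D2 Q x - q2 x).

Let dkin_integrable e P Q : 0 < e -> approx2 r p q p1 p2 q1 q2 e P Q ->
  mu2.-integrable (K2 r) (EFin \o dkin P Q) /\
  \int[mu2]_(x in K2 r) dkin P Q x <= (2 + r ^+ 2) * e.
Proof.
move=> e0 aPQ; have [cP cQ _ _] := aPQ.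
have [i0 i1 h0 h1] := approx2_integrable H aPQ.
have dom x : K2 r x -> dkin P Q x <= 2 * dist1 p1 p2 q1 q2 P Q x + r ^+ 2 * dist0 p q P Q x.
  by move=> Kx; exact: kin_le.
have iD : mu2.-integrable (K2 r) (EFin \o dkin P Q).
  apply: (dominated_integrable mK _ (integrable_lin2 mK 2 (r ^+ 2) i1 i0)) => //.
    by rewrite /dkin /kin; mfA.
  by move=> x Kx; rewrite ger0_norm ?kin_ge0//; exact: dom.
split=> //; apply: le_trans (le_Rintegral_lin2 mK iD i1 i0 dom) _.
rewrite [leRHS]mulrDl; apply: lerD; apply: ler_wpM2l; rewrite ?sqr_ge0//; exact: ltW.
Qed.

(** The order of choices matters: [lam] depends on the size [w] of the limit, and only then the
    distance [d] of the approximant is chosen, because the coefficient [k] contains the inverse of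
    [lam]. *)
Lemma H10_2_density b e : 0 <= b <= 1 -> 0 < e ->
  exists P Q, [/\ Cc2 r P, Cc2 r Q &
    \int[mu2]_(x in K2 r) edens b x (P x) (Q x) (D1 P x) (D2 P x) (D1 Q x) (D2 Q x) <
    GL2 b r p q p1 p2 q1 q2 + e].
Proof.
move=> b01 e0; have [iE ->] := H10_2_edens r0 H b.
have iK := H10_2_kin_integrable r0 H; have iM := H10_2_mass_integrable r0 H.
have i4 := H10_2_quartic_integrable r0 H.
pose W x := 1 * (1 * kin x (p x) (q x) (p1 x) (p2 x) (q1 x) (q2 x) + 1 * (p x ^+ 2 + q x ^+ 2))
  + 4 * (p x ^+ 2 + q x ^+ 2) ^+ 2.
have iW : mu2.-integrable (K2 r) (EFin \o W).
  by apply: integrable_lin2 => //; exact: integrable_lin2.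
pose w := \int[mu2]_(x in K2 r) W x.
have w0 : 0 <= w.
  apply: Rintegral_ge0 => x _; rewrite /W !mul1r; apply: addr_ge0; last by rewrite mulr_ge0 ?sqr_ge0.
  by rewrite addr_ge0 ?kin_ge0 ?addr_ge0 ?sqr_ge0.
have e2 : 0 < e / 2 by rewrite divr_gt0.
have [lam l01 lw] : exists2 lam, 0 < lam <= 1 & lam * w <= e / 2.
  exact: small_factor w0 e2.
have [l0 l1] := andP l01.
pose k := (1 + lam^-1) ^+ 3.
have k0 : 0 < k by rewrite exprn_gt0// addr_gt0// invr_gt0.
have [d /andP[d0 d1] dk] : exists2 d, 0 < d <= 1 & d * (k * (3 + r ^+ 2 + 256)) < e / 2.
  apply: small_factor_lt; last exact: e2.
  apply: mulr_ge0; first exact: ltW.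
  by apply: addr_ge0; [apply: addr_ge0; [exact: ler0n|exact: sqr_ge0]|exact: ler0n].
have [P [Q aPQ]] := H10_2_approx H d0.
have [cP cQ _ _] := aPQ; have [i0 i1 h0 h1] := approx2_integrable H aPQ.
have [id hd] := dkin_integrable d0 aPQ; have [iq hq] := approx2_L4_integrable r0 H d0 aPQ.
exists P, Q; split=> //.
pose Z x := 1 * (1 * dkin P Q x + 1 * dist0 p q P Q x) + 1 * dist0 p q P Q x ^+ 2.
have iZ : mu2.-integrable (K2 r) (EFin \o Z).
  by apply: integrable_lin2 => //; exact: integrable_lin2.
have hZ : \int[mu2]_(x in K2 r) Z x <= d * (3 + r ^+ 2 + 256).
  rewrite Rintegral_lin2//; last exact: integrable_lin2.
  rewrite Rintegral_lin2// !mul1r; apply: Z_bound; [by rewrite d0 d1|exact: hd|exact: ltW|exact: hq].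
have iPQ : mu2.-integrable (K2 r) (EFin \o (fun x => edens b x (P x) (Q x) (D1 P x) (D2 P x) (D1 Q x) (D2 Q x))).
  by case: (H10_2_edens r0 (Cc2_H10_2 cP cQ) b).
have iWZ := integrable_lin2 mK lam k iW iZ.
apply: (@le_lt_trans _ _ (\int[mu2]_(x in K2 r) (1 * edens b x (p x) (q x) (p1 x) (p2 x) (q1 x) (q2 x)
   + 1 * (lam * W x + k * Z x)))).
  apply: le_Rintegral => //; first exact: integrable_lin2.
  by move=> x Kx; rewrite /Z /W !mul1r; exact: edens_le.
rewrite Rintegral_lin2// Rintegral_lin2// !mul1r ltrD2l -/w.
apply: (@le_lt_trans _ _ (lam * w + k * (d * (3 + r ^+ 2 + 256)))).
  by rewrite lerD2l; apply: ler_wpM2l => //; exact: ltW.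
rewrite mulrCA [e]splitr; exact: ler_ltD.
Qed.

End H10_2_density.

(** * The planar energy: translations, tiling, averaging *)

Section plane_energy.
Variable R : realType.
Local Notation mu2 := (@leb2 R).
Local Notation D1 f x := (derive f x (e21 R)).
Local Notation D2 f x := (derive f x (e22 R)).

Definition dens (b : R) (P Q : pt2 R -> R) (x : pt2 R) :=
  edens b x (P x) (Q x) (D1 P x) (D2 P x) (D1 Q x) (D2 Q x).

(** Integration runs over the whole plane, so the value does not refer to a square containing the
    support and can be followed under translation and tiling. *)
Definition E2 (b : R) (P Q : pt2 R -> R) := \int[mu2]_x dens b P Q x.

Lemma dens_csupp r b P Q : Cc2 r P -> Cc2 r Q -> csupp2 r (dens b P Q).
Proof.
move=> cP cQ.
have sP := Cc2_csupp cP; have sQ := Cc2_csupp cQ.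
have dP v : csupp2 r (fun x => 'D_v P x) by apply: Cc2_csupp; exact: Cc2_derive.
have dQ v : csupp2 r (fun x => 'D_v Q x) by apply: Cc2_csupp; exact: Cc2_derive.
have m1 := @continuous_A01 R; have m2 := @continuous_A02 R.
have cb : continuous (fun _ : pt2 R => b) by move=> x; exact: cvg_cst.
have c2 : continuous (fun _ : pt2 R => 2^-1 : R) by move=> x; exact: cvg_cst.
rewrite /dens /edens /kin.
apply: csupp2D; [apply: csupp2B|].
- apply: csupp2M => //; do 3 (try apply: csupp2D); apply: csupp2X;
  first [apply: csupp2B|apply: csupp2D] => //; apply: csupp2M => //.
- by apply: csupp2D; apply: csupp2X.
- by apply: csupp2M => //; apply: csupp2X; apply: csupp2D; apply: csupp2X.
Qed.

Lemma dens_integrable r b P Q : 0 <= r -> Cc2 r P -> Cc2 r Q ->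
  mu2.-integrable setT (EFin \o dens b P Q).
Proof. by move=> r0 cP cQ; apply: (csupp2_integrable r0); exact: dens_csupp. Qed.

Lemma E2_K2 r b P Q : Cc2 r P -> Cc2 r Q ->
  \int[mu2]_(x in K2 r) dens b P Q x = E2 b P Q.
Proof. by move=> cP cQ; apply: Rintegral_supp; case: (dens_csupp b cP cQ). Qed.

Lemma GL2_E2 r b P Q : 0 < r -> Cc2 r P -> Cc2 r Q ->
  GL2 b r P Q (fun x => D1 P x) (fun x => D2 P x) (fun x => D1 Q x) (fun x => D2 Q x) = E2 b P Q.
Proof.
move=> r0 cP cQ; have [_ ->] := H10_2_edens r0 (Cc2_H10_2 cP cQ) b.
exact: E2_K2.
Qed.

Definition GL2_values (b r : R) : set R :=
  [set E | exists p q p1 p2 q1 q2, H10_2 r p q p1 p2 q1 q2 /\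
                 E = GL2 b r p q p1 p2 q1 q2].

(** Needed before any use of [m0]: [inf] takes a default value on a set that is not bounded
    below. *)
Lemma m0_lbound b r : 0 <= b -> 0 < r ->
  lbound (GL2_values b r) (- 2^-1 * r ^+ 2).
Proof. by move=> b0 r0 E [p [q [p1 [p2 [q1 [q2 [H ->]]]]]]]; exact: GL2_ge. Qed.

Lemma m0_le_GL2 (b r : R) p q p1 p2 q1 q2 : 0 <= b -> 0 < r ->
  H10_2 r p q p1 p2 q1 q2 -> m0 b r <= GL2 b r p q p1 p2 q1 q2.
Proof.
move=> b0 r0 H; apply: ge_inf; first by exists (- 2^-1 * r ^+ 2); exact: m0_lbound.
by exists p, q, p1, p2, q1, q2.
Qed.

Lemma m0_le_E2 (b r : R) P Q : 0 <= b -> 0 < r -> Cc2 r P -> Cc2 r Q -> m0 b r <= E2 b P Q.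
Proof.
move=> b0 r0 cP cQ; rewrite -(GL2_E2 b r0 cP cQ); apply: m0_le_GL2 => //.
exact: Cc2_H10_2.
Qed.

Lemma m0_nonempty b r : GL2_values b r !=set0.
Proof.
have c0 := @Cc2_0 R r.
by eexists; do 6 eexists; split; [exact: (Cc2_H10_2 c0 c0)|reflexivity].
Qed.

Lemma m0_approx (b r e : R) : 0 <= b <= 1 -> 0 < r -> 0 < e ->
  exists P Q, [/\ Cc2 r P, Cc2 r Q & E2 b P Q < m0 b r + e].
Proof.
move=> b01 r0 e0; have /andP[b0 b1] := b01.
have hI : has_inf (GL2_values b r).
  by split; [exact: m0_nonempty|exists (- 2^-1 * r ^+ 2); exact: m0_lbound].
have e2 : 0 < e / 2 by rewrite divr_gt0.
have [E [p [q [p1 [p2 [q1 [q2 [H ->]]]]]]] hE] := inf_adherent e2 hI.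
have [P [Q [cP cQ h]]] := H10_2_density r0 H b01 e2.
exists P, Q; split=> //; rewrite -(E2_K2 b cP cQ).
apply: lt_trans h _; apply: (@lt_le_trans _ _ (m0 b r + e / 2 + e / 2)).
  by rewrite ltrD2r; exact: hE.
by rewrite -addrA -splitr.
Qed.

Lemma E2_0 b : E2 b (fun=> 0) (fun=> 0) = 0.
Proof.
rewrite /E2 /Rintegral integral0_eq// => x _; rewrite /dens /edens /kin !derive_cst.
by congr EFin; ring.
Qed.

Lemma m0_le0 (b r : R) : 0 <= b -> 0 < r -> m0 b r <= 0.
Proof. by move=> b0 r0; rewrite -(E2_0 b); apply: m0_le_E2 => //; exact: Cc2_0. Qed.

(** Since the limit exists, arbitrarily large good values of [r] suffice; tiling provides a sequence
    of them. *)
Lemma le_lim_m0 (b c : R) : cvg (m0 b r / r ^+ 2 @[r --> +oo]) ->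
  (forall A, exists2 r, A < r & m0 b r / r ^+ 2 <= c) -> gGL b <= c.
Proof.
move=> cv H; rewrite leNgt; apply/negP => gc.
have [A [_ hA]] := cvgr_gt _ cv _ gc.
have [r Ar hr] := H A.
by have := hA r Ar; rewrite ltNge hr.
Qed.

End plane_energy.

(** * Magnetic translations and invariance of the energy *)

Section magnetic_translation.
Variable R : realType.
Local Notation mu2 := (@leb2 R).
Local Notation D1 f x := (derive f x (e21 R)).
Local Notation D2 f x := (derive f x (e22 R)).

(** On the line, the derivative in direction v is v times the derivative in direction 1, so closure
    under multiples replaces closure under all directions. *)
Lemma smooth1_coind (S : (R -> R) -> Prop) :
  (forall f x, S f -> derivable f x 1) ->
  (forall f, S f -> S (fun x => 'D_1 f x)) ->
  (forall (a : R) f, S f -> S (fun x => a * f x)) ->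
  forall f, S f -> smooth f.
Proof.
move=> dS DS ZS; apply: smooth_coind => [f x Sf|f v Sf].
  by apply/derivable1_diffP; exact: dS.
rewrite (_ : (fun x => _) = (fun x => v * 'D_1 f x)); first by apply: ZS; exact: DS.
apply/funext => x; have /derivable1_diffP dx := dS f x Sf.
by rewrite deriveE// -{1}[v]mulr1 -[v * 1]/(v *: 1) linearZ/= -deriveE.
Qed.

Lemma derive_cos_sin (a b x : R) :
  is_derive x 1 (fun x => a * cos x + b * sin x) (b * cos x + (- a) * sin x).
Proof.
have h : is_derive x 1 ((a \*: (cos : R -> R)) + (b \*: (sin : R -> R))) (a *: (- sin x) + b *: cos x).
  by apply: is_deriveD.
apply: is_derive_eq.
by rewrite /GRing.scale/=; ring.
Qed.

Lemma smooth_cos_sin (a b : R) : smooth (fun x => a * cos x + b * sin x).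
Proof.
apply: (@smooth1_coind (fun f => exists a b, f = fun x => a * cos x + b * sin x)).
- by move=> f x [c [d ->]]; have [] := derive_cos_sin c d x.
- move=> f [c [d ->]]; exists d, (- c); apply/funext => x.
  by have [_ ->] := derive_cos_sin c d x.
- by move=> e f [c [d ->]]; exists (e * c), (e * d); apply/funext => x; rewrite mulrDr !mulrA.
- by exists a, b.
Qed.

Lemma smooth_cos : smooth (cos : R -> R).
Proof.
rewrite (_ : cos = fun x => 1 * cos x + 0 * sin x); first exact: smooth_cos_sin.
by apply/funext => x; rewrite mul1r mul0r addr0.
Qed.

Lemma smooth_sin : smooth (sin : R -> R).
Proof.
rewrite (_ : sin = fun x => 0 * cos x + 1 * sin x); first exact: smooth_cos_sin.
by apply/funext => x; rewrite mul1r mul0r add0r.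
Qed.

(* [grad (phase a) = A(a)], so that multiplying by [exp (i phase a)] turns [A(x - a)] into [A(x)] *)
Definition phase (a x : pt2 R) : R := 2^-1 * (a.1 * x.2 - a.2 * x.1).

Lemma smooth_fst : smooth (fun x : pt2 R => x.1).
Proof. exact: (smooth_affine (@affine_fst R R R) (@smooth_id R)). Qed.

Lemma smooth_snd : smooth (fun x : pt2 R => x.2).
Proof. exact: (smooth_affine (@affine_snd R R R) (@smooth_id R)). Qed.

Lemma smooth_phase a : smooth (phase a).
Proof.
by apply: smoothZ; apply: smoothB; apply: smoothZ; [exact: smooth_snd|exact: smooth_fst].
Qed.

Lemma derive_phase a v x : 'D_v (phase a) x = phase a v.
Proof.
have aff : affine_map (phase a) (phase a).
  split=> [z y h|z]; last exact: smooth_differentiable (smooth_phase a).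
  rewrite -[LHS]/(2^-1 * (a.1 * (h * y.2 + z.2) - a.2 * (h * y.1 + z.1))).
  by rewrite -[RHS]/(h * (2^-1 * (a.1 * y.2 - a.2 * y.1)) + 2^-1 * (a.1 * z.2 - a.2 * z.1)); ring.
have := derive_affine id x v aff; rewrite derive_id; exact.
Qed.

(** With u = P + i Q, [translP] and [translQ] are the real and imaginary parts of exp(i phase_a(x))
    u(x - a). *)
Definition translP (a : pt2 R) (P Q : pt2 R -> R) x :=
  cos (phase a x) * P (x - a) - sin (phase a x) * Q (x - a).
Definition translQ (a : pt2 R) (P Q : pt2 R -> R) x :=
  sin (phase a x) * P (x - a) + cos (phase a x) * Q (x - a).

Lemma smooth_transl a P Q : smooth P -> smooth Q ->
  smooth (translP a P Q) /\ smooth (translQ a P Q).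
Proof.
move=> sP sQ.
have sa f : smooth f -> smooth (fun x : pt2 R => f (x - a)).
  by move=> sf; exact: (smooth_affine (affine_shift a) sf).
have sc := smooth_comp smooth_cos (smooth_phase a).
have ss := smooth_comp smooth_sin (smooth_phase a).
by split; [apply: smoothB|apply: smoothD]; apply: smoothM => //; exact: sa.
Qed.

Lemma derive_cosphase a v x :
  is_derive x v (fun x => cos (phase a x)) (- sin (phase a x) * phase a v).
Proof.
have sc := smooth_comp smooth_cos (smooth_phase a).
split; first by apply: diff_derivable; exact: smooth_differentiable.
rewrite (@derive_comp1 _ _ cos (phase a)) ?derive_phase ?derive_val//.
  exact: smooth_differentiable (smooth_phase a).
exact: smooth_differentiable smooth_cos.
Qed.

Lemma derive_sinphase a v x :
  is_derive x v (fun x => sin (phase a x)) (cos (phase a x) * phase a v).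
Proof.
have sc := smooth_comp smooth_sin (smooth_phase a).
split; first by apply: diff_derivable; exact: smooth_differentiable.
rewrite (@derive_comp1 _ _ sin (phase a)) ?derive_phase ?derive_val//.
  exact: smooth_differentiable (smooth_phase a).
exact: smooth_differentiable smooth_sin.
Qed.

Lemma derive_shifted a v (P : pt2 R -> R) x : smooth P ->
  is_derive x v (fun x => P (x - a)) ('D_v P (x - a)).
Proof.
move=> sP; split.
  apply: diff_derivable; exact: smooth_differentiable (smooth_affine (affine_shift a) sP).
exact: (derive_affine P x v (affine_shift a)).
Qed.

Lemma derive_transl a v P Q x : smooth P -> smooth Q ->
  'D_v (translP a P Q) x =
    cos (phase a x) * ('D_v P (x - a) - phase a v * Q (x - a))
    - sin (phase a x) * ('D_v Q (x - a) + phase a v * P (x - a)) /\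
  'D_v (translQ a P Q) x =
    sin (phase a x) * ('D_v P (x - a) - phase a v * Q (x - a))
    + cos (phase a x) * ('D_v Q (x - a) + phase a v * P (x - a)).
Proof.
move=> sP sQ.
have dc := derive_cosphase a v x; have ds := derive_sinphase a v x.
have dP := derive_shifted a v x sP; have dQ := derive_shifted a v x sQ.
split.
- have := is_deriveB (is_deriveM dc dP) (is_deriveM ds dQ).
  by move=> [_ e]; rewrite [LHS]e /GRing.scale/=; ring.
- have := is_deriveD (is_deriveM ds dP) (is_deriveM dc dQ).
  by move=> [_ e]; rewrite [LHS]e /GRing.scale/=; ring.
Qed.

Lemma rot_sqr (c s X Y : R) : c ^+ 2 + s ^+ 2 = 1 ->
  (c * X - s * Y) ^+ 2 + (s * X + c * Y) ^+ 2 = X ^+ 2 + Y ^+ 2.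
Proof.
move=> h; rewrite -[RHS]mul1r -h; ring.
Qed.

(** The gradient of the phase compensates the change of potential, so the covariant gradient of the
    translate is that of u at x - a times a number of modulus 1; [rot_sqr] says that such a factor
    preserves the squared modulus. *)
Lemma dens_transl b a P Q x : smooth P -> smooth Q ->
  dens b (translP a P Q) (translQ a P Q) x = dens b P Q (x - a).
Proof.
move=> sP sQ; rewrite /dens /edens /kin.
have [-> ->] := derive_transl a (e21 R) x sP sQ.
have [-> ->] := derive_transl a (e22 R) x sP sQ.
have cs := cos2Dsin2 (phase a x).
rewrite /translP /translQ.
set c := cos _ in cs *; set s := sin _ in cs *.
set p := P _; set q := Q _; set p1 := D1 P _; set p2 := D2 P _; set q1 := D1 Q _; set q2 := D2 Q _.
(* The potential is linear, and [phase a] is linear with partial derivatives given by its values at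
   the basis vectors. *)
have -> : A01 (x - a) = A01 x - phase a (e21 R) by rewrite /A01 /phase /=; field.
have -> : A02 (x - a) = A02 x - phase a (e22 R) by rewrite /A02 /phase /=; field.
rewrite !(rot_sqr _ _ cs).
set t1 := phase a (e21 R); set t2 := phase a (e22 R); set A1 := A01 x; set A2 := A02 x.
rewrite -(rot_sqr (p1 + (A1 - t1) * q) (q1 - (A1 - t1) * p) cs).
rewrite -[in RHS](addrA _ ((p2 + (A2 - t2) * q) ^+ 2)) -(rot_sqr (p2 + (A2 - t2) * q) (q2 - (A2 - t2) * p) cs).
by congr (_ * _ - _ + _); ring.
Qed.

Lemma E2_transl r b a P Q : 0 <= r -> Cc2 r P -> Cc2 r Q ->
  E2 b (translP a P Q) (translQ a P Q) = E2 b P Q.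
Proof.
move=> r0 cP cQ; have iD := dens_integrable b r0 cP cQ.
rewrite /E2 -(Rintegral_shift2 a iD); congr (Rintegral _ _ _).
by apply/funext => x; rewrite dens_transl//; [case: cP|case: cQ].
Qed.

End magnetic_translation.

(** * Tiling by translates: every planar energy bounds g(b) from above *)

Section tiling.
Variable R : realType.
Local Notation mu2 := (@leb2 R).
Local Notation D1 f x := (derive f x (e21 R)).
Local Notation D2 f x := (derive f x (e22 R)).

(** [w] and [h] are half-widths, whereas [Cc2] takes a full side. Rectangles occur because doubling
    is done in one direction at a time. *)
Definition Cbox (w h : R) (f : pt2 R -> R) := smooth f /\ exists2 d : R, 0 < d &
  forall x : pt2 R, ~ (`|x.1| <= w - d /\ `|x.2| <= h - d) -> f x = 0.

Lemma Cbox_Cc2 w h r f : w <= r / 2 -> h <= r / 2 -> Cbox w h f -> Cc2 r f.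
Proof.
move=> wr hr [sf [d d0 f0]]; split=> //; exists d => // x xr; apply: f0 => -[h1 h2].
by apply: xr; split; [apply: le_trans h1 _|apply: le_trans h2 _]; rewrite lerD2r.
Qed.

Lemma derive_add (f g : pt2 R -> R) v x : smooth f -> smooth g ->
  'D_v (fun x => f x + g x) x = 'D_v f x + 'D_v g x.
Proof. by move=> sf sg; apply: deriveD; apply: diff_derivable; exact: smooth_differentiable. Qed.

(** Openness of [U] makes the derivatives vanish along with the functions, so that no interaction
    term survives. *)
Lemma dens_add_vanish b P1 Q1 P2 Q2 (U : set (pt2 R)) x :
  smooth P1 -> smooth Q1 -> smooth P2 -> smooth Q2 -> open U -> U x ->
  (forall y, U y -> P2 y = 0 /\ Q2 y = 0) ->
  dens b (fun x => P1 x + P2 x) (fun x => Q1 x + Q2 x) x = dens b P1 Q1 x /\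
  dens b P2 Q2 x = 0.
Proof.
move=> sP1 sQ1 sP2 sQ2 oU Ux U0.
have P0 y : U y -> P2 y = 0 by case/U0.
have Q0 y : U y -> Q2 y = 0 by case/U0.
have dP v : 'D_v P2 x = 0 by exact: (derive_supp v oU P0 Ux).
have dQ v : 'D_v Q2 x = 0 by exact: (derive_supp v oU Q0 Ux).
rewrite /dens !derive_add// !dP !dQ (P0 x)// (Q0 x)// !addr0; split=> //.
by rewrite /edens /kin; ring.
Qed.

(** Every point has a neighbourhood on which one of the two copies vanishes, so the densities add
    up, and each copy keeps the energy of the original by translation invariance. *)
Lemma E2_double b r a P Q (U1 U2 : set (pt2 R)) : 0 <= r -> Cc2 r P -> Cc2 r Q ->
  open U1 -> open U2 -> (forall x, U1 x \/ U2 x) ->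
  (forall x, U1 x -> P (x - a) = 0 /\ Q (x - a) = 0) ->
  (forall x, U2 x -> P (x + a) = 0 /\ Q (x + a) = 0) ->
  E2 b (fun x => translP a P Q x + translP (- a) P Q x)
       (fun x => translQ a P Q x + translQ (- a) P Q x) = 2 * E2 b P Q.
Proof.
move=> r0 cP cQ oU1 oU2 U12 h1 h2.
have sP : smooth P by case: cP. have sQ : smooth Q by case: cQ.
have [sP1 sQ1] := smooth_transl a sP sQ; have [sP2 sQ2] := smooth_transl (- a) sP sQ.
have iD := dens_integrable b r0 cP cQ.
have z1 x : U1 x -> translP a P Q x = 0 /\ translQ a P Q x = 0.
  by move=> /h1[e1 e2]; rewrite /translP /translQ e1 e2 !mulr0 subr0 addr0.
have z2 x : U2 x -> translP (- a) P Q x = 0 /\ translQ (- a) P Q x = 0.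
  by move=> /h2[e1 e2]; rewrite /translP /translQ opprK e1 e2 !mulr0 subr0 addr0.
transitivity (\int[mu2]_x (dens b P Q (x - a) + dens b P Q (x - - a))).
  congr (Rintegral _ _ _); apply/funext => x.
  rewrite -!(dens_transl b _ _ sP sQ).
  have [Ux|Ux] := U12 x.
    have [e1 e2] := dens_add_vanish b sP2 sQ2 sP1 sQ1 oU1 Ux z1.
    have cP12 : (fun x => translP a P Q x + translP (- a) P Q x) = (fun x => translP (- a) P Q x + translP a P Q x).
      by apply/funext => y; rewrite addrC.
    have cQ12 : (fun x => translQ a P Q x + translQ (- a) P Q x) = (fun x => translQ (- a) P Q x + translQ a P Q x).
      by apply/funext => y; rewrite addrC.
    by rewrite cP12 cQ12 e1 e2 add0r.
  by have [-> ->] := dens_add_vanish b sP1 sQ1 sP2 sQ2 oU2 Ux z2; rewrite addr0.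
rewrite RintegralD//; [|exact: integrable_shift2|exact: integrable_shift2].
by rewrite !Rintegral_shift2// mulr2n mulrDl mul1r.
Qed.

(* [U1] avoids the support of the translate by [a], and [U2] that of the translate by [- a];
   [m] is the margin left by the supports. *)
Lemma Cbox_double b w h w' h' (a : pt2 R) (U1 U2 : R -> set (pt2 R)) P Q : 0 < w -> 0 < h ->
  (forall m, open (U1 m)) -> (forall m, open (U2 m)) ->
  (forall m x, 0 < m -> U1 m x \/ U2 m x) ->
  (forall m x, `|(x - a).1| <= w - m -> `|(x - a).2| <= h - m ->
     ~ U1 m x /\ (`|x.1| <= w' - m /\ `|x.2| <= h' - m)) ->
  (forall m x, `|(x + a).1| <= w - m -> `|(x + a).2| <= h - m ->
     ~ U2 m x /\ (`|x.1| <= w' - m /\ `|x.2| <= h' - m)) ->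
  Cbox w h P -> Cbox w h Q ->
  exists P' Q', [/\ Cbox w' h' P', Cbox w' h' Q' & E2 b P' Q' = 2 * E2 b P Q].
Proof.
move=> w0 h0 oU1 oU2 U12 hU1 hU2 cP cQ; have [sP [d d0 P0]] := cP; have [sQ [e e0 Q0]] := cQ.
pose m := Num.min d e.
have m0 : 0 < m by rewrite lt_min d0.
have md : m <= d by rewrite ge_min lexx.
have me : m <= e by rewrite ge_min lexx orbT.
have PQ0 x : ~ (`|x.1| <= w - m /\ `|x.2| <= h - m) -> P x = 0 /\ Q x = 0.
  by move=> H; rewrite P0 ?Q0// => -[h1 h2]; apply: H; split; [apply: le_trans h1 _|apply: le_trans h2 _|apply: le_trans h1 _|apply: le_trans h2 _]; rewrite lerD2l lerN2.
have r0 : 0 <= 2 * (w + h) by apply: mulr_ge0 => //; apply: ltW; apply: addr_gt0.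
have cP' : Cc2 (2 * (w + h)) P by apply: Cbox_Cc2 cP; lra.
have cQ' : Cc2 (2 * (w + h)) Q by apply: Cbox_Cc2 cQ; lra.
have [sP1 sQ1] := smooth_transl a sP sQ; have [sP2 sQ2] := smooth_transl (- a) sP sQ.
have supp x : ~ (`|x.1| <= w' - m /\ `|x.2| <= h' - m) ->
    (P (x - a) = 0 /\ Q (x - a) = 0) /\ (P (x + a) = 0 /\ Q (x + a) = 0).
  move=> H; split; apply: PQ0 => -[h1 h2]; apply: H.
    by have [] := hU1 m x h1 h2.
  by have [] := hU2 m x h1 h2.
exists (fun x => translP a P Q x + translP (- a) P Q x), (fun x => translQ a P Q x + translQ (- a) P Q x).
split.
- split; first exact: smoothD.
  exists m => // x /supp[[e1 e2] [e3 e4]].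
  by rewrite /translP opprK e1 e2 e3 e4 !mulr0 !subr0 addr0.
- split; first exact: smoothD.
  exists m => // x /supp[[e1 e2] [e3 e4]].
  by rewrite /translQ opprK e1 e2 e3 e4 !mulr0 !addr0.
apply: (E2_double b (U1 := U1 m) (U2 := U2 m) r0 cP' cQ') => //.
- by move=> x; exact: U12.
- by move=> x Ux; apply: PQ0 => -[h1 h2]; have [] := hU1 m x h1 h2.
- by move=> x Ux; apply: PQ0 => -[h1 h2]; have [] := hU2 m x h1 h2.
Qed.

Let open_halfplane (g : pt2 R -> R) m : continuous g -> open [set x | g x < m] /\ open [set x | m < g x].
Proof.
move=> cg; split.
  by apply: (@open_comp _ _ g [set t | t < m]); [move=> x _; exact: cg|exact: open_lt].
by apply: (@open_comp _ _ g [set t | m < t]); [move=> x _; exact: cg|exact: open_gt].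
Qed.

Let norm_shift (w m t : R) : 0 < w ->
  (`|t - w| <= w - m -> m <= t /\ `|t| <= 2 * w - m) /\
  (`|t + w| <= w - m -> t <= - m /\ `|t| <= 2 * w - m).
Proof.
move=> w0; split; rewrite !ler_norml => /andP[? ?]; split; [lra|apply/andP; split; lra|lra|apply/andP; split; lra].
Qed.

Lemma Cbox_double1 b w h P Q : 0 < w -> 0 < h -> Cbox w h P -> Cbox w h Q ->
  exists P' Q', [/\ Cbox (2 * w) h P', Cbox (2 * w) h Q' & E2 b P' Q' = 2 * E2 b P Q].
Proof.
move=> w0 h0.
apply: (@Cbox_double b w h _ _ (w, 0) (fun m => [set x | x.1 < m]) (fun m => [set x | - m < x.1])) => //.
- by move=> m; apply: (proj1 (open_halfplane _ _)) => x; exact: cvg_fst.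
- by move=> m; apply: (proj2 (open_halfplane _ _)) => x; exact: cvg_fst.
- by move=> m x m0 /=; have [?|?] := ltP x.1 m; [left|right; lra].
- move=> m [s t] /= h1; rewrite subr0 => h2; have [hs hs'] := (norm_shift m s w0).1 h1.
  by rewrite ltNge hs.
- move=> m [s t] /= h1; rewrite addr0 => h2; have [hs hs'] := (norm_shift m s w0).2 h1.
  by rewrite ltNge hs.
Qed.

Lemma Cbox_double2 b w h P Q : 0 < w -> 0 < h -> Cbox w h P -> Cbox w h Q ->
  exists P' Q', [/\ Cbox w (2 * h) P', Cbox w (2 * h) Q' & E2 b P' Q' = 2 * E2 b P Q].
Proof.
move=> w0 h0.
apply: (@Cbox_double b w h _ _ (0, h) (fun m => [set x | x.2 < m]) (fun m => [set x | - m < x.2])) => //.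
- by move=> m; apply: (proj1 (open_halfplane _ _)) => x; exact: cvg_snd.
- by move=> m; apply: (proj2 (open_halfplane _ _)) => x; exact: cvg_snd.
- by move=> m x m0 /=; have [?|?] := ltP x.2 m; [left|right; lra].
- move=> m [s t] /=; rewrite subr0 => h1 h2; have [ht ht'] := (norm_shift m t h0).1 h2.
  by rewrite ltNge ht.
- move=> m [s t] /=; rewrite addr0 => h1 h2; have [ht ht'] := (norm_shift m t h0).2 h2.
  by rewrite ltNge ht.
Qed.

Lemma E2_tile (b r : R) P Q n : 0 < r -> Cc2 r P -> Cc2 r Q ->
  exists P' Q', [/\ Cc2 (2 ^+ n * r) P', Cc2 (2 ^+ n * r) Q' & E2 b P' Q' = 4 ^+ n * E2 b P Q].
Proof.
move=> r0 cP cQ; elim: n => [|n [P' [Q' [cP' cQ' eE]]]].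
  by exists P, Q; rewrite !expr0 !mul1r.
set s := 2 ^+ n * r in cP' cQ' *.
have s0 : 0 < s / 2 by rewrite divr_gt0// mulr_gt0// exprn_gt0.
have [P1 [Q1 [cP1 cQ1 e1]]] := Cbox_double1 b s0 s0 cP' cQ'.
have s0' : 0 < 2 * (s / 2) by rewrite mulr_gt0.
have [P2 [Q2 [cP2 cQ2 e2]]] := Cbox_double2 b s0' s0 cP1 cQ1.
have sE : 2 * (s / 2) <= 2 ^+ n.+1 * r / 2.
  by rewrite exprS -[2 * 2 ^+ n * r]mulrA -/s mulrA.
exists P2, Q2; split; [exact: Cbox_Cc2 cP2|exact: Cbox_Cc2 cQ2|].
by rewrite e2 e1 eE exprS; ring.
Qed.

(** The 4^n copies fill a square of area 4^n r^2, so the energy per unit area stays constant as n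
    grows. *)
Lemma gGL_le_E2 (b r : R) P Q : 0 <= b -> 0 < r -> cvg (m0 b r / r ^+ 2 @[r --> +oo]) ->
  Cc2 r P -> Cc2 r Q -> gGL b * r ^+ 2 <= E2 b P Q.
Proof.
move=> b0 r0 cv cP cQ; rewrite -ler_pdivlMr ?exprn_gt0//.
apply: le_lim_m0 => // A.
have [n hn] : exists n : nat, A < 2 ^+ n * r.
  exists (Num.truncn (A / r)).+1.
  rewrite -ltr_pdivrMr//; apply: lt_trans (truncnS_gt _) _.
  by rewrite -natrX ltr_nat ltn_expl.
exists (2 ^+ n * r) => //.
have [P' [Q' [cP' cQ' eE]]] := E2_tile b n r0 cP cQ.
have s0 : 0 < 2 ^+ n * r by rewrite mulr_gt0// exprn_gt0.
rewrite ler_pdivrMr ?exprn_gt0//.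
apply: le_trans (m0_le_E2 b0 s0 cP' cQ') _.
rewrite eE exprMn -exprM mulnC exprM (_ : 2 ^+ 2 = 4); last by rewrite -natrX.
by rewrite [leRHS]mulrCA divfK// gt_eqF// exprn_gt0.
Qed.

Lemma gGL_le_m0 (b r : R) : 0 <= b <= 1 -> 0 < r -> cvg (m0 b r / r ^+ 2 @[r --> +oo]) ->
  gGL b * r ^+ 2 <= m0 b r.
Proof.
move=> b01 r0 cv; apply/ler_addgt0Pr => e e0.
have [P [Q [cP cQ h]]] := m0_approx b01 r0 e0.
apply: le_trans (ltW h); apply: gGL_le_E2 => //; by case/andP: b01.
Qed.

End tiling.

Section basis_vectors.
Variable R : realType.

Lemma fst_e21 : (e21 R).1 = 1. Proof. by []. Qed.
Lemma snd_e21 : (e21 R).2 = 0. Proof. by []. Qed.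
Lemma fst_e22 : (e22 R).1 = 0. Proof. by []. Qed.
Lemma snd_e22 : (e22 R).2 = 1. Proof. by []. Qed.
Lemma e31E : e31 R = (e21 R, 0). Proof. by []. Qed.
Lemma e32E : e32 R = (e22 R, 0). Proof. by []. Qed.
Lemma e33E : e33 R = (0, 1). Proof. by []. Qed.

End basis_vectors.

(* comparing these vectors would otherwise make unification compare 0 and 1 in R *)
Opaque e21 e22 e31 e32 e33.

(** * Integrals of the cutoff and of its gradient *)

Section cutoff_integrals.
Variable R : realType.
Local Notation mu1 := (@lebesgue_measure R).
Local Notation mu2 := (@leb2 R).
Local Notation D1 f x := (derive f x (e21 R)).
Local Notation D2 f x := (derive f x (e22 R)).

Lemma Cc1_cutoff (r : R) : Cc1 r (cutoff r).
Proof.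
split; first exact: smooth_cutoff.
by exists 1 => // x; exact: cutoff_eq0.
Qed.

Lemma derive_near_cst (f : R -> R) (U : set R) (c x : R) : open U -> U x ->
  (forall y, U y -> f y = c) -> 'D_1 f x = 0.
Proof.
move=> oU Ux Uc; rewrite -(derive_cst c x (1 : R)); apply: near_eq_derive.
by apply: filterS (open_nbhs_nbhs (conj oU Ux)) => y Uy; rewrite Uc.
Qed.

(** The step is constant on each side of [0, 1], so its derivative is continuous with compact
    support. *)
Lemma derive_step_bounded : exists2 M : R, 0 <= M & forall x : R, `|'D_1 (@step R) x| <= M.
Proof.
have c4 : csupp1 4 (fun x : R => 'D_1 (@step R) x).
  split; first exact: smooth_continuous (smooth_derive (1 : R) (@smooth_step R)).
  move=> x; rewrite itv1P => /negP; rewrite -leNgt ler_normr => /orP[h|h].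
    apply: (@derive_near_cst _ [set y | 1 < y] 0); [exact: open_gt|rewrite /=; lra|].
    by move=> y /= /ltW; exact: step_eq0.
  apply: (@derive_near_cst _ [set y | y < 0] 1); [exact: open_lt|rewrite /=; lra|].
  by move=> y /= /ltW; exact: step_eq1.
have [M hM] := csupp1_bounded (ler0n R 4) c4.
by exists M => //; apply: le_trans (hM 0).
Qed.

Lemma derive_cutoff (r s : R) : 'D_1 (cutoff r) s =
  'D_1 (@step R) (s - (r / 2 - 2)) * step (- s - (r / 2 - 2))
  - step (s - (r / 2 - 2)) * 'D_1 (@step R) (- s - (r / 2 - 2)).
Proof.
set c := r / 2 - 2.
have d1 : is_derive s (1 : R) (fun s => s - c) 1.
  by apply: is_derive_eq; rewrite subr0.
have d2 : is_derive s (1 : R) (fun s => - s - c) (- 1).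
  by apply: is_derive_eq; rewrite subr0.
have ds (x : R) : is_derive x (1 : R) (@step R) ('D_(1 : R) (@step R) x).
  exact: smooth1_is_derive (@smooth_step R).
have d3 := @is_derive1_comp _ _ (fun s : R => s - c) _ _ _ (ds (s - c)) d1.
have d4 := @is_derive1_comp _ _ (fun s : R => - s - c) _ _ _ (ds (- s - c)) d2.
have [_ e] := is_deriveM d3 d4.
have key (A B C D : R) : A *: (D * -1) + B *: (C * 1) = C * B - A * D.
  by rewrite /GRing.scale/=; ring.
have -> : cutoff r = (@step R \o (fun s => s - c)) * (@step R \o (fun s => - s - c)) by [].
rewrite e; exact: key.
Qed.

Lemma derive_cutoff_le : exists2 K : R, 0 <= K & forall r s : R,
  'D_1 (cutoff r) s ^+ 2 <= K /\
  (~ (r / 2 - 2 <= `|s| <= r / 2 - 1) -> 'D_1 (cutoff r) s = 0).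
Proof.
have [M M0 hM] := derive_step_bounded.
exists ((2 * M) ^+ 2); first exact: sqr_ge0.
move=> r s; split.
  rewrite -[X in X <= _]ger0_norm ?sqr_ge0// normrX ler_sqr ?nnegrE ?mulr_ge0//.
  rewrite derive_cutoff mulr2n mulrDl mul1r; apply: le_trans (ler_normB _ _) _.
  have st x : `|@step R x| <= 1 by rewrite ger0_norm ?step_ge0// step_le1.
  by apply: lerD; rewrite normrM; [rewrite -[leRHS]mulr1|rewrite -[leRHS]mul1r]; apply: ler_pM.
move=> h; have [h1|h1] := ltP `|s| (r / 2 - 2).
  apply: (@derive_near_cst _ ((fun y : R => `|y|) @^-1` [set t | t < r / 2 - 2]) 1) => //.
    by apply: open_comp; [move=> y _; exact: (@norm_continuous _ R y)|exact: open_lt].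
  by move=> y /= /ltW; exact: cutoff_eq1.
have h2 : r / 2 - 1 < `|s|.
  by rewrite ltNge; apply/negP => h2; apply: h; rewrite h1.
apply: (@derive_near_cst _ ((fun y : R => `|y|) @^-1` [set t | r / 2 - 1 < t]) 0) => //.
  by apply: open_comp; [move=> y _; exact: (@norm_continuous _ R y)|exact: open_gt].
by move=> y /= hy; apply: cutoff_eq0; apply/negP; rewrite -ltNge.
Qed.

(** The squared norm of the cutoff on the line, of order [r]; [dcut] is that of its derivative,
    bounded independently of [r]. *)
Definition kap (r : R) := \int[mu1]_s cutoff r s ^+ 2.
Definition dcut (r : R) := \int[mu1]_s 'D_1 (cutoff r) s ^+ 2.

Lemma Cc1X r (f : R -> R) : Cc1 r f -> Cc1 r (fun x => f x ^+ 2).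
Proof. by move=> cf; under eq_fun do rewrite expr2; apply: Cc1M => //; case: cf. Qed.

Lemma Rintegral_itv1_cst r (c : R) : 0 <= r -> \int[mu1]_(x in itv1 r) c = c * r.
Proof.
move=> r0; rewrite Rintegral_cst; last exact: measurable_itv1.
by congr (_ * _); exact: (congr1 fine (leb_itv1 r0)).
Qed.

Lemma integrable_itv1_cst r (c : R) : 0 <= r -> mu1.-integrable (itv1 r) (EFin \o cst c).
Proof.
move=> r0; apply: integrable_cst_fin; first exact: measurable_itv1.
by apply: (@le_lt_trans _ _ r%:E); [rewrite -(leb_itv1 r0)|exact: ltry].
Qed.

Lemma kap_le r : 0 <= r -> kap r <= r.
Proof.
move=> r0; have cc := Cc1X (Cc1_cutoff r); have [_ c0] := Cc1_csupp cc.
have -> : kap r = \int[mu1]_(x in itv1 r) cutoff r x ^+ 2 by apply/esym/Rintegral_supp.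
rewrite -[leRHS]mul1r -Rintegral_itv1_cst//.
apply: le_Rintegral; first exact: measurable_itv1.
- apply: (@integrableS _ _ _ _ setT); [by []|exact: measurable_itv1|by []|].
  exact: (Cc1_integrable r0 cc).
- exact: integrable_itv1_cst.
- by move=> x _; rewrite expr_le1// ?cutoff_le1// cutoff_ge0.
Qed.

Lemma kap_ge r : 4 <= r -> r - 4 <= kap r.
Proof.
move=> r4; have r0 : 0 <= r by lra. have r40 : 0 <= r - 4 by lra.
have cc := Cc1X (Cc1_cutoff r); have ic := Cc1_integrable r0 cc.
rewrite -[leLHS]mul1r -Rintegral_itv1_cst//.
apply: (@le_trans _ _ (\int[mu1]_(x in itv1 (r - 4)) cutoff r x ^+ 2)).
  apply: le_Rintegral; first exact: measurable_itv1.
  - exact: integrable_itv1_cst.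
  - by apply: (@integrableS _ _ _ _ setT); [by []|exact: measurable_itv1|by []|].
  - move=> x /itv1P xr; rewrite cutoff_eq1 ?expr1n//; lra.
by apply: (Rintegral_subset_le _ _ ic); [exact: measurable_itv1|move=> x; exact: sqr_ge0].
Qed.

Lemma Rintegral_indic_itv (a b : R) : a < b ->
  \int[mu1]_x (\1_(`[a, b]%classic : set R) x : R) = b - a.
Proof.
move=> ab.
rewrite (_ : (fun x => _) = (cst 1 : R -> R) \_ `[a, b]%classic); last first.
  by apply/funext => x; rewrite patchE indicE; case: ifP.
rewrite -Rintegral_mkcond Rintegral_cst// mul1r.
have h : lebesgue_measure (`[a, b]%classic : set R) = (b - a)%:E.
  by rewrite lebesgue_measure_itv/= lte_fin ab EFinB.
exact: (congr1 fine h).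
Qed.

(** The derivative lives on two intervals of length 1, whatever [r] is. *)
Lemma dcut_le : exists2 C : R, 0 <= C & forall r, 0 < r -> dcut r <= C.
Proof.
have [K K0 hK] := derive_cutoff_le.
exists (K * 2) => [|r r0]; first by rewrite mulr_ge0.
pose I1 := `[(r / 2 - 2), (r / 2 - 1)]%classic : set R.
pose I2 := `[(- (r / 2 - 1)), (- (r / 2 - 2))]%classic : set R.
have i1 : mu1.-integrable setT (EFin \o (\1_I1 : R -> R)) by exact: integrable_indic_itv.
have i2 : mu1.-integrable setT (EFin \o (\1_I2 : R -> R)) by exact: integrable_indic_itv.
have e1 : \int[mu1]_x (\1_I1 x : R) = 1 by rewrite Rintegral_indic_itv; lra.
have e2 : \int[mu1]_x (\1_I2 x : R) = 1 by rewrite Rintegral_indic_itv; lra.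
have -> : K * 2 = K * (\int[mu1]_x (\1_I1 x : R)) + K * (\int[mu1]_x (\1_I2 x : R)).
  by rewrite e1 e2; ring.
apply: le_Rintegral_lin2 => //.
  by apply: Cc1_integrable (ltW r0) _; apply: Cc1X; apply: Cc1_derive; exact: Cc1_cutoff.
move=> x _; have [h1 h2] := hK r x.
have [hx|/h2 ->] := pselect (r / 2 - 2 <= `|x| <= r / 2 - 1); last first.
  by rewrite expr0n addr_ge0// mulr_ge0// indicE ler0n.
apply: le_trans h1 _; rewrite -mulrDr -[leLHS]mulr1; apply: ler_wpM2l => //.
have [x0|x0] := lerP 0 x.
  have -> : \1_I1 x = 1 :> R.
    by rewrite indicE mem_set// /I1/= in_itv/=; move: hx; rewrite ger0_norm.
  by rewrite lerDl indicE ler0n.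
have -> : \1_I2 x = 1 :> R.
  rewrite indicE mem_set// /I2/= in_itv/=; move: hx; rewrite ltr0_norm// => /andP[? ?].
  by apply/andP; split; lra.
by rewrite lerDr indicE ler0n.
Qed.

(** The integrand is half the derivative of the squared cutoff. This removes the terms linear in the
    gradient of the cutoff from the averaged energy. *)
Lemma int_cutoff_derive r : 0 < r -> \int[mu1]_s (cutoff r s * 'D_1 (cutoff r) s) = 0.
Proof.
move=> r0; have cc := Cc1_cutoff r.
have sc := smooth_cutoff r.
have h := Cc1_int_derive r0 (Cc1X cc).
have dE s : 'D_1 (fun s => cutoff r s ^+ 2) s = 2 * (cutoff r s * 'D_1 (cutoff r) s).
  rewrite (_ : (fun s => _) = cutoff r * cutoff r); last by apply/funext => z; rewrite expr2.
  have [df _] := smooth1_is_derive s sc.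
  by rewrite deriveM// /GRing.scale/=; ring.
have iM : mu1.-integrable setT (EFin \o (fun s => cutoff r s * 'D_1 (cutoff r) s)).
  by apply: Cc1_integrable (ltW r0) _; apply: Cc1M => //; exact: Cc1_derive.
move: h; under eq_Rintegral do rewrite dE.
by rewrite RintegralZl// => /eqP; rewrite mulf_eq0 pnatr_eq0 => /eqP.
Qed.

Definition cutoff2 (r : R) (y : pt2 R) := cutoff r y.1 * cutoff r y.2.

Lemma Cc2_tensor (r : R) h : Cc1 r h -> Cc2 r (fun x : pt2 R => h x.1 * h x.2).
Proof.
move=> [sh [d d0 h0]]; split.
  apply: smoothM; first exact: (smooth_affine (@affine_fst R R R) sh).
  exact: (smooth_affine (@affine_snd R R R) sh).
exists d => // x xr.
have [h1|h1] := pselect (`|x.1| <= r / 2 - d); last by rewrite (h0 _ h1) mul0r.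
have [h2|h2] := pselect (`|x.2| <= r / 2 - d); last by rewrite (h0 _ h2) mulr0.
by exfalso; apply: xr.
Qed.

Lemma Cc2_cutoff2 r : Cc2 r (cutoff2 r).
Proof. exact: Cc2_tensor (Cc1_cutoff r). Qed.

Lemma smooth_cutoff2 r : smooth (cutoff2 r).
Proof. by case: (Cc2_cutoff2 r). Qed.

Lemma cutoff2_ge0 r y : 0 <= cutoff2 r y.
Proof. by rewrite mulr_ge0// cutoff_ge0. Qed.

Lemma cutoff2_le1 r y : cutoff2 r y <= 1.
Proof. by rewrite mulr_ile1// ?cutoff_ge0// cutoff_le1. Qed.

Lemma derive_tensor (f g : R -> R) (y v : pt2 R) : smooth f -> smooth g ->
  'D_v (fun y : pt2 R => f y.1 * g y.2) y = f y.1 * 'D_(v.2) g y.2 + g y.2 * 'D_(v.1) f y.1.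
Proof.
move=> sf sg.
have s1 := smooth_affine (@affine_fst R R R) sf; have s2 := smooth_affine (@affine_snd R R R) sg.
rewrite (_ : (fun y : pt2 R => _) = (f \o (@fst R R)) * (g \o (@snd R R)))//.
rewrite deriveM; [|apply: diff_derivable; exact: smooth_differentiable..].
by rewrite (derive_affine f y v (@affine_fst R R R)) (derive_affine g y v (@affine_snd R R R)).
Qed.

Let aux1 (A B C D : R) : B = 0 -> A * B + C * D = D * C.
Proof. by move=> ->; rewrite mulr0 add0r mulrC. Qed.

Let aux2 (A B C D : R) : D = 0 -> A * B + C * D = A * B.
Proof. by move=> ->; rewrite mulr0 addr0. Qed.

Lemma derive1_tensor (f g : R -> R) (y : pt2 R) : smooth f -> smooth g ->
  D1 (fun y : pt2 R => f y.1 * g y.2) y = 'D_1 f y.1 * g y.2.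
Proof.
move=> sf sg; apply: etrans (derive_tensor y (e21 R) sf sg) _.
rewrite fst_e21 snd_e21; apply: aux1; exact: derive0.
Qed.

Lemma derive2_tensor (f g : R -> R) (y : pt2 R) : smooth f -> smooth g ->
  D2 (fun y : pt2 R => f y.1 * g y.2) y = f y.1 * 'D_1 g y.2.
Proof.
move=> sf sg; apply: etrans (derive_tensor y (e22 R) sf sg) _.
rewrite fst_e22 snd_e22; apply: aux2; exact: derive0.
Qed.

Lemma derive1_cutoff2 r y : D1 (cutoff2 r) y = 'D_1 (cutoff r) y.1 * cutoff r y.2.
Proof. by apply: derive1_tensor; exact: smooth_cutoff. Qed.

Lemma derive2_cutoff2 r y : D2 (cutoff2 r) y = cutoff r y.1 * 'D_1 (cutoff r) y.2.
Proof. by apply: derive2_tensor; exact: smooth_cutoff. Qed.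

Lemma Rintegral_tensor2 r (f g : R -> R) : 0 <= r -> Cc1 r f -> Cc1 r g ->
  \int[mu2]_y (f y.1 * g y.2) = (\int[mu1]_x f x) * \int[mu1]_x g x.
Proof. by move=> r0 cf cg; exact: (Rintegral_tensor (Cc1_integrable r0 cf) (Cc1_integrable r0 cg)). Qed.

Lemma int_cutoff2_sqr r : 0 <= r -> \int[mu2]_y cutoff2 r y ^+ 2 = kap r ^+ 2.
Proof.
move=> r0; under eq_Rintegral do rewrite exprMn.
have c := Cc1X (Cc1_cutoff r); exact: (Rintegral_tensor2 r0 c c).
Qed.

Lemma int_cutoff2_grad r : 0 <= r ->
  \int[mu2]_y (D1 (cutoff2 r) y ^+ 2 + D2 (cutoff2 r) y ^+ 2) = 2 * kap r * dcut r.
Proof.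
move=> r0; have cc := Cc1_cutoff r; have cd := Cc1X (Cc1_derive cc); have c2 := Cc1X cc.
have csD v : csupp2 r (fun y => 'D_v (cutoff2 r) y ^+ 2).
  by apply: csupp2X; apply: Cc2_csupp; apply: Cc2_derive; exact: Cc2_cutoff2.
rewrite RintegralD//; [|exact: (csupp2_integrable r0 (csD _))..].
rewrite (_ : 2 * kap r * dcut r = dcut r * kap r + kap r * dcut r); last by ring.
congr (_ + _).
  apply: etrans (Rintegral_tensor2 r0 cd c2); apply: eq_Rintegral => y _.
  by rewrite derive1_cutoff2 exprMn.
apply: etrans (Rintegral_tensor2 r0 c2 cd); apply: eq_Rintegral => y _.
by rewrite derive2_cutoff2 exprMn.
Qed.

Let cross1 (A C D : R) : A * C * (D * C) = A * D * C ^+ 2.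
Proof. ring. Qed.

Let cross2 (A C D : R) : A * C * (A * D) = A ^+ 2 * (C * D).
Proof. ring. Qed.

Lemma int_cutoff2_cross1 r : 0 < r -> \int[mu2]_y (cutoff2 r y * D1 (cutoff2 r) y) = 0.
Proof.
move=> r0; have cc := Cc1_cutoff r; have cd := Cc1_derive cc; have c2 := Cc1X cc.
have sc := smooth_cutoff r.
have := Rintegral_tensor2 (ltW r0) (Cc1M sc cd) c2.
rewrite int_cutoff_derive// mul0r; apply: etrans; apply: eq_Rintegral => y _.
by rewrite derive1_cutoff2; exact: cross1.
Qed.

Lemma int_cutoff2_cross2 r : 0 < r -> \int[mu2]_y (cutoff2 r y * D2 (cutoff2 r) y) = 0.
Proof.
move=> r0; have cc := Cc1_cutoff r; have cd := Cc1_derive cc; have c2 := Cc1X cc.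
have sc := smooth_cutoff r.
have := Rintegral_tensor2 (ltW r0) c2 (Cc1M sc cd).
rewrite int_cutoff_derive// mulr0; apply: etrans; apply: eq_Rintegral => y _.
by rewrite derive2_cutoff2; exact: cross2.
Qed.

End cutoff_integrals.

(** * Averaging a cut-off near-minimiser over translations *)

Section averaging.
Variable R : realType.
Local Notation mu2 := (@leb2 R).
Local Notation D1 f x := (derive f x (e21 R)).
Local Notation D2 f x := (derive f x (e22 R)).

Definition mass (P Q : pt2 R -> R) := \int[mu2]_x (P x ^+ 2 + Q x ^+ 2).

Let mass_scalar (k s : R) : 0 <= k -> s <= 2 * (k - s + 2^-1 * s ^+ 2) + 3 * 1.
Proof. by move=> k0; have := sqr_ge0 (s - 3 / 2); nra. Qed.

(** Pointwise s <= 2 (s^2/2 - s) + 3 for s = |u|^2, and the kinetic term only helps. Hence a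
    near-minimiser has mass at most of the order of the area. *)
Lemma E2_mass_le r b e P Q : 0 <= b -> 0 < r -> Cc2 r P -> Cc2 r Q -> E2 b P Q <= e ->
  mass P Q <= 2 * e + 3 * r ^+ 2.
Proof.
move=> b0 r0 cP cQ hE; have r0' := ltW r0.
have cM : csupp2 r (fun x => P x ^+ 2 + Q x ^+ 2).
  by apply: csupp2D; apply: csupp2X; exact: Cc2_csupp.
have iM := csupp2_integrableK r0 cM.
have iE := csupp2_integrableK r0 (dens_csupp b cP cQ).
have i1 : mu2.-integrable (K2 r) (EFin \o cst (1 : R)).
  by apply: integrable_cst_fin; [exact: measurable_K2|exact: leb2_K2_fin].
have mK : @measurable _ (measurableTypeR R * measurableTypeR R)%type (K2 r) by exact: measurable_K2.
have -> : mass P Q = \int[mu2]_(x in K2 r) (P x ^+ 2 + Q x ^+ 2).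
  by apply/esym/Rintegral_supp; case: cM.
have h : \int[mu2]_(x in K2 r) (P x ^+ 2 + Q x ^+ 2) <=
    2 * (\int[mu2]_(x in K2 r) dens b P Q x) + 3 * \int[mu2]_(x in K2 r) (1 : R).
  apply: (le_Rintegral_lin2 mK iM iE i1) => x _.
  by apply: mass_scalar; exact: mulr_ge0 b0 (kin_ge0 _ _ _ _ _ _ _).
apply: le_trans h _; rewrite (E2_K2 b cP cQ).
have -> : \int[mu2]_(x in K2 r) (1 : R) = r ^+ 2.
  by rewrite Rintegral_cst// mul1r; exact: (congr1 fine (leb2_K2 r0')).
by rewrite lerD2r; apply: ler_wpM2l.
Qed.

(** The potential drops out of the cross terms because the cutoff [h] is real; the two sides differ
    by |u|^4 h^2 (1 - h^2)/2, which is nonnegative. *)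
Let cut_scalar (b A1 A2 h d1 d2 p q p1 p2 q1 q2 : R) : 0 <= h -> h <= 1 ->
  b * ((p1 * h + p * d1 + A1 * (q * h)) ^+ 2 + (q1 * h + q * d1 - A1 * (p * h)) ^+ 2
     + (p2 * h + p * d2 + A2 * (q * h)) ^+ 2 + (q2 * h + q * d2 - A2 * (p * h)) ^+ 2)
  - ((p * h) ^+ 2 + (q * h) ^+ 2) + 2^-1 * ((p * h) ^+ 2 + (q * h) ^+ 2) ^+ 2 <=
  (b * ((p1 + A1 * q) ^+ 2 + (q1 - A1 * p) ^+ 2 + (p2 + A2 * q) ^+ 2 + (q2 - A2 * p) ^+ 2)
   - (p ^+ 2 + q ^+ 2) + 2^-1 * (p ^+ 2 + q ^+ 2) ^+ 2) * h ^+ 2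
  + b * (p ^+ 2 + q ^+ 2) * (d1 ^+ 2 + d2 ^+ 2)
  + 2 * b * (p * p1 + q * q1) * (h * d1) + 2 * b * (p * p2 + q * q2) * (h * d2).
Proof.
move=> h0 h1; rewrite -subr_ge0.
rewrite (_ : _ - _ = 2^-1 * (p ^+ 2 + q ^+ 2) ^+ 2 * (h ^+ 2 * (1 - h ^+ 2))); last by field.
apply: mulr_ge0; first by rewrite mulr_ge0 ?sqr_ge0.
by rewrite mulr_ge0 ?sqr_ge0// subr_ge0 expr_le1.
Qed.

Let deriveM' v (f g : pt2 R -> R) x : smooth f -> smooth g ->
  'D_v (fun x => f x * g x) x = 'D_v f x * g x + f x * 'D_v g x.
Proof.
move=> sf sg; rewrite (_ : (fun x => _) = f * g)// deriveM; [|apply: diff_derivable; exact: smooth_differentiable..].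
by rewrite /GRing.scale/= addrC mulrC.
Qed.

(** Each of the four terms is a function of u times a function of the cutoff alone, the shape that
    [Rintegral_conv2] integrates over all translations. *)
Lemma dens_cut_le b P Q (h : pt2 R -> R) x d1 d2 : smooth P -> smooth Q -> smooth h ->
  D1 h x = d1 -> D2 h x = d2 -> 0 <= h x -> h x <= 1 ->
  dens b (fun x => P x * h x) (fun x => Q x * h x) x <=
  dens b P Q x * h x ^+ 2 + b * (P x ^+ 2 + Q x ^+ 2) * (d1 ^+ 2 + d2 ^+ 2)
  + 2 * b * (P x * D1 P x + Q x * D1 Q x) * (h x * d1)
  + 2 * b * (P x * D2 P x + Q x * D2 Q x) * (h x * d2).
Proof.
move=> sP sQ sh <- <- h0 h1; rewrite /dens /edens /kin.
rewrite !(deriveM' _ _ sP sh) !(deriveM' _ _ sQ sh).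
exact: cut_scalar.
Qed.

Definition conv2 (c e : pt2 R -> R) (a : pt2 R) := \int[mu2]_x (c x * e (x + a)).

Lemma conv2_supp (r s : R) c e a : csupp2 r c -> csupp2 s e -> ~ K2 (r + s) a -> conv2 c e a = 0.
Proof.
move=> [_ c0] [_ e0] ha; rewrite /conv2 /Rintegral integral0_eq// => x _; congr EFin.
have [hx|/c0->] := pselect (K2 r x); last by rewrite mul0r.
rewrite e0 ?mulr0// => hxa; apply: ha; move: hx hxa => [+ +] [].
rewrite /= !ltr_norml => /andP[? ?] /andP[? ?] /andP[? ?] /andP[? ?].
by split; rewrite ltr_norml; apply/andP; split; lra.
Qed.

Lemma conv2_pt_integrable (r : R) c e a : 0 <= r -> csupp2 r c -> continuous e ->
  mu2.-integrable setT (EFin \o (fun x => c x * e (x + a))).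
Proof.
move=> r0 cc ce; apply: (csupp2_integrable r0).
rewrite (_ : (fun x => _) = (fun x => e (x + a) * c x)); last by apply/funext => x; rewrite mulrC.
by apply: csupp2M => //; exact: continuous_shift2.
Qed.

Lemma Cc2_Ms (r : R) f h : Cc2 r f -> smooth h -> Cc2 r (fun x => f x * h x).
Proof.
move=> [sf [d d0 f0]] sh; split; first exact: smoothM.
by exists d => // x /f0 ->; rewrite mul0r.
Qed.

(** The cut-off function lives in a square around - a; the magnetic translation by [a] brings it
    into [K2 r] at the same energy. *)
Lemma m0_le_cut (b r s : R) P Q a : 0 <= b -> 0 < r -> 0 <= s -> Cc2 s P -> Cc2 s Q ->
  m0 b r <= E2 b (fun x => P x * cutoff2 r (x + a)) (fun x => Q x * cutoff2 r (x + a)).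
Proof.
move=> b0 r0 s0 cP cQ.
have sh : smooth (fun x : pt2 R => cutoff2 r (x + a)).
  by have := smooth_affine (affine_shift (- a)) (@smooth_cutoff2 R r); under eq_fun do rewrite opprK.
have cPh := Cc2_Ms cP sh; have cQh := Cc2_Ms cQ sh.
rewrite -(E2_transl b a s0 cPh cQh).
have [sP sQ] := smooth_transl a (proj1 cPh) (proj1 cQh).
have [_ [d d0 h0]] := @Cc2_cutoff2 R r.
by apply: m0_le_E2 => //; split=> //; exists d => // x /h0 e;
  rewrite /translP /translQ subrK e !mulr0 ?subr0 ?addr0.
Qed.

Let sum4 (f0 f1 f2 f3 : pt2 R -> R) :
  mu2.-integrable setT (EFin \o f0) -> mu2.-integrable setT (EFin \o f1) ->
  mu2.-integrable setT (EFin \o f2) -> mu2.-integrable setT (EFin \o f3) ->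
  mu2.-integrable setT (EFin \o (fun x => f0 x + f1 x + f2 x + f3 x)) /\
  \int[mu2]_x (f0 x + f1 x + f2 x + f3 x) =
  \int[mu2]_x f0 x + \int[mu2]_x f1 x + \int[mu2]_x f2 x + \int[mu2]_x f3 x.
Proof.
move=> i0 i1 i2 i3.
have i01 := integrableD measurableT i0 i1; have i012 := integrableD measurableT i01 i2.
split; first exact: (integrableD measurableT i012 i3).
by rewrite !RintegralD.
Qed.

Let sum4_0 (a0 a1 a2 a3 : R) : a0 = 0 -> a1 = 0 -> a2 = 0 -> a3 = 0 -> a0 + a1 + a2 + a3 = 0.
Proof. by move=> -> -> -> ->; rewrite !addr0. Qed.

Let sum4_congr (a0 a1 a2 a3 b0 b1 : R) :
  a0 = b0 -> a1 = b1 -> a2 = 0 -> a3 = 0 -> a0 + a1 + a2 + a3 = b0 + b1.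
Proof. by move=> -> -> -> ->; rewrite !addr0. Qed.

Section fixed.
Variables (b r s : R) (P Q : pt2 R -> R).
Hypotheses (b0 : 0 <= b) (r0 : 0 < r) (s0 : 0 < s) (cP : Cc2 s P) (cQ : Cc2 s Q).

Let c0 := dens b P Q.
Let c1 (x : pt2 R) : R := b * (P x ^+ 2 + Q x ^+ 2).
Let c2 (x : pt2 R) : R := 2 * b * (P x * D1 P x + Q x * D1 Q x).
Let c3 (x : pt2 R) : R := 2 * b * (P x * D2 P x + Q x * D2 Q x).
Let h0 (x : pt2 R) : R := cutoff2 r x ^+ 2.
Let h1 (x : pt2 R) : R := D1 (cutoff2 r) x ^+ 2 + D2 (cutoff2 r) x ^+ 2.
Let h2 (x : pt2 R) : R := cutoff2 r x * D1 (cutoff2 r) x.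
Let h3 (x : pt2 R) : R := cutoff2 r x * D2 (cutoff2 r) x.

Let csP := Cc2_csupp cP. Let csQ := Cc2_csupp cQ.
Let csD f (t : R) v : Cc2 t f -> csupp2 t (fun x => 'D_v f x).
Proof. by move=> cf; apply: Cc2_csupp; exact: Cc2_derive. Qed.
Let ccst (c : R) : continuous (fun _ : pt2 R => c).
Proof. by move=> x; exact: cvg_cst. Qed.

Let cc0 : csupp2 s c0. Proof. exact: dens_csupp. Qed.
Let cc1 : csupp2 s c1.
Proof. by apply: csupp2M => //; apply: csupp2D; exact: csupp2X. Qed.
Let cM f g (t : R) : csupp2 t f -> csupp2 t g -> csupp2 t (fun x => f x * g x).
Proof. by move=> [cf _]; exact: csupp2M. Qed.
Let cc2 : csupp2 s c2.
Proof. by apply: csupp2M => //; apply: csupp2D; apply: cM => //; exact: csD. Qed.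
Let cc3 : csupp2 s c3.
Proof. by apply: csupp2M => //; apply: csupp2D; apply: cM => //; exact: csD. Qed.
Let ck := @Cc2_cutoff2 R r.
Let cs0 : csupp2 r h0. Proof. by apply: csupp2X; exact: Cc2_csupp. Qed.
Let cs1 : csupp2 r h1. Proof. by apply: csupp2D; apply: csupp2X; exact: csD. Qed.
Let cs2 : csupp2 r h2. Proof. by apply: cM; [exact: Cc2_csupp|exact: csD]. Qed.
Let cs3 : csupp2 r h3. Proof. by apply: cM; [exact: Cc2_csupp|exact: csD]. Qed.

Let V a := conv2 c0 h0 a + conv2 c1 h1 a + conv2 c2 h2 a + conv2 c3 h3 a.

Let m0_le_V a : m0 b r <= V a.
Proof.
apply: le_trans (m0_le_cut a b0 r0 (ltW s0) cP cQ) _.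
have sh : smooth (fun x : pt2 R => cutoff2 r (x + a)).
  by have := smooth_affine (affine_shift (- a)) (@smooth_cutoff2 R r); under eq_fun do rewrite opprK.
have cPh := Cc2_Ms cP sh; have cQh := Cc2_Ms cQ sh.
have i0 := conv2_pt_integrable a (ltW s0) cc0 (proj1 cs0).
have i1 := conv2_pt_integrable a (ltW s0) cc1 (proj1 cs1).
have i2 := conv2_pt_integrable a (ltW s0) cc2 (proj1 cs2).
have i3 := conv2_pt_integrable a (ltW s0) cc3 (proj1 cs3).
have [i e] := sum4 i0 i1 i2 i3.
rewrite -[leRHS]e; apply: (le_Rintegral measurableT (dens_integrable b (ltW s0) cPh cQh) i).
move=> x _; have dh v : 'D_v (fun x : pt2 R => cutoff2 r (x + a)) x = 'D_v (cutoff2 r) (x + a).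
    have := derive_affine (cutoff2 r) x v (affine_shift (- a)); rewrite /= opprK; apply: etrans.
    by congr ('D_v _ _); apply/funext => y; rewrite /= opprK.
  exact: (dens_cut_le b (proj1 cP) (proj1 cQ) sh (dh (e21 R)) (dh (e22 R)) (cutoff2_ge0 _ _) (cutoff2_le1 _ _)).
Qed.

(** The bound [m0 b r <= V a] holds for every [a], and [V] vanishes off the square of side s + r,
    over which it is integrated. The two cross terms contribute 0. *)
Lemma m0_average_le : (s + r) ^+ 2 * m0 b r <=
  E2 b P Q * kap r ^+ 2 + b * mass P Q * (2 * kap r * dcut r).
Proof.
have [j0 e0] := Rintegral_conv2 (ltW s0) (ltW r0) cc0 cs0.
have [j1 e1] := Rintegral_conv2 (ltW s0) (ltW r0) cc1 cs1.
have [j2 e2] := Rintegral_conv2 (ltW s0) (ltW r0) cc2 cs2.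
have [j3 e3] := Rintegral_conv2 (ltW s0) (ltW r0) cc3 cs3.
have [jV eV'] := sum4 j0 j1 j2 j3.
have sr : 0 < s + r by exact: addr_gt0.
have mK : @measurable _ (measurableTypeR R * measurableTypeR R)%type (K2 (s + r)) by exact: measurable_K2.
have eV : \int[mu2]_a V a = E2 b P Q * kap r ^+ 2 + b * mass P Q * (2 * kap r * dcut r).
  apply: (etrans eV'); apply: sum4_congr.
  - apply: (etrans e0); congr (_ * _); exact: int_cutoff2_sqr (ltW r0).
  - apply: (etrans e1); congr (_ * _); last exact: int_cutoff2_grad (ltW r0).
    rewrite /c1 RintegralZl//; apply: (csupp2_integrable (ltW s0)).
    by apply: csupp2D; exact: csupp2X.
  - apply: (etrans e2); have -> : \int[mu2]_x h2 x = 0 by exact: int_cutoff2_cross1.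
    exact: mulr0.
  - apply: (etrans e3); have -> : \int[mu2]_x h3 x = 0 by exact: int_cutoff2_cross2.
    exact: mulr0.
rewrite -eV (_ : \int[mu2]_a V a = \int[mu2]_(a in K2 (s + r)) V a); last first.
  apply/esym/Rintegral_supp => a ha.
  exact: (sum4_0 (conv2_supp cc0 cs0 ha) (conv2_supp cc1 cs1 ha) (conv2_supp cc2 cs2 ha) (conv2_supp cc3 cs3 ha)).
have <- : \int[mu2]_(a in K2 (s + r)) m0 b r = (s + r) ^+ 2 * m0 b r.
  by rewrite Rintegral_cst// mulrC; congr (_ * _); exact: (congr1 fine (leb2_K2 (ltW sr))).
apply: le_Rintegral => //.
- by apply: integrable_cst_fin => //; exact: leb2_K2_fin.
- by apply: (@integrableS _ _ _ _ setT).
Qed.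

End fixed.

End averaging.

(** * Upper bound for the planar minimum by g(b) *)

Section m0_upper.
Variable R : realType.

(** Divide [m0_average_le] by s^2 and let s tend to infinity. The mass is at most 2 + 3 s^2, so the
    gradient term keeps the factor 2 times 3. *)
Lemma m0_le_limit (b r D : R) : 0 <= b <= 1 -> 0 < r -> dcut r <= D ->
  cvg (m0 b s / s ^+ 2 @[s --> +oo]) ->
  m0 b r <= kap r ^+ 2 * gGL b + 6 * b * kap r * D.
Proof.
move=> b01 r0 hD cv; have /andP[b0 b1] := b01.
have k0 : 0 <= kap r by apply: Rintegral_ge0 => // x _; exact: sqr_ge0.
have key s : 0 < s -> m0 b r * (1 + r * s^-1) ^+ 2 <=
    kap r ^+ 2 * (m0 b s / s ^+ 2 + s^-1 * s^-1) + 2 * b * kap r * D * (3 + 2 * (s^-1 * s^-1)).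
  move=> s0; have [P [Q [cP cQ hE]]] := m0_approx b01 s0 (ltr01 : 0 < 1).
  have h1 := m0_average_le b0 r0 s0 cP cQ.
  have m00 := m0_le0 b0 s0.
  have hE1 : E2 b P Q <= 1 by apply: le_trans (ltW hE) _; rewrite gerDr.
  have h2 := E2_mass_le b0 s0 cP cQ hE1.
  have M0 : 0 <= mass P Q by apply: Rintegral_ge0 => // x _; apply: addr_ge0; exact: sqr_ge0.
  have D0 : 0 <= dcut r by apply: Rintegral_ge0 => // x _; exact: sqr_ge0.
  have s20 : 0 < s ^+ 2 by apply: exprn_gt0.
  rewrite -(ler_pM2r s20).
  apply: (@le_trans _ _ ((s + r) ^+ 2 * m0 b r)).
    rewrite le_eqVlt; apply/orP; left; apply/eqP; field; exact: lt0r_neq0.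
  apply: le_trans h1 _.
  apply: (@le_trans _ _ ((m0 b s + 1) * kap r ^+ 2 + b * (2 * 1 + 3 * s ^+ 2) * (2 * kap r * D))).
    apply: lerD; first by apply: ler_wpM2r; [exact: sqr_ge0|exact: ltW].
    apply: ler_pM; [exact: mulr_ge0|by rewrite !mulr_ge0|exact: ler_wpM2l|].
    by apply: ler_wpM2l => //; exact: mulr_ge0.
  rewrite le_eqVlt; apply/orP; left; apply/eqP; field; exact: lt0r_neq0.
have ci : (s : R)^-1 @[s --> +oo] --> (0 : R).
  by apply/(@gtr0_cvgV0 _ _ _ _ id); [exact: nbhs_pinfty_gt|exact: cvg_id].
have c1 : m0 b r * (1 + r * s^-1) ^+ 2 @[s --> +oo] --> m0 b r * (1 + r * 0) ^+ 2.
  apply: cvgM; first exact: cvg_cst.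
  under eq_fun do rewrite expr2. rewrite expr2.
  by apply: cvgM; apply: cvgD; try exact: cvg_cst; apply: cvgM => //; exact: cvg_cst.
have c2 : kap r ^+ 2 * (m0 b s / s ^+ 2 + s^-1 * s^-1) + 2 * b * kap r * D * (3 + 2 * (s^-1 * s^-1))
    @[s --> +oo] --> kap r ^+ 2 * (gGL b + 0 * 0) + 2 * b * kap r * D * (3 + 2 * (0 * 0)).
  apply: cvgD; apply: cvgM; try exact: cvg_cst; apply: cvgD; try exact: cvg_cst.
  - exact: cv.
  - exact: cvgM.
  - by apply: cvgM; [exact: cvg_cst|exact: cvgM].
have := ler_cvg_to c1 c2.
rewrite !mulr0 !addr0 expr1n mulr1.
have -> : kap r ^+ 2 * gGL b + 2 * b * kap r * D * 3 = kap r ^+ 2 * gGL b + 6 * b * kap r * D by ring.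
apply; near=> s; apply: key; near: s; exact: nbhs_pinfty_gt.
Unshelve. all: by end_near. Qed.

Lemma m0_upper (b : R) : 0 <= b <= 1 ->
  cvg (m0 b s / s ^+ 2 @[s --> +oo]) -> gGL b <= 0 /\
  exists2 C : R, 0 <= C & forall r, 4 <= r -> m0 b r <= gGL b * r ^+ 2 + C * r.
Proof.
move=> b01 cv; have /andP[b0 b1] := b01.
have g0 : gGL b <= 0.
  apply: le_lim_m0 => // A; exists (`|A| + 1); first by apply: le_lt_trans (ler_norm A) _; rewrite ltrDl.
  have h : 0 < `|A| + 1 by apply: ltr_wpDl.
  by rewrite mulr_le0_ge0 ?invr_ge0 ?sqr_ge0 ?m0_le0.
split=> //; have [D D0 hD] := dcut_le R.
(* From r - 4 <= kap r <= r, the squared norm (kap r)^2 is at least r^2 - 8 r, which costs 8 r times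
   - g(b); the rest is the gradient term. *)
exists (8 * - gGL b + 6 * b * D) => [|r r4]; first by rewrite addr_ge0 ?mulr_ge0// oppr_ge0.
have r0 : 0 < r by apply: lt_le_trans r4; rewrite ltr0n.
apply: le_trans (m0_le_limit b01 r0 (hD _ r0) cv) _.
have k1 := kap_le (ltW r0); have k2 := kap_ge r4.
move: (kap r) (gGL b) g0 k1 k2 => k g g0 k1 k2.
have h1 : g * (k ^+ 2 - (r ^+ 2 - 8 * r)) <= 0.
  by rewrite mulr_le0_ge0//; nra.
have h2 : 6 * b * D * (r - k) >= 0 by rewrite !mulr_ge0// subr_ge0.
have -> : g * r ^+ 2 + (8 * - g + 6 * b * D) * r = 
  k ^+ 2 * g + 6 * b * k * D - g * (k ^+ 2 - (r ^+ 2 - 8 * r)) + 6 * b * D * (r - k) by ring.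
by rewrite -addrA lerDl addr_ge0// oppr_ge0.
Qed.

End m0_upper.

(** * Negativity of g(b) *)

Section negative_energy.
Variable R : realType.
Local Notation mu1 := (@lebesgue_measure R).
Local Notation mu2 := (@leb2 R).
Local Notation D1 f x := (derive f x (e21 R)).
Local Notation D2 f x := (derive f x (e22 R)).

Let lin4 (c0 c1 c2 c3 : R) (f0 f1 f2 f3 : pt2 R -> R) :
  mu2.-integrable setT (EFin \o f0) -> mu2.-integrable setT (EFin \o f1) ->
  mu2.-integrable setT (EFin \o f2) -> mu2.-integrable setT (EFin \o f3) ->
  \int[mu2]_x (c0 * f0 x + c1 * f1 x + c2 * f2 x + c3 * f3 x) =
  c0 * \int[mu2]_x f0 x + c1 * \int[mu2]_x f1 x + c2 * \int[mu2]_x f2 x + c3 * \int[mu2]_x f3 x.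
Proof.
move=> i0 i1 i2 i3.
have j (c : R) f : mu2.-integrable setT (EFin \o f) -> mu2.-integrable setT (EFin \o (fun x => c * f x)).
  by move=> i; exact: (integrableZl measurableT c i).
have k0 := j c0 _ i0; have k1 := j c1 _ i1; have k2 := j c2 _ i2; have k3 := j c3 _ i3.
have i01 := integrableD measurableT k0 k1; have i012 := integrableD measurableT i01 k2.
by rewrite !RintegralD// !RintegralZl.
Qed.

(** Energy density of the harmonic oscillator - h'' + (s^2/4) h. For a real product function the
    mixed terms vanish, and the planar kinetic energy splits into one oscillator in each
    variable. *)
Definition osc (h : R -> R) (s : R) := 'D_1 h s ^+ 2 + (s / 2 * h s) ^+ 2.

Let dens_tensor_scalar (b x1 x2 f1 f2 g1 g2 : R) :
  b * ((g1 * f2 + - x2 / 2 * 0) ^+ 2 + (0 - - x2 / 2 * (f1 * f2)) ^+ 2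
     + (f1 * g2 + x1 / 2 * 0) ^+ 2 + (0 - x1 / 2 * (f1 * f2)) ^+ 2)
  - ((f1 * f2) ^+ 2 + 0 ^+ 2) + 2^-1 * ((f1 * f2) ^+ 2 + 0 ^+ 2) ^+ 2 =
  b * ((g1 ^+ 2 + (x1 / 2 * f1) ^+ 2) * f2 ^+ 2) + b * (f1 ^+ 2 * (g2 ^+ 2 + (x2 / 2 * f2) ^+ 2))
  + (-1) * (f1 ^+ 2 * f2 ^+ 2) + 2^-1 * ((f1 ^+ 2) ^+ 2 * (f2 ^+ 2) ^+ 2).
Proof. by field. Qed.

Lemma dens_tensor b (h : R -> R) (x : pt2 R) : smooth h ->
  dens b (fun x : pt2 R => h x.1 * h x.2) (fun=> 0) x =
  b * (osc h x.1 * h x.2 ^+ 2) + b * (h x.1 ^+ 2 * osc h x.2)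
  + (-1) * (h x.1 ^+ 2 * h x.2 ^+ 2) + 2^-1 * ((h x.1 ^+ 2) ^+ 2 * (h x.2 ^+ 2) ^+ 2).
Proof.
move=> sh; rewrite /dens /edens /kin.
rewrite (derive1_tensor x sh sh) (derive2_tensor x sh sh).
rewrite (derive_cst (0 : R) x (e21 R)) (derive_cst (0 : R) x (e22 R)).
exact: dens_tensor_scalar.
Qed.

Lemma Cc1_osc (r : R) h : Cc1 r h -> Cc1 r (osc h).
Proof.
move=> ch; apply: Cc1D; first by apply: Cc1X; exact: Cc1_derive.
apply: Cc1X; apply: Cc1M => //.
by apply: smoothM; [exact: smooth_id|exact: smooth_cst].
Qed.

Lemma E2_tensor (b r : R) h : 0 <= r -> Cc1 r h ->
  E2 b (fun x : pt2 R => h x.1 * h x.2) (fun=> 0) =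
  2 * b * (\int[mu1]_s osc h s) * (\int[mu1]_s h s ^+ 2) - (\int[mu1]_s h s ^+ 2) ^+ 2
  + 2^-1 * (\int[mu1]_s (h s ^+ 2) ^+ 2) ^+ 2.
Proof.
move=> r0 ch; have cm := Cc1X ch; have co := Cc1_osc ch; have cq := Cc1X cm.
have it f g : Cc1 r f -> Cc1 r g -> mu2.-integrable setT (EFin \o (fun x : pt2 R => f x.1 * g x.2)).
  by move=> cf cg; exact: (integrable_tensor (Cc1_integrable r0 cf) (Cc1_integrable r0 cg)).
rewrite /E2; under eq_Rintegral do rewrite (dens_tensor _ _ (proj1 ch)).
apply: (etrans (lin4 b b (-1) 2^-1 (it _ _ co cm) (it _ _ cm co) (it _ _ cm cm) (it _ _ cq cq))).
rewrite (Rintegral_tensor2 r0 co cm) (Rintegral_tensor2 r0 cm co) (Rintegral_tensor2 r0 cm cm).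
rewrite (Rintegral_tensor2 r0 cq cq).
set A := Rintegral _ _ _; set B := Rintegral _ _ _; set C := Rintegral _ _ _.
by move: A B C => A B C; ring.
Qed.

Let oscZ (t : R) h s : smooth h -> osc (fun s => t * h s) s = t ^+ 2 * osc h s.
Proof.
move=> sh; rewrite /osc (_ : 'D_1 (fun s => t * h s) s = t * 'D_1 h s); first by ring.
by apply: deriveZ; have [] := smooth1_is_derive s sh.
Qed.

(** Scaling both factors by [t] multiplies the quadratic part of the energy by t^4 and the quartic
    part by t^8, so a negative quadratic part wins for small [t]. *)
Lemma E2_tensor_neg (b r : R) h : 0 <= r -> Cc1 r h ->
  2 * b * (\int[mu1]_s osc h s) < \int[mu1]_s h s ^+ 2 -> 0 < \int[mu1]_s h s ^+ 2 ->
  exists P Q, [/\ Cc2 r P, Cc2 r Q & E2 b P Q < 0].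
Proof.
move=> r0 ch hK hN.
have cm := Cc1X ch; have co := Cc1_osc ch; have cq := Cc1X cm.
pose d := (\int[mu1]_s h s ^+ 2 - 2 * b * (\int[mu1]_s osc h s)) * (\int[mu1]_s h s ^+ 2).
have d0 : 0 < d by apply: mulr_gt0 => //; rewrite subr_gt0.
have w0 : 0 <= 2^-1 * (\int[mu1]_s (h s ^+ 2) ^+ 2) ^+ 2 by rewrite mulr_ge0 ?invr_ge0 ?sqr_ge0.
have [t /andP[t0 t1] ht] := small_factor_lt w0 d0.
have ct : Cc1 r (fun s => t * h s) by apply: Cc1M => //; exact: smooth_cst.
exists (fun x : pt2 R => (t * h x.1) * (t * h x.2)), (fun=> 0); split; [exact: (Cc2_tensor ct)|exact: Cc2_0|].
rewrite (E2_tensor b r0 ct).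
have -> : \int[mu1]_s osc (fun s => t * h s) s = t ^+ 2 * \int[mu1]_s osc h s.
  rewrite -RintegralZl//; last exact: Cc1_integrable r0 co.
  by apply: eq_Rintegral => s _; rewrite oscZ//; case: ch.
have -> : \int[mu1]_s (t * h s) ^+ 2 = t ^+ 2 * \int[mu1]_s h s ^+ 2.
  rewrite -RintegralZl//; last exact: Cc1_integrable r0 cm.
  by apply: eq_Rintegral => s _; rewrite exprMn.
have -> : \int[mu1]_s ((t * h s) ^+ 2) ^+ 2 = t ^+ 4 * \int[mu1]_s (h s ^+ 2) ^+ 2.
  rewrite -RintegralZl//; last exact: Cc1_integrable r0 cq.
  by apply: eq_Rintegral => s _; move: (h s) => y; ring.
move: ht; rewrite /d; move: w0.
clear -t0 t1; move: (\int[mu1]_s (h s ^+ 2) ^+ 2) (\int[mu1]_s h s ^+ 2) (\int[mu1]_s osc h s) => A B C w0 ht.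
have -> : 2 * b * (t ^+ 2 * C) * (t ^+ 2 * B) - (t ^+ 2 * B) ^+ 2 + 2^-1 * (t ^+ 4 * A) ^+ 2 =
  t ^+ 4 * (t ^+ 4 * (2^-1 * A ^+ 2) - (B - 2 * b * C) * B) by ring.
rewrite pmulr_rlt0 ?exprn_gt0// subr_lt0; apply: le_lt_trans ht; apply: ler_wpM2r => //.
by rewrite -[leRHS]expr1; apply: ler_wiXn2l => //; exact: ltW.
Qed.

Definition gauss (s : R) := expR (- (s ^+ 2 / 4)).

Lemma gauss_gt0 s : 0 < gauss s. Proof. exact: expR_gt0. Qed.

Lemma smooth_expR : smooth (expR : R -> R).
Proof.
apply: (@smooth1_coind _ (fun f => exists a, f = fun x : R => a * expR x)).
- by move=> f x [a ->].
- move=> f [a ->]; exists a; apply/funext => x.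
  have h : is_derive x (1 : R) (a \*: (expR : R -> R)) (a *: expR x) by exact: is_deriveZ.
  by have [_ ->] := h.
- by move=> c f [a ->]; exists (c * a); apply/funext => x; rewrite mulrA.
- by exists 1; apply/funext => x; rewrite mul1r.
Qed.

Lemma smooth_gauss : smooth gauss.
Proof.
apply: smooth_comp; first exact: smooth_expR.
apply: smoothN; apply: smoothM; last exact: smooth_cst.
have e : (fun s : R => s ^+ 2) = (fun s => s * s) by apply/funext => s; rewrite expr2.
by rewrite e; apply: smoothM; exact: smooth_id.
Qed.

Lemma is_derive_gauss (s : R) : is_derive s (1 : R) gauss (- (s / 2) * gauss s).
Proof.
have h1 : is_derive s (1 : R) (fun s : R => - (s ^+ 2 / 4)) (- (s / 2)).
  by apply: is_derive_eq; rewrite /GRing.scale/=; field.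
have := @is_derive1_comp _ (expR : R -> R) (fun s : R => - (s ^+ 2 / 4)) _ _ _ (is_derive_expR _) h1.
by move=> h2; apply: is_derive_eq; rewrite /GRing.scale/= mulrC.
Qed.

Definition trial (r s : R) := cutoff r s * gauss s.

Lemma Cc1_trial (r : R) : Cc1 r (trial r).
Proof.
have c := Cc1_cutoff r; rewrite (_ : trial r = fun s => gauss s * cutoff r s); last first.
  by apply/funext => s; rewrite mulrC.
exact: (Cc1M smooth_gauss c).
Qed.

(* the Gaussian is the ground state of the harmonic oscillator, with energy half its mass; the
   error is carried by the derivative of the cutoff *)
Lemma osc_trial (r s : R) : osc (trial r) s =
  ('D_1 (cutoff r) s * gauss s) ^+ 2 + 2^-1 * trial r s ^+ 2
  - 2^-1 * 'D_1 (fun s : R => s * trial r s ^+ 2) s.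
Proof.
have dc := smooth1_is_derive s (@smooth_cutoff R r); have dg := is_derive_gauss s.
have [_ e1] := is_deriveM dc dg.
have dt : is_derive s (1 : R) (trial r) ('D_1 (cutoff r) s * gauss s - s / 2 * (cutoff r s * gauss s)).
  have h := is_deriveM dc dg; apply: is_derive_eq; rewrite /GRing.scale/=; ring.
have [_ e2] := is_deriveM (is_derive_id s (1 : R)) (is_deriveM dt dt).
have -> : (fun s : R => s * trial r s ^+ 2) = id * (trial r * trial r).
  by apply/funext => z; rewrite expr2.
rewrite e2 /osc; have [_ ->] := dt.
have -> : (trial r * trial r) s = trial r s * trial r s by [].
rewrite /trial /GRing.scale/=.
move: ('D_1 (cutoff r) s) (cutoff r s) (gauss s) => A B C; by field.
Qed.

Lemma int_osc_trial (r : R) : 0 < r -> \int[mu1]_s osc (trial r) s =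
  \int[mu1]_s ('D_1 (cutoff r) s * gauss s) ^+ 2 + 2^-1 * \int[mu1]_s trial r s ^+ 2.
Proof.
move=> r0; have ct := Cc1_trial r; have cm := Cc1X ct.
have cd : Cc1 r (fun s : R => s * trial r s ^+ 2) by apply: Cc1M => //; exact: smooth_id.
have cg : Cc1 r (fun s : R => ('D_1 (cutoff r) s * gauss s) ^+ 2).
  apply: Cc1X; have c := Cc1_derive (Cc1_cutoff r).
  rewrite (_ : (fun s => _) = (fun s => gauss s * 'D_1 (cutoff r) s)); last by apply/funext => s; rewrite mulrC.
  exact: (Cc1M smooth_gauss c).
have z := Cc1_int_derive r0 cd.
have ig := Cc1_integrable (ltW r0) cg; have im := Cc1_integrable (ltW r0) cm.
have id := Cc1_integrable (ltW r0) (Cc1_derive cd).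
have im2 := integrableZl measurableT 2^-1 im; have id2 := integrableZl measurableT 2^-1 id.
under eq_Rintegral do rewrite osc_trial.
have igm := integrableD measurableT ig im2.
rewrite RintegralB// RintegralD// !RintegralZl//.
by rewrite [X in _ - _ * X]z mulr0 subr0.
Qed.

(** On (-1/2, 1/2) the cutoff is 1 as soon as r >= 5, and the Gaussian is at least its value at 1/2.
    The bound is uniform in [r]. *)
Lemma int_trial_ge (r : R) : 5 <= r -> gauss (2^-1) ^+ 2 <= \int[mu1]_s trial r s ^+ 2.
Proof.
move=> r5; have r0 : 0 <= r by apply: le_trans r5; rewrite ler0n.
have im := Cc1_integrable r0 (Cc1X (Cc1_trial r)).
have h01 : (0 : R) <= 1 by [].
have {1}-> : gauss (2^-1) ^+ 2 = \int[mu1]_(x in itv1 1) (gauss (2^-1) ^+ 2).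
  by rewrite Rintegral_itv1_cst// mulr1.
apply: (@le_trans _ _ (\int[mu1]_(x in itv1 1) trial r x ^+ 2)).
  apply: le_Rintegral; first exact: measurable_itv1.
  - exact: integrable_itv1_cst.
  - by apply: (@integrableS _ _ _ _ setT); [by []|exact: measurable_itv1|by []|].
  - move=> x /itv1P xr; rewrite /trial cutoff_eq1 ?mul1r; last first.
      by apply: (le_trans (ltW xr)); lra.
    rewrite ler_sqr ?nnegrE; [|exact: ltW (gauss_gt0 _)..].
    rewrite /gauss ler_expR lerN2 ler_pM2r ?invr_gt0 ?ltr0n//.
    rewrite -(real_normK (num_real x)) ler_sqr ?nnegrE ?invr_ge0 ?ler0n//.
    by rewrite -[leRHS]mul1r; exact: ltW.
by apply: (Rintegral_subset_le _ _ im); [exact: measurable_itv1|move=> x; exact: sqr_ge0].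
Qed.

Lemma gauss_decay (s : R) : gauss s ^+ 2 * s ^+ 2 <= 2.
Proof.
have h : gauss s ^+ 2 = expR (- (s ^+ 2 / 2)).
  by rewrite /gauss expr2 -expRD; congr expR; field.
rewrite h expRN mulrC ler_pdivrMr ?expR_gt0//.
apply: (@le_trans _ _ (2 * (1 + s ^+ 2 / 2))); last by rewrite ler_pM2l// expR_ge1Dx.
have -> : 2 * (1 + s ^+ 2 / 2) = 2 + s ^+ 2 by field.
by rewrite lerDr.
Qed.

(** Where the cutoff varies, |s| >= r/2 - 2, so [gauss_decay] bounds the squared Gaussian times (r/2
    - 2)^2 by 2. *)
Lemma int_trial_error_le : exists2 C : R, 0 <= C & forall r : R, 5 <= r ->
  (\int[mu1]_s ('D_1 (cutoff r) s * gauss s) ^+ 2) * (r / 2 - 2) ^+ 2 <= C.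
Proof.
have [D D0 hD] := dcut_le R.
exists (2 * D) => [|r r5]; first by rewrite mulr_ge0.
have r0 : 0 < r by apply: lt_le_trans r5; rewrite ltr0n.
have cc := Cc1_derive (Cc1_cutoff r).
have cg : Cc1 r (fun s : R => ('D_1 (cutoff r) s * gauss s) ^+ 2).
  apply: Cc1X; rewrite (_ : (fun s => _) = (fun s => gauss s * 'D_1 (cutoff r) s)); last by apply/funext => s; rewrite mulrC.
  exact: (Cc1M smooth_gauss cc).
have [K _ hK] := derive_cutoff_le R.
rewrite mulrC -RintegralZl//; last exact: Cc1_integrable (ltW r0) cg.
apply: (@le_trans _ _ (2 * dcut r)); last by apply: ler_wpM2l => //; exact: hD.
have id := Cc1_integrable (ltW r0) (Cc1X cc).
rewrite /dcut -RintegralZl//.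
apply: le_Rintegral => //.
- exact: (integrableZl measurableT ((r / 2 - 2) ^+ 2) (Cc1_integrable (ltW r0) cg)).
- exact: (integrableZl measurableT 2 id).
move=> x _; have [_ hx] := hK r x.
have [xr|/hx ->] := pselect (r / 2 - 2 <= `|x| <= r / 2 - 1); last by rewrite mul0r expr0n !mulr0.
rewrite exprMn mulrCA mulrC; apply: ler_wpM2r; first exact: sqr_ge0.
apply: le_trans (gauss_decay x); rewrite mulrC; apply: ler_wpM2l; first exact: sqr_ge0.
rewrite -(real_normK (num_real x)) ler_sqr ?nnegrE//; first by case/andP: xr.
by lra.
Qed.

(** [e] is the truncation error and [N] the mass. With d = (1 - b) c, the factor w = 2C/d + 1 forces
    2 e < d <= (1 - b) N, which is the gap left by the Gaussian. *)
Let final_scalar (b c C e N : R) : 0 < c -> 0 <= C -> 0 <= b -> b < 1 -> 0 <= e ->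
  e * (2 * C / ((1 - b) * c) + 1) ^+ 2 <= C -> c <= N -> 2 * b * (e + 2^-1 * N) < N.
Proof.
move=> c0 C0 b0 b1 e0; set d := (1 - b) * c; set w := _ + 1 => hE hN.
have d0 : 0 < d by rewrite mulr_gt0// subr_gt0.
have w1 : 1 <= w.
  by rewrite lerDr; apply: divr_ge0; [exact: mulr_ge0|exact: ltW].
have h1 : e * w <= C.
  by apply: le_trans hE; apply: ler_wpM2l => //; rewrite expr2 ler_peMl// (le_trans ler01).
have h2 : 2 * C * e + e * d <= C * d.
  have -> : 2 * C * e + e * d = (e * w) * d by rewrite /w; field; exact: lt0r_neq0.
  by apply: ler_wpM2r => //; exact: ltW.
have h3 : 2 * e < d.
  have [e1|e1] := ltP 0 e; last by apply: le_lt_trans d0; rewrite mulr_ge0_le0.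
  rewrite ltNge; apply/negP => de.
  have h := mulr_gt0 e1 d0.
  have : C * (d - 2 * e) <= 0 by rewrite mulr_ge0_le0// subr_le0.
  by clear -h h2; lra.
have h4 : d <= (1 - b) * N by apply: ler_wpM2l => //; rewrite subr_ge0 ltW.
nra.
Qed.

Lemma gGL_lt0 (b : R) : 0 <= b < 1 -> cvg (m0 b r / r ^+ 2 @[r --> +oo]) -> gGL b < 0.
Proof.
move=> /andP[b0 b1] cv; have [C C0 hC] := int_trial_error_le.
pose c := gauss (2^-1 : R) ^+ 2.
have c0 : 0 < c by rewrite exprn_gt0// gauss_gt0.
have d0 : 0 < (1 - b) * c by rewrite mulr_gt0// subr_gt0.
pose w := 2 * C / ((1 - b) * c) + 1.
have w1 : 1 <= w.
  by rewrite lerDr; apply: divr_ge0; [exact: mulr_ge0|exact: ltW].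
(* The transition layers of the cutoff then start at distance exactly [w]. *)
pose r := 2 * (w + 2); have r5 : 5 <= r by rewrite /r; lra.
have r0 : 0 < r by apply: lt_le_trans r5; rewrite ltr0n.
have rw : r / 2 - 2 = w by rewrite /r; field.
have hN := int_trial_ge r5; have := hC _ r5; rewrite rw -/c in hN * => hE.
have hN0 := lt_le_trans c0 hN.
have [P [Q [cP cQ hlt]]] : exists P Q, [/\ Cc2 r P, Cc2 r Q & E2 b P Q < 0].
  apply: (E2_tensor_neg (ltW r0) (Cc1_trial r)) => //.
  rewrite int_osc_trial//; move: hE hN.
  have e0 : 0 <= \int[mu1]_s ('D_1 (cutoff r) s * gauss s) ^+ 2.
    by apply: Rintegral_ge0 => // x _; exact: sqr_ge0.
  move: e0; move: (\int[mu1]_s ('D_1 (cutoff r) s * gauss s) ^+ 2) (\int[mu1]_s trial r s ^+ 2) => e N e0 hE hN.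
  exact: final_scalar c0 C0 b0 b1 e0 hE hN.
have := gGL_le_E2 b0 r0 cv cP cQ.
by rewrite -(pmulr_llt0 _ (exprn_gt0 2 r0)) => h; apply: le_lt_trans h _.
Qed.

End negative_energy.

(** * The three-dimensional problem *)

Section product_slices.
Context d1 d2 (T1 : measurableType d1) (T2 : measurableType d2) (R : realType).
Variables (m1 : {sigma_finite_measure set T1 -> \bar R}) (m2 : {sigma_finite_measure set T2 -> \bar R}).
Variables (A : set T1) (B : set T2).
Hypotheses (mA : measurable A) (mB : measurable B).

Let mAB : measurable (A `*` B). Proof. exact: measurableX. Qed.

Lemma slice_measurable d (T : measurableType d) (f : T1 * T2 -> T) y : B y ->
  measurable_fun (A `*` B) f -> measurable_fun A (fun x => f (x, y)).
Proof.
move=> By mf _ Y mY.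
have mp : measurable_fun setT (fun x : T1 => (x, y)).
  by apply/measurable_fun_pairP; split; [exact: measurable_id|exact: measurable_cst].
rewrite (_ : A `&` _ = (fun x => (x, y)) @^-1` (A `*` B `&` f @^-1` Y)); last first.
  by apply/seteqP; split => x /=; [case|case=> -[]].
by rewrite -[_ @^-1` _]setTI; apply: mp => //; exact: mf.
Qed.

Lemma tonelli_rect (f : T1 * T2 -> \bar R) : measurable_fun (A `*` B) f ->
  (forall z, (0 <= f z)%E) ->
  measurable_fun B (fun y => \int[m1]_(x in A) f (x, y))%E /\
  (\int[(m1 \x m2)%E]_(z in A `*` B) f z = \int[m2]_(y in B) \int[m1]_(x in A) f (x, y))%E.
Proof.
move=> mf f0; pose g := f \_ (A `*` B).
have mg : measurable_fun setT g by apply: (iffLR (measurable_restrictT f mAB)).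
have g0 z : (0 <= g z)%E by rewrite /g patchE; case: ifP.
have GE y : (\int[m1]_x g (x, y) = ((fun y => \int[m1]_(x in A) f (x, y)) \_ B) y)%E.
  rewrite /g patchE; case: ifPn => yB.
    rewrite [RHS]integral_mkcond; apply: eq_integral => x _.
    rewrite !patchE; congr (if _ then _ else _).
    by apply/idP/idP; rewrite !inE /=; [case|move: yB; rewrite inE].
  apply: integral0_eq => x _; rewrite patchE ifF//; apply/negbTE; apply: contra yB.
  by rewrite !inE => -[].
have GE' : fubini_G m1 g = (fun y => \int[m1]_(x in A) f (x, y))%E \_ B.
  by apply/funext => y; exact: GE.
split.
  apply: (iffRL (measurable_restrictT _ mB)); rewrite -GE'.
  exact: measurable_fun_fubini_tonelli_G.
rewrite integral_mkcond [RHS]integral_mkcond -/g -GE'; exact: fubini_tonelli2.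
Qed.

(** Tonelli's theorem, the bound [c] being integrated over [B]; for negative [c] nonnegativity of
    [f] is enough. *)
Lemma ae_slice_lbound (f : T1 * T2 -> R) (c l : R) : measurable_fun (A `*` B) f ->
  (forall z, 0 <= f z) -> m2 B = l%:E ->
  {ae m2, forall y, B y -> (c%:E <= \int[m1]_(x in A) (f (x, y))%:E)%E} ->
  ((c * l)%:E <= \int[(m1 \x m2)%E]_(z in A `*` B) (f z)%:E)%E.
Proof.
move=> mf f0 Bl ae; have [c0|c0] := leP 0 c; last first.
  apply: (@le_trans _ _ 0%E); last by apply: integral_ge0 => z _; rewrite lee_fin.
  by rewrite lee_fin mulr_le0_ge0 ?(ltW c0)// -lee_fin -Bl measure_ge0.
have [mG ->] := @tonelli_rect (EFin \o f) (iffRL (measurable_EFinP _ _) mf) f0.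
rewrite EFinM -Bl -integral_cst//.
by apply: ae_ge0_le_integral => // y _; apply: integral_ge0 => x _; rewrite lee_fin.
Qed.

(** The pointwise infimum over n of the slice integrals lies below each of them, so its integral is
    0 and it vanishes almost everywhere. The index may depend on the slice, which spares the
    extraction of a common subsequence. *)
Lemma ae_slice_small (f : nat -> T1 * T2 -> R) :
  (forall n, measurable_fun (A `*` B) (f n)) -> (forall n z, 0 <= f n z) ->
  (\int[(m1 \x m2)%E]_(z in A `*` B) (f n z)%:E)%E @[n --> \oo] --> 0%E ->
  {ae m2, forall y, B y -> forall e : R, 0 < e -> exists n,
    (\int[m1]_(x in A) (f n (x, y))%:E < e%:E)%E}.
Proof.
move=> mf f0 cf; pose G n y := (\int[m1]_(x in A) (f n (x, y))%:E)%E.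
have G0 n y : (0 <= G n y)%E by apply: integral_ge0 => x _; rewrite lee_fin.
have GE n := @tonelli_rect (EFin \o f n) (iffRL (measurable_EFinP _ _) (mf n)) (f0 n).
pose I y := einfs (G ^~ y) 0.
have mI : measurable_fun B I by apply: measurable_fun_einfs => n; case: (GE n).
have I0 y : (0 <= I y)%E by apply: le_ereal_inf_tmp => _ [n _ <-].
have IG n y : (I y <= G n y)%E by apply: ereal_inf_lbound; exists n.
have int0 : (\int[m2]_(y in B) I y = 0)%E.
  apply/eqP; rewrite eq_le; apply/andP; split; last by apply: integral_ge0.
  apply: (cvge_ge _ cf); apply: nearW => n; case: (GE n) => mG ->.
  apply: ge0_le_integral; [exact: mB|by move=> y _; exact: I0|exact: mI|exact: mG|by move=> y _; exact: IG].
have : ae_eq m2 B I (cst 0%E).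
  apply/ae_eq_integral_abs => //; rewrite -int0; apply: eq_integral => y _.
  by rewrite gee0_abs.
apply: filterS => y Iy By e e0; have Iy0 := Iy By.
have : (I y < e%:E)%E by rewrite Iy0 /cst lte_fin.
by move/ereal_inf_lt => [_ [n _ <-] h]; exists n.
Qed.

End product_slices.

Lemma ecvg_congr (R : realType) (u v : nat -> \bar R) (l : \bar R) : u =1 v -> v @ \oo --> l -> u @ \oo --> l.
Proof. by move=> /funext ->. Qed.

Section H10_2_scaling.
Variable R : realType.
Local Notation mu2 := (@leb2 R).

(** Used to apply the planar bound to every multiple t u of a slice. *)
Lemma H10_2Z (r t : R) p q p1 p2 q1 q2 : H10_2 r p q p1 p2 q1 q2 ->
  H10_2 r (fun x => t * p x) (fun x => t * q x) (fun x => t * p1 x) (fun x => t * p2 x)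
    (fun x => t * q1 x) (fun x => t * q2 x).
Proof.
have mK := @measurable_K2 R r.
move=> H; have [mp mq [mp1 mp2] [mq1 mq2] [P [Q [cPQ [h0 h1]]]]] := H.
have mt f : measurable_fun (K2 r) f -> measurable_fun (K2 r) (fun x => t * f x).
  by move=> mf; apply: measurable_funM => //; exact: measurable_cst.
have cZ f : Cc2 r f -> Cc2 r (fun x => t * f x).
  move=> [sf [d d0 f0]]; split; first exact: smoothZ.
  by exists d => // x /f0 ->; rewrite mulr0.
have dZ n v x : 'D_v (fun x => t * P n x) x = t * 'D_v (P n) x /\
    'D_v (fun x => t * Q n x) x = t * 'D_v (Q n) x.
  have [[sP _] [sQ _]] := cPQ n.
  by split; apply: deriveZ; apply: diff_derivable; exact: smooth_differentiable.
have t20 : (0 : R) <= t ^+ 2 by exact: sqr_ge0.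
have t2f : (t ^+ 2)%:E \is a fin_num by [].
split; [exact: mt|exact: mt|by split; exact: mt|by split; exact: mt|].
exists (fun n x => t * P n x), (fun n x => t * Q n x); split.
  by move=> n; have [] := cPQ n; split; exact: cZ.
split.
- rewrite -[X in _ --> X](mule0 (t ^+ 2)%:E).
  apply: ecvg_congr (cvgeZl t2f h0) => n.
  have [cP cQ] := cPQ n.
  rewrite -ge0_integralZl_EFin//.
  + apply: eq_integral => x _; rewrite -EFinM; congr EFin.
    by move: (P n x) (Q n x) (p x) (q x) => A B C D; ring.
  + by move=> x _; rewrite lee_fin addr_ge0 ?sqr_ge0.
  + by apply/measurable_EFinP; exact: (dist0_mfun H).
- rewrite -[X in _ --> X](mule0 (t ^+ 2)%:E).
  apply: ecvg_congr (cvgeZl t2f h1) => n.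
  have [cP cQ] := cPQ n.
  rewrite -ge0_integralZl_EFin//.
  + apply: eq_integral => x _; rewrite -EFinM; congr EFin.
    have [-> ->] := dZ n (e21 R) x; have [-> ->] := dZ n (e22 R) x.
    move: ('D_(e21 R) (P n) x) ('D_(e21 R) (Q n) x) ('D_(e22 R) (P n) x) ('D_(e22 R) (Q n) x) (p1 x) (q1 x) (p2 x) (q2 x).
    by move=> *; ring.
  + by move=> x _; rewrite lee_fin !addr_ge0 ?sqr_ge0.
  + by apply/measurable_EFinP; exact: (dist1_mfun H).
Qed.

End H10_2_scaling.

Section H10_3_slices.
Variable R : realType.
Local Notation mu1 := (@lebesgue_measure R).
Local Notation mu2 := (@leb2 R).
Local Notation mu3 := (@leb3 R).

Lemma Cc3_slice (r : R) f y : Cc3 r f -> Cc2 r (fun x => f (x, y)).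
Proof.
move=> [sf [d d0 f0]]; split.
  exact: (smooth_affine (@affine_pairl R (pt2 R) R y) sf).
by exists d => // x xr; apply: f0 => -[h1 [h2 _]]; apply: xr.
Qed.

Lemma derive_slice_plane (f : pt3 R -> R) (y : R) (x v : pt2 R) :
  'D_v (fun x => f (x, y)) x = 'D_((v, 0) : pt3 R) f (x, y).
Proof. exact: (derive_affine f x v (@affine_pairl R (pt2 R) R y)). Qed.

Lemma Cc3_derive (r : R) f v : Cc3 r f -> Cc3 r (fun x => 'D_v f x).
Proof.
move=> [sf [d d0 f0]]; split; first exact: smooth_derive.
exists d => // x xr.
pose U := [set x : pt3 R | r / 2 - d < `|x.1.1|] `|` ([set x : pt3 R | r / 2 - d < `|x.1.2|]
  `|` [set x : pt3 R | r / 2 - d < `|x.2|]).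
have on (g : pt3 R -> R) : continuous g -> open [set x | r / 2 - d < `|g x|].
  move=> cg; apply: (@open_comp _ _ (fun x => `|g x|) [set t | r / 2 - d < t]); last exact: open_gt.
  by move=> z _; apply: continuous_comp; [exact: cg|exact: norm_continuous].
apply: (@derive_supp R (pt3 R) f U).
- have c1 : continuous (fun x : pt3 R => x.1.1).
    by move=> z; apply: (@continuous_comp _ _ _ (@fst (pt2 R) R) (@fst R R)); exact: cvg_fst.
  have c2 : continuous (fun x : pt3 R => x.1.2).
    by move=> z; apply: (@continuous_comp _ _ _ (@fst (pt2 R) R) (@snd R R)); [exact: cvg_fst|exact: cvg_snd].
  have c3 : continuous (fun x : pt3 R => x.2) by move=> z; exact: cvg_snd.
  by apply: openU; [exact: on|apply: openU; exact: on].
- move=> z Uz; apply: f0 => -[h1 [h2 h3]].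
  by case: Uz => [|[]] /=; rewrite ltNge => /negP; apply.
- apply: contrapT => nU; apply: xr; split; [|split]; rewrite leNgt; apply/negP => h; apply: nU.
  + by left.
  + by right; left.
  + by right; right.
Qed.

Lemma Cc3_mfun (r : R) (D : set (pt3 R)) f : Cc3 r f -> measurable_fun D f.
Proof.
by move=> [sf _]; apply: measurable_funTS; apply: continuous_measurable3; exact: smooth_continuous.
Qed.

Lemma Cc3_mfun_derive (r : R) (D : set (pt3 R)) f v : Cc3 r f -> measurable_fun D (fun x => 'D_v f x).
Proof. by move=> /(Cc3_derive v); exact: Cc3_mfun. Qed.

Variable r : R.
Hypothesis r0 : 0 < r.
Variables p q p1 p2 p3 q1 q2 q3 : pt3 R -> R.
Hypothesis H : H10_3 r p q p1 p2 p3 q1 q2 q3.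

Let mp : measurable_fun (Q3 r) p. Proof. by case: H. Qed.
Let mq : measurable_fun (Q3 r) q. Proof. by case: H. Qed.
Let mp1 : measurable_fun (Q3 r) p1. Proof. by case: H => _ _ []. Qed.
Let mp2 : measurable_fun (Q3 r) p2. Proof. by case: H => _ _ []. Qed.
Let mp3 : measurable_fun (Q3 r) p3. Proof. by case: H => _ _ []. Qed.
Let mq1 : measurable_fun (Q3 r) q1. Proof. by case: H => _ _ _ []. Qed.
Let mq2 : measurable_fun (Q3 r) q2. Proof. by case: H => _ _ _ []. Qed.
Let mq3 : measurable_fun (Q3 r) q3. Proof. by case: H => _ _ _ []. Qed.

Let regroup6 (a b c d e f : R) : a + b + d + e + c + f = a + b + c + d + e + f.
Proof. ring. Qed.

Definition sdist0 (P Q : pt3 R -> R) x := (P x - p x) ^+ 2 + (Q x - q x) ^+ 2.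
(** The vertical derivatives are left out, since a slice only sees the horizontal ones. *)
Definition sdist1 (P Q : pt3 R -> R) x :=
  (derive P x (e31 R) - p1 x) ^+ 2 + (derive P x (e32 R) - p2 x) ^+ 2
  + (derive Q x (e31 R) - q1 x) ^+ 2 + (derive Q x (e32 R) - q2 x) ^+ 2.

Lemma sdist0_mfun P Q : Cc3 r P -> Cc3 r Q -> measurable_fun (Q3 r) (sdist0 P Q).
Proof. by move=> cP cQ; rewrite /sdist0; mfun_with ltac:(eapply Cc3_mfun; eassumption). Qed.

Lemma sdist1_mfun P Q : Cc3 r P -> Cc3 r Q -> measurable_fun (Q3 r) (sdist1 P Q).
Proof. by move=> cP cQ; rewrite /sdist1; mfun_with ltac:(idtac; lazymatch goal with |- context [@derive] => eapply Cc3_mfun_derive; eassumption | _ => assumption end). Qed.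

Lemma sdist0_ge0 P Q x : 0 <= sdist0 P Q x.
Proof. by rewrite addr_ge0 ?sqr_ge0. Qed.
Lemma sdist1_ge0 P Q x : 0 <= sdist1 P Q x.
Proof. by rewrite !addr_ge0 ?sqr_ge0. Qed.

(** The approximating sequence is chosen slice by slice: its k-th term restricts an approximant
    whose distance on this slice is below 1/(k+1), as given by [ae_slice_small]. Functions and
    gradients are summed in one [f], so that a single index serves both. *)
Lemma H10_3_slice : {ae mu1, forall y, itv1 r y ->
  H10_2 r (fun x => p (x, y)) (fun x => q (x, y)) (fun x => p1 (x, y)) (fun x => p2 (x, y))
    (fun x => q1 (x, y)) (fun x => q2 (x, y))}.
Proof.
have [_ _ _ _ [P [Q [cPQ [h0 h1]]]]] := H.
have mQ3 : measurable (Q3 r) := measurable_Q3 r.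
pose f n z := sdist0 (P n) (Q n) z + sdist1 (P n) (Q n) z.
have f0 n z : 0 <= f n z by rewrite addr_ge0 ?sdist0_ge0 ?sdist1_ge0.
have m0' n : measurable_fun (Q3 r) (sdist0 (P n) (Q n)).
  by case: (cPQ n) => cP cQ; exact: sdist0_mfun.
have m1' n : measurable_fun (Q3 r) (sdist1 (P n) (Q n)).
  by case: (cPQ n) => cP cQ; exact: sdist1_mfun.
have mf n : measurable_fun (Q3 r) (f n) by exact: measurable_funD.
have cf : (\int[mu3]_(z in Q3 r) (f n z)%:E)%E @[n --> \oo] --> 0%E.
  pose a n := (\int[mu3]_(x in Q3 r) (sdist0 (P n) (Q n) x)%:E)%E.
  pose g n x := sdist1 (P n) (Q n) x + (derive (P n) x (e33 R) - p3 x) ^+ 2 + (derive (Q n) x (e33 R) - q3 x) ^+ 2.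
  pose c n := (\int[mu3]_(x in Q3 r) (g n x)%:E)%E.
  have ca : a @ \oo --> 0%E by exact: h0.
  have cc : c @ \oo --> 0%E.
    apply: ecvg_congr h1 => n; apply: eq_integral => x _.
    by congr EFin; exact: regroup6.
  have cac : (a \+ c)%E @ \oo --> 0%E by rewrite -[X in _ --> X]adde0; exact: cvgeD.
  apply: (squeeze_cvge _ (@cvg_cst _ 0%E _ _ _) cac); apply: nearW => n.
  apply/andP; split; first by apply: integral_ge0 => z _; rewrite lee_fin.
  rewrite (_ : \int[mu3]_(z in Q3 r) (f n z)%:E =
      a n + \int[mu3]_(z in Q3 r) (sdist1 (P n) (Q n) z)%:E)%E; last first.
    rewrite /a -ge0_integralD//.
    - by move=> z _; rewrite lee_fin sdist0_ge0.
    - by apply/measurable_EFinP; exact: m0'.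
    - by move=> z _; rewrite lee_fin sdist1_ge0.
    - by apply/measurable_EFinP; exact: m1'.
  apply: leeD => //; case: (cPQ n) => cP cQ; apply: ge0_le_integral => //.
  - by move=> z _; rewrite lee_fin sdist1_ge0.
  - by apply/measurable_EFinP; exact: m1'.
  - apply/measurable_EFinP; rewrite /g; have mg := m1' n; apply: measurable_funD; first apply: measurable_funD => //;
    mfun_with ltac:(idtac; lazymatch goal with |- context [@derive] => eapply Cc3_mfun_derive; eassumption | _ => assumption end).
  - by move=> z _; rewrite lee_fin /g -addrA lerDl addr_ge0 ?sqr_ge0.
have mK : @measurable _ (measurableTypeR R * measurableTypeR R)%type (K2 r) := measurable_K2 r; have mI := measurable_itv1 r.
rewrite Q3E in mf cf.
have := @ae_slice_small _ _ _ _ R mu2 mu1 (K2 r) (itv1 r) mK mI f mf f0 cf.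
apply: filterS => y hy By.
have i0 (k : nat) : 0 < (k.+1%:R^-1 : R) by rewrite invr_gt0 ltr0Sn.
have [n hn] := choice (fun k : nat => hy By (k.+1%:R^-1) (i0 k)).
have sl (g : pt3 R -> R) : measurable_fun (Q3 r) g -> measurable_fun (K2 r) (fun x => g (x, y)).
  by rewrite Q3E => mg; exact: (@slice_measurable _ _ (measurableTypeR R * measurableTypeR R)%type (measurableTypeR R) (K2 r) (itv1 r) mK mI _ (measurableTypeR R) g y By mg).
split; [exact: sl|exact: sl|by split; exact: sl|by split; exact: sl|].
exists (fun k x => P (n k) (x, y)), (fun k x => Q (n k) (x, y)); split.
  by move=> k; case: (cPQ (n k)) => cP cQ; split; exact: Cc3_slice.
have inv0 : ((k.+1%:R^-1)%:E : \bar R) @[k --> \oo] --> 0%E.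
  by apply: cvg_EFin; [exact: nearW|exact: cvg_harmonic].
have sq (h : nat -> pt2 R -> R) : (forall k, measurable_fun (K2 r) (h k)) -> (forall k x, 0 <= h k x) ->
    (forall k x, h k x <= f (n k) (x, y)) ->
    (\int[mu2]_(x in K2 r) (h k x)%:E)%E @[k --> \oo] --> 0%E.
  move=> mh hh0 hf; apply: (squeeze_cvge _ (@cvg_cst _ 0%E _ _ _) inv0); apply: nearW => k.
  apply/andP; split; first by apply: integral_ge0 => z _; rewrite lee_fin.
  apply: le_trans (ltW (hn k)); apply: ge0_le_integral => //.
  - by move=> x _; rewrite lee_fin.
  - by apply/measurable_EFinP; exact: mh.
  - by apply/measurable_EFinP; apply: (sl (f (n k))); rewrite Q3E; exact: mf.
  - by move=> x _; rewrite lee_fin.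
split.
- apply: sq.
  + by move=> k; apply: (sl (sdist0 (P (n k)) (Q (n k)))).
  + by move=> k x; rewrite addr_ge0 ?sqr_ge0.
  + by move=> k x; rewrite /f lerDl sdist1_ge0.
- apply: (@ecvg_congr _ _ (fun k => \int[mu2]_(x in K2 r) (sdist1 (P (n k)) (Q (n k)) (x, y))%:E)%E).
    by move=> k; apply: eq_integral => x _; rewrite !derive_slice_plane -e31E -e32E.
  apply: sq.
  + by move=> k; apply: (sl (sdist1 (P (n k)) (Q (n k)))).
  + by move=> k x; exact: sdist1_ge0.
  + by move=> k x; rewrite /f lerDr sdist0_ge0.
Qed.

End H10_3_slices.

(** * Compactly supported functions in space *)

Section compact_support3.
Variable R : realType.
Local Notation mu3 := (@leb3 R).

Lemma leb3_Q3 (r : R) : 0 <= r -> mu3 (Q3 r) = (r ^+ 3)%:E.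
Proof.
move=> r0; rewrite Q3E /leb3 product_measure1E; [|exact: measurable_K2|exact: measurable_itv1].
rewrite [X in (X * _)%E](leb2_K2 r0) [X in (_ * X)%E](leb_itv1 r0) -EFinM; congr EFin; ring.
Qed.

Lemma leb3_Q3_fin (r : R) : 0 <= r -> (mu3 (Q3 r) < +oo)%E.
Proof. by move=> r0; apply: (@le_lt_trans _ _ (r ^+ 3)%:E); [rewrite -(leb3_Q3 r0)|exact: ltry]. Qed.

Definition csupp3 (r : R) (f : pt3 R -> R) := continuous f /\ forall x, ~ Q3 r x -> f x = 0.

Lemma csupp3_bounded r f : 0 <= r -> csupp3 r f -> exists M, forall x, `|f x| <= M.
Proof.
move=> r0 [cf f0].
pose I := `[(- (r / 2)), (r / 2)]%classic : set R.
have IP x : I x <-> `|x| <= r / 2 by rewrite /I /= in_itv/= -ler_norml.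
have [|||c _ hc] := @compact_EVT_max _ R (fun x : pt3 R => `|f x|) ((I `*` I) `*` I).
- by exists ((0, 0), 0); split; [split|]; apply/IP; rewrite normr0; lra.
- by apply: compact_setX; [apply: compact_setX|]; exact: segment_compact.
- by apply: continuous_subspaceT => x; apply: cvg_norm; exact: cf.
exists `|f c| => x; have [xr|xr] := pselect (((I `*` I) `*` I) x); first by apply: hc; rewrite inE.
by rewrite f0 ?normr0// => -[h1 [h2 h3]]; apply: xr; split; [split|]; apply/IP; exact: ltW.
Qed.

Lemma csupp3_integrable r f : 0 <= r -> csupp3 r f -> mu3.-integrable (Q3 r) (EFin \o f).
Proof.
move=> r0 cf; have [M hM] := csupp3_bounded r0 cf.
apply: measurable_bounded_integrable; first exact: measurable_Q3.
- exact: leb3_Q3_fin.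
- by apply: measurable_funTS; apply: continuous_measurable3; case: cf.
- by exists M; split; [exact: num_real|move=> N MN x _; apply: le_trans (hM x) (ltW MN)].
Qed.

Lemma Cc3_csupp r f : Cc3 r f -> csupp3 r f.
Proof.
move=> [sf [d d0 f0]]; split; first exact: smooth_continuous.
move=> x xr; apply: f0 => -[h1 [h2 h3]]; apply: xr.
by split; [|split]; (apply: le_lt_trans; [eassumption|]; rewrite ltrBlDr ltrDl).
Qed.

Lemma csupp3D r f g : csupp3 r f -> csupp3 r g -> csupp3 r (fun x => f x + g x).
Proof.
move=> [cf f0] [cg g0]; split; first by move=> x; apply: cvgD; [exact: cf|exact: cg].
by move=> x xr; rewrite f0// g0// addr0.
Qed.

Lemma csupp3X r f n : csupp3 r f -> csupp3 r (fun x => f x ^+ n.+1).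
Proof.
move=> [cf f0]; split; last by move=> x xr; rewrite f0// expr0n.
move=> x; apply: (@continuous_comp _ _ _ f (fun y => y ^+ n.+1)); [exact: cf|exact: exprn_continuous].
Qed.

End compact_support3.

Lemma edensZ_scalar (R : realType) (b t A1 A2 p q p1 p2 q1 q2 : R) :
  b * ((t * p1 + A1 * (t * q)) ^+ 2 + (t * q1 - A1 * (t * p)) ^+ 2
    + (t * p2 + A2 * (t * q)) ^+ 2 + (t * q2 - A2 * (t * p)) ^+ 2)
  - ((t * p) ^+ 2 + (t * q) ^+ 2) + 2^-1 * ((t * p) ^+ 2 + (t * q) ^+ 2) ^+ 2 =
  t ^+ 2 * (b * ((p1 + A1 * q) ^+ 2 + (q1 - A1 * p) ^+ 2 + (p2 + A2 * q) ^+ 2 + (q2 - A2 * p) ^+ 2)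
    + (-1) * (p ^+ 2 + q ^+ 2)) + 2^-1 * t ^+ 4 * (p ^+ 2 + q ^+ 2) ^+ 2.
Proof. by field. Qed.

(** * Lower bound for the energy in space by slicing *)

Section energy3.
Variable R : realType.
Local Notation mu1 := (@lebesgue_measure R).
Local Notation mu2 := (@leb2 R).
Local Notation mu3 := (@leb3 R).
Variable r : R.
Hypothesis r0 : 0 < r.
Variables p q p1 p2 p3 q1 q2 q3 : pt3 R -> R.
Hypothesis H : H10_3 r p q p1 p2 p3 q1 q2 q3.

Let mp : measurable_fun (Q3 r) p. Proof. by case: H. Qed.
Let mq : measurable_fun (Q3 r) q. Proof. by case: H. Qed.
Let mp1 : measurable_fun (Q3 r) p1. Proof. by case: H => _ _ []. Qed.
Let mp2 : measurable_fun (Q3 r) p2. Proof. by case: H => _ _ []. Qed.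
Let mp3 : measurable_fun (Q3 r) p3. Proof. by case: H => _ _ []. Qed.
Let mq1 : measurable_fun (Q3 r) q1. Proof. by case: H => _ _ _ []. Qed.
Let mq2 : measurable_fun (Q3 r) q2. Proof. by case: H => _ _ _ []. Qed.
Let mq3 : measurable_fun (Q3 r) q3. Proof. by case: H => _ _ _ []. Qed.

Let mQ3 : @measurable _ (measurableTypeR R * measurableTypeR R * measurableTypeR R)%type (Q3 r) := measurable_Q3 r.

(* [u] is the limit of [P], so it suffices to compare with one [P] *)
Let L2_limit (u : pt3 R -> R) (P : nat -> pt3 R -> R) (D : nat -> pt3 R -> R) :
  measurable_fun (Q3 r) u -> (forall n, csupp3 r (P n)) -> (forall n, measurable_fun (Q3 r) (D n)) ->
  (forall n x, (P n x - u x) ^+ 2 <= D n x) ->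
  (\int[mu3]_(x in Q3 r) (D n x)%:E)%E @[n --> \oo] --> 0%E ->
  mu3.-integrable (Q3 r) (EFin \o (fun x => u x ^+ 2)).
Proof.
move=> mu cP mD hD cv; have [n hn] := filter_ex (cvge0_lt cv (@ltr01 R)).
have D0 x : 0 <= D n x by apply: le_trans (hD n x); exact: sqr_ge0.
have iD : mu3.-integrable (Q3 r) (EFin \o D n).
  by apply: ge0_integrable; [exact: mD|by move=> x _|exact: lt_trans hn (ltry _)].
have iP := csupp3_integrable (ltW r0) (csupp3X 1 (cP n)).
apply: (dominated_integrable mQ3 _ (integrable_lin2 mQ3 2 2 iP iD)) => //.
  exact: measurable_funX.
move=> x _; rewrite ger0_norm ?sqr_ge0//.
have := hD n x; have := sqrB_le (u x) 0 (P n x).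
by rewrite subr0 sub0r sqrrN -[(u x - P n x) ^+ 2]sqrrN opprB; lra.
Qed.

Let dist1_3 (P Q : pt3 R -> R) x :=
  (derive P x (e31 R) - p1 x) ^+ 2 + (derive P x (e32 R) - p2 x) ^+ 2
  + (derive P x (e33 R) - p3 x) ^+ 2
  + (derive Q x (e31 R) - q1 x) ^+ 2 + (derive Q x (e32 R) - q2 x) ^+ 2
  + (derive Q x (e33 R) - q3 x) ^+ 2.

Let dist1_3_mfun P Q : Cc3 r P -> Cc3 r Q -> measurable_fun (Q3 r) (dist1_3 P Q).
Proof.
by move=> cP cQ; rewrite /dist1_3; mfun_with ltac:(idtac; lazymatch goal with
  |- context [@derive] => eapply Cc3_mfun_derive; eassumption | _ => assumption end).
Qed.

Let le_sum6 (a b c d e f : R) : 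
  let S := a ^+ 2 + b ^+ 2 + c ^+ 2 + d ^+ 2 + e ^+ 2 + f ^+ 2 in
  [/\ a ^+ 2 <= S, b ^+ 2 <= S, c ^+ 2 <= S & [/\ d ^+ 2 <= S, e ^+ 2 <= S & f ^+ 2 <= S]].
Proof.
move=> S; rewrite {}/S; have := sqr_ge0 a; have := sqr_ge0 b; have := sqr_ge0 c; have := sqr_ge0 d; have := sqr_ge0 e; have := sqr_ge0 f.
by move=> *; split; [lra..|split; lra].
Qed.

Let L2 (u : pt3 R -> R) := mu3.-integrable (Q3 r) (EFin \o (fun x => u x ^+ 2)).

Lemma H10_3_L2 : [/\ L2 p, L2 q, [/\ L2 p1, L2 p2 & L2 p3] & [/\ L2 q1, L2 q2 & L2 q3]].
Proof.
have [_ _ _ _ [P [Q [cPQ [h0 h1]]]]] := H.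
have m0 n : measurable_fun (Q3 r) (sdist0 p q (P n) (Q n)) by case: (cPQ n) => ? ?; exact: (sdist0_mfun H).
have m1 n : measurable_fun (Q3 r) (dist1_3 (P n) (Q n)) by case: (cPQ n) => ? ?; exact: dist1_3_mfun.
have cP n : Cc3 r (P n) by case: (cPQ n).
have cQ n : Cc3 r (Q n) by case: (cPQ n).
have dP n v : csupp3 r (fun x => 'D_v (P n) x) by apply: Cc3_csupp; exact: Cc3_derive.
have dQ n v : csupp3 r (fun x => 'D_v (Q n) x) by apply: Cc3_csupp; exact: Cc3_derive.
have ls n x := le_sum6 (derive (P n) x (e31 R) - p1 x) (derive (P n) x (e32 R) - p2 x)
  (derive (P n) x (e33 R) - p3 x) (derive (Q n) x (e31 R) - q1 x) (derive (Q n) x (e32 R) - q2 x)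
  (derive (Q n) x (e33 R) - q3 x).
have s0 n := Cc3_csupp (cP n); have s1 n := Cc3_csupp (cQ n).
split; [| |split|split].
- by apply: (L2_limit mp s0 m0 _ h0) => n x; rewrite /sdist0 lerDl sqr_ge0.
- by apply: (L2_limit mq s1 m0 _ h0) => n x; rewrite /sdist0 lerDr sqr_ge0.
- by apply: (L2_limit mp1 (fun n => dP n (e31 R)) m1 _ h1) => n x; have [h _ _ _] := ls n x; exact: h.
- by apply: (L2_limit mp2 (fun n => dP n (e32 R)) m1 _ h1) => n x; have [_ h _ _] := ls n x; exact: h.
- by apply: (L2_limit mp3 (fun n => dP n (e33 R)) m1 _ h1) => n x; have [_ _ h _] := ls n x; exact: h.
- by apply: (L2_limit mq1 (fun n => dQ n (e31 R)) m1 _ h1) => n x; have [_ _ _ [h _ _]] := ls n x; exact: h.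
- by apply: (L2_limit mq2 (fun n => dQ n (e32 R)) m1 _ h1) => n x; have [_ _ _ [_ h _]] := ls n x; exact: h.
- by apply: (L2_limit mq3 (fun n => dQ n (e33 R)) m1 _ h1) => n x; have [_ _ _ [_ _ h]] := ls n x; exact: h.
Qed.

Let i2 (f g : pt3 R -> R) : mu3.-integrable (Q3 r) (EFin \o f) -> mu3.-integrable (Q3 r) (EFin \o g) ->
  mu3.-integrable (Q3 r) (EFin \o (fun x => f x + g x)).
Proof. by move=> jf jg; exact: (integrableD mQ3 jf jg). Qed.

Lemma H10_3_mass_integrable : mu3.-integrable (Q3 r) (EFin \o (fun x => p x ^+ 2 + q x ^+ 2)).
Proof. by have [jp jq _ _] := H10_3_L2; exact: i2. Qed.

Let c1_mfun (D : set (pt3 R)) : measurable_fun D (fun x : pt3 R => A01 x.1).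
Proof.
apply: measurable_funTS; apply: continuous_measurable3 => x.
by apply: (@continuous_comp _ _ _ (@fst (pt2 R) R) (@A01 R)); [exact: cvg_fst|exact: continuous_A01].
Qed.

Let c2_mfun (D : set (pt3 R)) : measurable_fun D (fun x : pt3 R => A02 x.1).
Proof.
apply: measurable_funTS; apply: continuous_measurable3 => x.
by apply: (@continuous_comp _ _ _ (@fst (pt2 R) R) (@A02 R)); [exact: cvg_fst|exact: continuous_A02].
Qed.

Definition kin3 (x : pt3 R) := kin x.1 (p x) (q x) (p1 x) (p2 x) (q1 x) (q2 x).

Lemma kin3_mfun : measurable_fun (Q3 r) kin3.
Proof.
rewrite /kin3 /kin; mfun_with ltac:(idtac; lazymatch goal with
  | |- context [@A01] => exact: c1_mfun
  | |- context [@A02] => exact: c2_mfun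
  | _ => assumption end).
Qed.

Lemma H10_3_kin_integrable : mu3.-integrable (Q3 r) (EFin \o kin3).
Proof.
have [jp jq [j1 j2 _] [k1 k2 _]] := H10_3_L2.
have ig := i2 (i2 (i2 j1 j2) k1) k2.
apply: (dominated_integrable mQ3 kin3_mfun (integrable_lin2 mQ3 2 (r ^+ 2) ig H10_3_mass_integrable)).
move=> x Qx; rewrite ger0_norm ?kin_ge0//; apply: kin_le.
by case: Qx => ? [].
Qed.

Lemma H10_3_vertical_integrable :
  mu3.-integrable (Q3 r) (EFin \o (fun x => p3 x ^+ 2 + q3 x ^+ 2)).
Proof. by have [_ _ [_ _ j] [_ _ k]] := H10_3_L2; exact: i2. Qed.

Let vertical_scalar (k u v s t : R) : k + (u + 0 * s) ^+ 2 + (v - 0 * t) ^+ 2 = k + (u ^+ 2 + v ^+ 2).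
Proof. by rewrite !mul0r addr0 subr0 addrA. Qed.

(** Isolates the vertical derivative, free of potential since [F3] is 0, as the term that the lower
    bound discards. *)
Lemma Flin3E b : Flin3 b r p q p1 p2 p3 q1 q2 q3 =
  b * (\int[mu3]_(x in Q3 r) kin3 x) + b * (\int[mu3]_(x in Q3 r) (p3 x ^+ 2 + q3 x ^+ 2))
  - \int[mu3]_(x in Q3 r) (p x ^+ 2 + q x ^+ 2).
Proof.
rewrite -mulrDr -RintegralD//; [|exact: H10_3_kin_integrable|exact: H10_3_vertical_integrable].
rewrite /Flin3; congr (_ * _ - _); apply: eq_Rintegral => x _.
exact: (vertical_scalar (kin3 x)).
Qed.

Let quartic (x : pt3 R) := (p x ^+ 2 + q x ^+ 2) ^+ 2.
Hypothesis iq : mu3.-integrable (Q3 r) (EFin \o quartic).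

Definition edens3 (b t : R) (x : pt3 R) :=
  edens b x.1 (t * p x) (t * q x) (t * p1 x) (t * p2 x) (t * q1 x) (t * q2 x).

Lemma edens3E b t x :
  edens3 b t x = t ^+ 2 * (b * kin3 x + (-1) * (p x ^+ 2 + q x ^+ 2)) + 2^-1 * t ^+ 4 * quartic x.
Proof. exact: edensZ_scalar. Qed.

Lemma edens3_integrable b t : mu3.-integrable (Q3 r) (EFin \o edens3 b t).
Proof.
have i := integrable_lin2 mQ3 b (-1) H10_3_kin_integrable H10_3_mass_integrable.
have := integrable_lin2 mQ3 (t ^+ 2) (2^-1 * t ^+ 4) i iq.
by apply: eq_integrable => // x _; rewrite /= edens3E.
Qed.

Lemma int_edens3 b t : \int[mu3]_(x in Q3 r) edens3 b t x =
  t ^+ 2 * (b * (\int[mu3]_(x in Q3 r) kin3 x) - \int[mu3]_(x in Q3 r) (p x ^+ 2 + q x ^+ 2))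
  + 2^-1 * t ^+ 4 * \int[mu3]_(x in Q3 r) quartic x.
Proof.
have i := integrable_lin2 mQ3 b (-1) H10_3_kin_integrable H10_3_mass_integrable.
under eq_Rintegral do rewrite edens3E.
apply: (etrans (Rintegral_lin2 mQ3 (t ^+ 2) (2^-1 * t ^+ 4) i iq)).
by rewrite (Rintegral_lin2 mQ3 b (-1) H10_3_kin_integrable H10_3_mass_integrable) mulN1r.
Qed.

(** The planar bound is integrated over the slices. Adding 1/2 makes the density nonnegative, by
    [edens_ge], so that Tonelli's theorem applies; the same constant is subtracted at the end. *)
Lemma int_edens3_ge b t : 0 <= b <= 1 -> cvg (m0 b s / s ^+ 2 @[s --> +oo]) ->
  gGL b * r ^+ 3 <= \int[mu3]_(x in Q3 r) edens3 b t x.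
Proof.
move=> b01 cv; have /andP[b0 b1] := b01; have r0' := ltW r0.
have mK : @measurable _ (measurableTypeR R * measurableTypeR R)%type (K2 r) := measurable_K2 r.
have mI := measurable_itv1 r.
have ie := edens3_integrable b t.
have icst : mu3.-integrable (Q3 r) (EFin \o cst (2^-1 : R)).
  by apply: integrable_cst_fin => //; exact: leb3_Q3_fin.
have ief := integrableD mQ3 ie icst.
pose f (x : pt3 R) := edens3 b t x + 2^-1.
have f0 z : 0 <= f z.
  by rewrite /f -lerBlDr sub0r; exact: edens_ge.
have mf : measurable_fun (Q3 r) f by apply/measurable_EFinP; exact: measurable_int ief.
have ae : {ae mu1, forall y, itv1 r y ->
    (((gGL b + 2^-1) * r ^+ 2)%:E <= \int[mu2]_(x in K2 r) (f (x, y))%:E)%E}.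
  move: (H10_3_slice H); apply: filterS; first exact: (ae_filter_ringOfSetsType mu1).
  move=> y hy Iy; have hz := H10_2Z t (hy Iy).
  have [iz ez] := H10_2_edens r0 hz b.
  have ic2 : mu2.-integrable (K2 r) (EFin \o cst (2^-1 : R)).
    by apply: integrable_cst_fin => //; exact: leb2_K2_fin.
  have izf : mu2.-integrable (K2 r) (EFin \o (fun x => f (x, y))) by exact: (integrableD mK iz ic2).
  rewrite -(EFin_Rintegral mK izf) lee_fin.
  have -> : \int[mu2]_(x in K2 r) f (x, y) =
      GL2 b r (fun x => t * p (x, y)) (fun x => t * q (x, y)) (fun x => t * p1 (x, y))
        (fun x => t * p2 (x, y)) (fun x => t * q1 (x, y)) (fun x => t * q2 (x, y)) + 2^-1 * r ^+ 2.
    apply: (etrans (RintegralD mK iz ic2)); rewrite ez; congr (_ + _).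
    by rewrite Rintegral_cst//; congr (_ * _); exact: (congr1 fine (leb2_K2 r0')).
  rewrite mulrDl lerD2r; apply: le_trans (m0_le_GL2 b0 r0 hz).
  exact: gGL_le_m0.
rewrite Q3E in mf.
have := @ae_slice_lbound _ _ _ _ R mu2 mu1 (K2 r) (itv1 r) mK mI f ((gGL b + 2^-1) * r ^+ 2) r mf f0 (leb_itv1 r0') ae.
rewrite -Q3E -[X in (_ <= X)%E]/(\int[mu3]_(z in Q3 r) (f z)%:E)%E.
have ief' : mu3.-integrable (Q3 r) (EFin \o f) by exact: ief.
rewrite -(EFin_Rintegral mQ3 ief') lee_fin.
have -> : \int[mu3]_(z in Q3 r) f z = \int[mu3]_(x in Q3 r) edens3 b t x + 2^-1 * r ^+ 3.
  apply: (etrans (RintegralD mQ3 ie icst)); congr (_ + _).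
  by rewrite Rintegral_cst//; congr (_ * _); exact: (congr1 fine (leb3_Q3 r0')).
rewrite -mulrA -exprSr mulrDl lerD2r; exact.
Qed.

Lemma Flin3_quartic_ge b t : 0 <= b <= 1 -> cvg (m0 b s / s ^+ 2 @[s --> +oo]) ->
  gGL b * r ^+ 3 <= t ^+ 2 * Flin3 b r p q p1 p2 p3 q1 q2 q3
    + 2^-1 * t ^+ 4 * \int[mu3]_(x in Q3 r) quartic x.
Proof.
move=> b01 cv; apply: le_trans (int_edens3_ge t b01 cv) _; rewrite int_edens3 Flin3E lerD2r.
apply: ler_wpM2l; first exact: sqr_ge0.
rewrite lerD2r lerDl; case/andP: b01 => b0 _; apply: mulr_ge0 => //.
by apply: Rintegral_ge0 => // x _; rewrite addr_ge0 ?sqr_ge0.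
Qed.

End energy3.

(** * Lower bound for the quotient *)

Section quotient_lower.
Variable R : realType.
Local Notation mu3 := (@leb3 R).

Let quotient_scalar (F a c G3 : R) : 0 < a -> 0 < c -> G3 = a ^+ 2 ->
  - 2^-1 * G3 <= a / c * F + 2^-1 * (a / c) ^+ 2 * c ^+ 2 -> - a <= F / c.
Proof.
move=> a0 c0 ->.
have -> : 2^-1 * (a / c) ^+ 2 * c ^+ 2 = 2^-1 * a ^+ 2 by field; exact: lt0r_neq0.
have -> : a / c * F = a * (F / c) by field; exact: lt0r_neq0.
move: (F / c) => y h; rewrite -(ler_pM2l a0); lra.
Qed.

(** With a^2 = - 2 g(b) r^3 and c the denominator of the quotient, the optimal multiple of u is
    given by t^2 = a / c. *)
Lemma quotient_ge (b r : R) p q p1 p2 p3 q1 q2 q3 : 0 <= b <= 1 ->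
  cvg (m0 b s / s ^+ 2 @[s --> +oo]) -> gGL b < 0 -> 0 < r ->
  H10_3 r p q p1 p2 p3 q1 q2 q3 ->
  - Num.sqrt (- 2 * gGL b * r ^+ 3) <= Flin3 b r p q p1 p2 p3 q1 q2 q3 / L4norm3 r p q.
Proof.
move=> b01 cv g0 r0 H; rewrite /L4norm3.
set I := Rintegral _ _ _.
have G0 : 0 < - 2 * gGL b * r ^+ 3.
  by rewrite mulr_gt0 ?exprn_gt0// nmulr_rgt0// oppr_lt0.
(* The first case includes an infinite quartic integral, for which [Rintegral] is 0: the denominator
   is then 0, and so is the quotient. *)
have [I0|I0] := leP I 0.
  by rewrite (ler0_sqrtr I0) invr0 mulr0 oppr_le0 sqrtr_ge0.
have mq : measurable_fun (Q3 r) (fun x => (p x ^+ 2 + q x ^+ 2) ^+ 2).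
  by case: H => mp mq _ _ _; mfun_with ltac:(assumption).
have iq : mu3.-integrable (Q3 r) (EFin \o (fun x => (p x ^+ 2 + q x ^+ 2) ^+ 2)).
  apply: ge0_integrable => //; first by move=> x _; exact: sqr_ge0.
  (* An infinite integral would make [I] equal to 0. *)
  rewrite ltey; apply/eqP => h; move: I0; rewrite /I /Rintegral h /= ltxx; exact.
pose a := Num.sqrt (- 2 * gGL b * r ^+ 3); pose c := Num.sqrt I.
have a0 : 0 < a by rewrite sqrtr_gt0. have c0 : 0 < c by rewrite sqrtr_gt0.
have := Flin3_quartic_ge r0 H iq (Num.sqrt (a / c)) b01 cv.
have s2 : Num.sqrt (a / c) ^+ 2 = a / c by rewrite sqr_sqrtr// divr_ge0// ltW.
have s4 : Num.sqrt (a / c) ^+ 4 = (a / c) ^+ 2 by rewrite -[in RHS]s2 -exprM.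
have aE : - 2 * gGL b * r ^+ 3 = a ^+ 2 by rewrite (sqr_sqrtr (ltW G0)).
have cE : I = c ^+ 2 by rewrite (sqr_sqrtr (ltW I0)).
rewrite s2 s4 -/I => h.
apply: (quotient_scalar a0 c0 aE); rewrite -cE.
by have <- : gGL b * r ^+ 3 = - 2^-1 * (- 2 * gGL b * r ^+ 3) by field.
Qed.

End quotient_lower.

(** * Product trial functions in space *)

Section trial3.
Variable R : realType.
Local Notation mu1 := (@lebesgue_measure R).
Local Notation mu2 := (@leb2 R).
Local Notation mu3 := (@leb3 R).
Local Notation D1 f x := (derive f x (e21 R)).
Local Notation D2 f x := (derive f x (e22 R)).

Let sum6_0 (u v w s t y : R) : (u - u) ^+ 2 + (v - v) ^+ 2 + (w - w) ^+ 2
  + (s - s) ^+ 2 + (t - t) ^+ 2 + (y - y) ^+ 2 = 0.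
Proof. ring. Qed.

Lemma Cc3_H10_3 (r : R) P Q : Cc3 r P -> Cc3 r Q ->
  H10_3 r P Q (fun x => derive P x (e31 R)) (fun x => derive P x (e32 R)) (fun x => derive P x (e33 R))
    (fun x => derive Q x (e31 R)) (fun x => derive Q x (e32 R)) (fun x => derive Q x (e33 R)).
Proof.
move=> cP cQ.
split; [exact: Cc3_mfun cP|exact: Cc3_mfun cQ|by split; exact: Cc3_mfun_derive cP|by split; exact: Cc3_mfun_derive cQ|].
exists (fun=> P), (fun=> Q); split=> //; split.
- apply: (@ecvg_congr _ _ (fun=> 0%E)); last exact: cvg_cst.
  by move=> n; apply: integral0_eq => x _; rewrite !subrr expr0n addr0.
- apply: (@ecvg_congr _ _ (fun=> 0%E)); last exact: cvg_cst.
  by move=> n; apply: integral0_eq => x _; congr EFin; exact: sum6_0.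
Qed.

Lemma derive_tensor3 (f : pt2 R -> R) (g : R -> R) (y v : pt3 R) : smooth f -> smooth g ->
  'D_v (fun y : pt3 R => f y.1 * g y.2) y = f y.1 * 'D_(v.2) g y.2 + g y.2 * 'D_(v.1) f y.1.
Proof.
move=> sf sg.
have s1 := smooth_affine (@affine_fst R (pt2 R) R) sf; have s2 := smooth_affine (@affine_snd R (pt2 R) R) sg.
rewrite (_ : (fun y : pt3 R => _) = (f \o (@fst (pt2 R) R)) * (g \o (@snd (pt2 R) R)))//.
rewrite deriveM; [|apply: diff_derivable; exact: smooth_differentiable..].
by rewrite (derive_affine f y v (@affine_fst R (pt2 R) R)) (derive_affine g y v (@affine_snd R (pt2 R) R)).
Qed.

Definition tens3 (P : pt2 R -> R) (z : R -> R) (x : pt3 R) := P x.1 * z x.2.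

Lemma Cc3_tens3 (r : R) P z : Cc2 r P -> Cc1 r z -> Cc3 r (tens3 P z).
Proof.
move=> [sP [d d0 P0]] [sz [e e0 z0]]; split.
  apply: smoothM; first exact: (smooth_affine (@affine_fst R (pt2 R) R) sP).
  exact: (smooth_affine (@affine_snd R (pt2 R) R) sz).
exists (Num.min d e); first by rewrite lt_min d0.
have md : Num.min d e <= d by rewrite ge_min lexx.
have me : Num.min d e <= e by rewrite ge_min lexx orbT.
move=> x xr; rewrite /tens3.
have [h1|/P0 ->] := pselect (`|x.1.1| <= r / 2 - d /\ `|x.1.2| <= r / 2 - d); last by rewrite mul0r.
have [h2|/z0 ->] := pselect (`|x.2| <= r / 2 - e); last by rewrite mulr0.
exfalso; apply: xr; case: h1 => h1 h1'.
by split; [|split]; [apply: le_trans h1 _|apply: le_trans h1' _|apply: le_trans h2 _]; rewrite lerD2l lerN2.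
Qed.

Lemma derive1_tens3 P z x : smooth P -> smooth z -> derive (tens3 P z) x (e31 R) = D1 P x.1 * z x.2.
Proof.
move=> sP sz; apply: etrans (derive_tensor3 x (e31 R) sP sz) _.
by rewrite e31E /= derive0 mulr0 add0r mulrC.
Qed.

Lemma derive2_tens3 P z x : smooth P -> smooth z -> derive (tens3 P z) x (e32 R) = D2 P x.1 * z x.2.
Proof.
move=> sP sz; apply: etrans (derive_tensor3 x (e32 R) sP sz) _.
by rewrite e32E /= derive0 mulr0 add0r mulrC.
Qed.

Lemma derive3_tens3 P z x : smooth P -> smooth z -> derive (tens3 P z) x (e33 R) = P x.1 * 'D_1 z x.2.
Proof.
move=> sP sz; apply: etrans (derive_tensor3 x (e33 R) sP sz) _.
by rewrite e33E /= derive0 mulr0 addr0.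
Qed.

Lemma Rintegral_tens3 (r : R) c e : 0 <= r -> csupp2 r c -> csupp1 r e ->
  \int[mu3]_(x in Q3 r) tens3 c e x = (\int[mu2]_x c x) * \int[mu1]_x e x.
Proof.
move=> r0 cc ce; transitivity (\int[mu3]_x tens3 c e x).
  apply: Rintegral_supp => x xr; rewrite /tens3.
  have [h1|h1] := pselect (K2 r x.1); last by case: cc => _ ->//; rewrite mul0r.
  have [h2|h2] := pselect (itv1 r x.2); last by case: ce => _ ->//; rewrite mulr0.
  by exfalso; apply: xr; rewrite Q3E.
exact: (Rintegral_tensor (csupp2_integrable r0 cc) (csupp1_integrable r0 ce)).
Qed.

Section energy.
Variables (b r : R) (P Q : pt2 R -> R) (z : R -> R).
Hypotheses (b0 : 0 <= b) (r0 : 0 < r) (cP : Cc2 r P) (cQ : Cc2 r Q) (cz : Cc1 r z).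
Hypothesis z01 : forall s, 0 <= z s <= 1.
Let p := tens3 P z. Let q := tens3 Q z.
Let p1 x := derive p x (e31 R). Let p2 x := derive p x (e32 R). Let p3 x := derive p x (e33 R).
Let q1 x := derive q x (e31 R). Let q2 x := derive q x (e32 R). Let q3 x := derive q x (e33 R).

Lemma H10_3_tens3 : H10_3 r p q p1 p2 p3 q1 q2 q3.
Proof. by apply: Cc3_H10_3; exact: Cc3_tens3. Qed.

Let kin_scalar (A1 A2 u v u1 u2 v1 v2 w : R) :
  (u1 * w + A1 * (v * w)) ^+ 2 + (v1 * w - A1 * (u * w)) ^+ 2
  + (u2 * w + A2 * (v * w)) ^+ 2 + (v2 * w - A2 * (u * w)) ^+ 2 =
  ((u1 + A1 * v) ^+ 2 + (v1 - A1 * u) ^+ 2 + (u2 + A2 * v) ^+ 2 + (v2 - A2 * u) ^+ 2) * w ^+ 2.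
Proof. ring. Qed.

Let kin0 x := kin x (P x) (Q x) (D1 P x) (D2 P x) (D1 Q x) (D2 Q x).

Let kin3_tens3 x : kin3 p q p1 p2 q1 q2 x = tens3 kin0 (fun s => z s ^+ 2) x.
Proof.
have [sP _] := cP; have [sQ _] := cQ; have [sz _] := cz.
rewrite /kin3 /p1 /p2 /q1 /q2 (derive1_tens3 x sP sz) (derive2_tens3 x sP sz)
  (derive1_tens3 x sQ sz) (derive2_tens3 x sQ sz).
exact: kin_scalar.
Qed.

Let vert_tens3 x : p3 x ^+ 2 + q3 x ^+ 2 =
  tens3 (fun x => P x ^+ 2 + Q x ^+ 2) (fun s => 'D_1 z s ^+ 2) x.
Proof.
have [sP _] := cP; have [sQ _] := cQ; have [sz _] := cz.
rewrite /p3 /q3 (derive3_tens3 x sP sz) (derive3_tens3 x sQ sz) /tens3.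
by rewrite mulrDl -!exprMn.
Qed.

Let mass_tens3 x : p x ^+ 2 + q x ^+ 2 = tens3 (fun x => P x ^+ 2 + Q x ^+ 2) (fun s => z s ^+ 2) x.
Proof. by rewrite /p /q /tens3 mulrDl -!exprMn. Qed.

Let quartic_tens3 x : (p x ^+ 2 + q x ^+ 2) ^+ 2 =
  tens3 (fun x => (P x ^+ 2 + Q x ^+ 2) ^+ 2) (fun s => (z s ^+ 2) ^+ 2) x.
Proof. by rewrite mass_tens3 /tens3 exprMn. Qed.

Let csM : csupp2 r (fun x => P x ^+ 2 + Q x ^+ 2).
Proof. by apply: csupp2D; apply: csupp2X; exact: Cc2_csupp. Qed.

Let csK : csupp2 r kin0.
Proof.
have dP v : csupp2 r (fun x => 'D_v P x) by apply: Cc2_csupp; exact: Cc2_derive.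
have dQ v : csupp2 r (fun x => 'D_v Q x) by apply: Cc2_csupp; exact: Cc2_derive.
have sP := Cc2_csupp cP; have sQ := Cc2_csupp cQ.
have m1 := @continuous_A01 R; have m2 := @continuous_A02 R.
rewrite /kin0 /kin; do 3 (try apply: csupp2D); apply: csupp2X;
  first [apply: csupp2B|apply: csupp2D] => //; apply: csupp2M => //.
Qed.

Let iz2 := Cc1X cz.

Lemma tens3_quartic_integrable : mu3.-integrable (Q3 r) (EFin \o (fun x => (p x ^+ 2 + q x ^+ 2) ^+ 2)).
Proof.
apply: (csupp3_integrable (ltW r0)); apply: csupp3X.
by apply: csupp3D; apply: csupp3X; apply: Cc3_csupp; exact: Cc3_tens3.
Qed.

(** All integrals factor. In the quartic one, z^4 <= z^2 because 0 <= z <= 1, which rebuilds the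
    planar energy; the vertical derivative of [z] produces the mass term. *)
Lemma tens3_energy_le : Flin3 b r p q p1 p2 p3 q1 q2 q3
    + 2^-1 * \int[mu3]_(x in Q3 r) ((p x ^+ 2 + q x ^+ 2) ^+ 2) <=
  (\int[mu1]_s z s ^+ 2) * E2 b P Q + b * mass P Q * \int[mu1]_s 'D_1 z s ^+ 2.
Proof.
have r0' := ltW r0.
rewrite (Flin3E r0 H10_3_tens3).
under [X in b * X + _ - _ + _]eq_Rintegral do rewrite kin3_tens3.
under [X in _ + b * X - _ + _]eq_Rintegral do rewrite vert_tens3.
under [X in _ - X + _]eq_Rintegral do rewrite mass_tens3.
under [X in _ + 2^-1 * X]eq_Rintegral do rewrite quartic_tens3.
rewrite (Rintegral_tens3 r0' csK (Cc1_csupp iz2)).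
rewrite (Rintegral_tens3 r0' csM (Cc1_csupp (Cc1X (Cc1_derive cz)))).
rewrite (Rintegral_tens3 r0' csM (Cc1_csupp iz2)).
rewrite (Rintegral_tens3 r0' (csupp2X 1 csM) (Cc1_csupp (Cc1X iz2))).
have k4 : \int[mu1]_s (z s ^+ 2) ^+ 2 <= \int[mu1]_s z s ^+ 2.
  apply: le_Rintegral => //; [exact: Cc1_integrable r0' (Cc1X iz2)|exact: Cc1_integrable r0' iz2|].
  move=> s _; have /andP[h0 h1] := z01 s; rewrite expr2; apply: ler_piMr; first exact: sqr_ge0.
  by rewrite expr_le1.
have Q40 : 0 <= \int[mu2]_x (P x ^+ 2 + Q x ^+ 2) ^+ 2.
  by apply: Rintegral_ge0 => // x _; exact: sqr_ge0.
have -> : E2 b P Q = b * (\int[mu2]_x kin0 x) - mass P Q + 2^-1 * \int[mu2]_x (P x ^+ 2 + Q x ^+ 2) ^+ 2.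
  have iK := csupp2_integrable r0' csK; have iM := csupp2_integrable r0' csM.
  have i4 := csupp2_integrable r0' (csupp2X 1 csM).
  have i1 := integrable_lin2 measurableT b (-1) iK iM.
  transitivity (\int[mu2]_x (1 * (b * kin0 x + (-1) * (P x ^+ 2 + Q x ^+ 2)) + 2^-1 * (P x ^+ 2 + Q x ^+ 2) ^+ 2)).
    by apply: eq_Rintegral => x _; rewrite mul1r mulN1r.
  by rewrite (Rintegral_lin2 measurableT 1 2^-1 i1 i4) (Rintegral_lin2 measurableT b (-1) iK iM) mul1r mulN1r.
move: k4 Q40; rewrite -/(mass P Q).
move: (\int[mu1]_s (z s ^+ 2) ^+ 2) (\int[mu1]_s z s ^+ 2) (\int[mu2]_x (P x ^+ 2 + Q x ^+ 2) ^+ 2)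
  (\int[mu2]_x kin0 x) (mass P Q) (\int[mu1]_s 'D_1 z s ^+ 2) => k4 k2 Q4 K M d h1 h2.
have := mulr_ge0 h2 (_ : 0 <= k2 - k4); rewrite subr_ge0 => /(_ h1); lra.
Qed.

End energy.

End trial3.

(** * Upper bound for the quotient, and the limit *)

Section M0_bounds.
Variable R : realType.
Local Notation mu1 := (@lebesgue_measure R).
Local Notation mu3 := (@leb3 R).

Section quotient_upper.
Variables (b r : R) (p q p1 p2 p3 q1 q2 q3 : pt3 R -> R) (E : R).
Hypotheses (b0 : 0 <= b) (r0 : 0 < r) (H : H10_3 r p q p1 p2 p3 q1 q2 q3).
Let quartic (x : pt3 R) := (p x ^+ 2 + q x ^+ 2) ^+ 2.
Hypothesis iq : mu3.-integrable (Q3 r) (EFin \o quartic).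
Let I := \int[mu3]_(x in Q3 r) quartic x.
Hypothesis E0 : E < 0.
Hypothesis hE : Flin3 b r p q p1 p2 p3 q1 q2 q3 + 2^-1 * I <= E.

Let mQ3 : @measurable _ (measurableTypeR R * measurableTypeR R * measurableTypeR R)%type (Q3 r) := measurable_Q3 r.

(** A function vanishing almost everywhere has zero mass, and the mass is the only negative term of
    the energy. *)
Lemma energy_neg_not_ae0 : ~ {ae mu3, forall x, Q3 r x -> p x = 0 /\ q x = 0}.
Proof.
move=> ae.
have im := H10_3_mass_integrable r0 H.
have M0 : \int[mu3]_(x in Q3 r) (p x ^+ 2 + q x ^+ 2) = 0.
  rewrite /Rintegral (@ae_eq_integral _ _ _ mu3 _ (cst 0%E))//.
  - by rewrite integral0.
  - exact: measurable_int im.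
  - move: ae; apply: filterS; first exact: (ae_filter_ringOfSetsType mu3).
    by move=> x h Qx; have [-> ->] := h Qx; rewrite expr0n addr0.
have I0 : 0 <= I by apply: Rintegral_ge0 => x _; exact: sqr_ge0.
have F0 : 0 <= Flin3 b r p q p1 p2 p3 q1 q2 q3.
  rewrite (Flin3E r0 H) M0 subr0 addr_ge0// mulr_ge0//; apply: Rintegral_ge0 => x _.
    exact: kin_ge0.
  by rewrite addr_ge0 ?sqr_ge0.
have : 0 <= Flin3 b r p q p1 p2 p3 q1 q2 q3 + 2^-1 * I by rewrite addr_ge0 ?mulr_ge0 ?invr_ge0.
by rewrite leNgt (le_lt_trans hE E0).
Qed.

Lemma energy_neg_quartic_gt0 : 0 < I.
Proof.
have I0 : 0 <= I by apply: Rintegral_ge0 => x _; exact: sqr_ge0.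
rewrite lt_neqAle I0 andbT; apply/eqP => /esym Iz; apply: energy_neg_not_ae0.
have : (\int[mu3]_(x in Q3 r) `|(EFin \o quartic) x| = 0)%E.
  transitivity (\int[mu3]_(x in Q3 r) (quartic x)%:E)%E.
    by apply: eq_integral => x _; rewrite gee0_abs// lee_fin sqr_ge0.
  by rewrite -(EFin_Rintegral mQ3 iq) -/I Iz.
move/(ae_eq_integral_abs mu3 mQ3 (measurable_int _ iq)).
move=> [N [mN N0 hN]]; exists N; split; [exact: mN|exact: N0|].
apply: subset_trans hN => x /= h1 h2; apply: h1 => Qx; have [] := h2 Qx.
move/eqP; rewrite sqrf_eq0 paddr_eq0 ?sqr_ge0// !sqrf_eq0 => /andP[/eqP -> /eqP ->].
by [].
Qed.

Let quotient_scalar (F a c : R) : 0 < c -> F + 2^-1 * c ^+ 2 <= - (2^-1 * a ^+ 2) -> F / c <= - a.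
Proof.
by move=> c0 h; rewrite ler_pdivrMr//; have := sqr_ge0 (a - c); nra.
Qed.

Lemma quotient_le : Flin3 b r p q p1 p2 p3 q1 q2 q3 / L4norm3 r p q <= - Num.sqrt (- 2 * E).
Proof.
have I0 := energy_neg_quartic_gt0.
apply: quotient_scalar; first by rewrite sqrtr_gt0.
rewrite sqr_sqrtr; last exact: ltW.
rewrite sqr_sqrtr; last by rewrite nmulr_rge0 ?ltW// oppr_lt0.
by have -> : - (2^-1 * (- 2 * E)) = E by field.
Qed.

End quotient_upper.

Definition M0_values (b r : R) : set R :=
  [set E | exists p q p1 p2 p3 q1 q2 q3,
         [/\ H10_3 r p q p1 p2 p3 q1 q2 q3,
             ~ {ae @leb3 R, forall x, Q3 r x -> p x = 0 /\ q x = 0} &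
             E = Flin3 b r p q p1 p2 p3 q1 q2 q3 / L4norm3 r p q]].

Lemma M0_lbound (b r : R) : 0 <= b <= 1 ->
  cvg (m0 b s / s ^+ 2 @[s --> +oo]) -> gGL b < 0 -> 0 < r ->
  lbound (M0_values b r) (- Num.sqrt (- 2 * gGL b * r ^+ 3)).
Proof.
move=> b01 cv g0 r0 _ [p [q [p1 [p2 [p3 [q1 [q2 [q3 [H _ ->]]]]]]]]].
exact: quotient_ge.
Qed.

(** [E] and [M] are the planar energy and mass, [k] and [d] the integrals of the squared vertical
    cutoff and of its squared derivative. The negative term is multiplied by at least r - 4, the
    positive terms of the energy by at most r; 5 D comes from 2 + 3 r^2 <= 5 r^2. *)
Let energy_scalar (b g C D r k E M d : R) : 0 <= b <= 1 -> g <= 0 -> 0 <= C -> 4 <= r ->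
  r - 4 <= k -> k <= r -> 0 <= D -> 0 <= d -> d <= D -> 0 <= M -> E <= g * r ^+ 2 + C * r + 1 ->
  M <= 2 + 3 * r ^+ 2 ->
  k * E + b * M * d <= g * r ^+ 3 + (- 4 * g + C + 1 + 5 * D) * r ^+ 2.
Proof.
move=> /andP[b0 b1] g0 C0 r4 k1 k2 D0 d0 dD M0 hE hM.
have r0 : 0 <= r by lra. have k0 : 0 <= k by lra.
have r1 : r <= r ^+ 2 by rewrite expr2 ler_peMl//; lra.
have r2 : 1 <= r ^+ 2 by lra.
have h1 : k * E <= k * (g * r ^+ 2 + C * r + 1) by exact: ler_wpM2l.
have h2 : k * (g * r ^+ 2) <= (r - 4) * (g * r ^+ 2).
  by rewrite ler_wnM2r// mulr_le0_ge0 ?sqr_ge0.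
have h3 : k * (C * r + 1) <= r * (C * r + 1).
  by rewrite ler_wpM2r// addr_ge0// mulr_ge0.
have h4 : b * M * d <= (2 + 3 * r ^+ 2) * D.
  apply: ler_pM => //; first exact: mulr_ge0.
  by rewrite -[leRHS]mul1r; apply: ler_pM.
have h5 : (2 + 3 * r ^+ 2) * D <= 5 * D * r ^+ 2.
  rewrite [leRHS](_ : _ = (5 * r ^+ 2) * D); last by ring.
  by apply: ler_wpM2r => //; lra.
rewrite mulrDr in h3; rewrite -addrA mulrDr in h1.
have -> : g * r ^+ 3 + (- 4 * g + C + 1 + 5 * D) * r ^+ 2 =
  (r - 4) * (g * r ^+ 2) + r * (C * r) + r ^+ 2 + 5 * D * r ^+ 2 by ring.
lra.
Qed.

Lemma M0_le_energy (b : R) : 0 <= b <= 1 -> cvg (m0 b s / s ^+ 2 @[s --> +oo]) -> gGL b < 0 ->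
  exists2 C : R, 0 <= C & forall r, 4 <= r -> gGL b * r ^+ 3 + C * r ^+ 2 < 0 ->
    M0_values b r !=set0 /\ M0 b r <= - Num.sqrt (- 2 * (gGL b * r ^+ 3 + C * r ^+ 2)).
Proof.
move=> b01 cv g0; have /andP[b0 b1] := b01.
have [_ [C1 C10 hC1]] := m0_upper b01 cv.
have [D D0 hD] := dcut_le R.
exists (- 4 * gGL b + C1 + 1 + 5 * D).
  by clear -C10 D0 g0; lra.
move=> r r4 E0; have r0 : 0 < r by apply: lt_le_trans r4; rewrite ltr0n.
have [P [Q [cP cQ hE]]] := m0_approx b01 r0 (ltr01 : 0 < 1).
have E1 : E2 b P Q <= 1 by apply: le_trans (ltW hE) _; rewrite gerDr m0_le0.
have hM := E2_mass_le b0 r0 cP cQ E1; rewrite mulr1 in hM.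
have hE' : E2 b P Q <= gGL b * r ^+ 2 + C1 * r + 1.
  by apply: le_trans (ltW hE) _; rewrite lerD2r; exact: hC1.
have M0' : 0 <= mass P Q by apply: Rintegral_ge0 => // x _; apply: addr_ge0; exact: sqr_ge0.
have d0 : 0 <= dcut r by apply: Rintegral_ge0 => // x _; exact: sqr_ge0.
have h := energy_scalar b01 (ltW g0) C10 r4 (kap_ge r4) (kap_le (ltW r0)) D0 d0 (hD _ r0) M0' hE' hM.
have cz := Cc1_cutoff r.
have z01 s : 0 <= cutoff r s <= 1 by rewrite cutoff_ge0 cutoff_le1.
have H := H10_3_tens3 cP cQ cz.
have iq := tens3_quartic_integrable r0 cP cQ cz.
have hF := le_trans (tens3_energy_le b r0 cP cQ cz z01) h.
have in_set : M0_values b r (Flin3 b r (tens3 P (cutoff r)) (tens3 Q (cutoff r))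
  (fun x => derive (tens3 P (cutoff r)) x (e31 R)) (fun x => derive (tens3 P (cutoff r)) x (e32 R))
  (fun x => derive (tens3 P (cutoff r)) x (e33 R)) (fun x => derive (tens3 Q (cutoff r)) x (e31 R))
  (fun x => derive (tens3 Q (cutoff r)) x (e32 R)) (fun x => derive (tens3 Q (cutoff r)) x (e33 R))
  / L4norm3 r (tens3 P (cutoff r)) (tens3 Q (cutoff r))).
  by do 8 eexists; split; [exact: H|exact: (energy_neg_not_ae0 b0 r0 H E0 hF)|reflexivity].
split; first by eexists; exact: in_set.
apply: le_trans (quotient_le b0 r0 H iq E0 hF).
by apply: ge_inf; [eexists; exact: M0_lbound|exact: in_set].
Qed.

Lemma powR32 (r : R) : 0 <= r -> r `^ (3 / 2) = Num.sqrt (r ^+ 3).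
Proof.
by move=> r0; rewrite powRrM powR12_sqrt ?powR_ge0// -(powR_mulrn 3 r0).
Qed.

Let sqrt_cube (x r : R) : 0 < r -> - Num.sqrt x * Num.sqrt (r ^+ 3) = - Num.sqrt (x * r ^+ 3).
Proof.
move=> r0; have r30 : 0 <= r ^+ 3 by exact: exprn_ge0 (ltW r0).
by rewrite mulNr; congr (- _); rewrite mulrC -sqrtrM// mulrC.
Qed.

Lemma M0_ratio_bounds (b : R) : 0 <= b <= 1 -> cvg (m0 b s / s ^+ 2 @[s --> +oo]) -> gGL b < 0 ->
  exists C R0 : R, [/\ 0 < C, 1 < R0 & forall r, R0 <= r ->
    - Num.sqrt (- 2 * gGL b) <= M0 b r / r `^ (3 / 2) <= - Num.sqrt ((1 - C / r) * (- 2 * gGL b))].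
Proof.
move=> b01 cv g0; have [C C0 hC] := M0_le_energy b01 cv g0.
have ng0 : 0 < - gGL b by rewrite oppr_gt0.
have Cg : 0 <= C / - gGL b by rewrite divr_ge0// ltW.
(* Division by - g(b) turns the error C r^2 into a relative one, and adding 1 makes the constant
   positive. The threshold ensures both r >= 4 and a negative energy bound. *)
exists (C / - gGL b + 1), (C / - gGL b + 5); split; [lra|lra|move=> r hr].
have r4 : 4 <= r by lra. have r0 : 0 < r by lra.
have s0 : 0 < Num.sqrt (r ^+ 3) by rewrite sqrtr_gt0 exprn_gt0.
have gr : C < - gGL b * r by rewrite -ltr_pdivrMl// mulrC; lra.
have E0 : gGL b * r ^+ 3 + C * r ^+ 2 < 0.
  have -> : gGL b * r ^+ 3 + C * r ^+ 2 = - (r ^+ 2 * (- gGL b * r - C)) by ring.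
  by rewrite oppr_lt0 mulr_gt0 ?exprn_gt0// subr_gt0.
have [ne hM] := hC r r4 E0.
rewrite (powR32 (ltW r0)); apply/andP; split.
  rewrite ler_pdivlMr// (sqrt_cube _ r0).
  by apply: lb_le_inf => //; exact: M0_lbound.
rewrite ler_pdivrMr// (sqrt_cube _ r0); apply: le_trans hM _; rewrite lerN2; apply: ler_wsqrtr.
(* The added 1 leaves the term 2 g(b) r^2, which is nonpositive and so preserves the comparison. *)
have -> : (1 - (C / - gGL b + 1) / r) * (- 2 * gGL b) * r ^+ 3 =
    - 2 * (gGL b * r ^+ 3 + C * r ^+ 2) + 2 * (gGL b * r ^+ 2).
  by field; rewrite lt0r_neq0//= ltr0_neq0.
by rewrite gerDl mulr_ge0_le0// mulr_le0_ge0 ?sqr_ge0// ltW.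
Qed.

Lemma cvg_M0_ratio (b C R0 : R) : (forall r, R0 <= r ->
    - Num.sqrt (- 2 * gGL b) <= M0 b r / r `^ (3 / 2) <= - Num.sqrt ((1 - C / r) * (- 2 * gGL b))) ->
  M0 b r / r `^ (3 / 2) @[r --> +oo] --> - Num.sqrt (- 2 * gGL b).
Proof.
move=> h.
have ci : (s : R)^-1 @[s --> +oo] --> (0 : R).
  by apply/(@gtr0_cvgV0 _ _ _ _ id); [exact: nbhs_pinfty_gt|exact: cvg_id].
have c1 : - Num.sqrt ((1 - C / r) * (- 2 * gGL b)) @[r --> +oo] --> - Num.sqrt (- 2 * gGL b).
  have c0 : (1 - C / r) * (- 2 * gGL b) @[r --> +oo] --> (1 - C * 0) * (- 2 * gGL b).
    apply: cvgM; last exact: cvg_cst.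
    by apply: cvgB; [exact: cvg_cst|apply: cvgM => //; exact: cvg_cst].
  rewrite mulr0 subr0 mul1r in c0.
  by apply: cvgN; exact: (continuous_cvg _ (@sqrt_continuous R _) c0).
apply: (squeeze_cvgr _ (cvg_cst _) c1).
have := nbhs_pinfty_ge (num_real R0); apply: filterS => r; exact: h.
Qed.

End M0_bounds.

Theorem mainTheorem5 (R : realType) (b : R) :
  0 < b < 1 ->
  (* standing fact from the context: the limit defining g(b) exists *)
  cvg (m0 b r / r ^+ 2 @[r --> +oo]) ->
  exists C R0 : R, [/\ 0 < C, 1 < R0,
    (forall r : R, R0 <= r ->
       - Num.sqrt (- 2 * gGL b) <= M0 b r / r `^ (3 / 2) /\
       M0 b r / r `^ (3 / 2) <=
         - Num.sqrt ((1 - C / r) * (- 2 * gGL b))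
         + C / r * (Num.sqrt (- 2 * gGL b))^-1) &
    exists L : R, (M0 b r / r `^ (3 / 2) @[r --> +oo] --> L) /\
                  gGL b = - 2^-1 * L ^+ 2].
Proof.
move=> /andP[b0 b1] cv.
have b01 : 0 <= b <= 1 by rewrite (ltW b0) (ltW b1).
have g0 : gGL b < 0 by apply: gGL_lt0 => //; rewrite (ltW b0).
have [C [R0 [C0 R01 h]]] := M0_ratio_bounds b01 cv g0.
exists C, R0; split=> //.
  move=> r hr; have /andP[h1 h2] := h r hr; split=> //; apply: le_trans h2 _.
  have r0 : 0 < r by apply: lt_le_trans hr; apply: lt_trans R01.
  by rewrite lerDl mulr_ge0 ?invr_ge0 ?sqrtr_ge0// divr_ge0// ltW.
exists (- Num.sqrt (- 2 * gGL b)); split; first exact: cvg_M0_ratio h.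
rewrite sqrrN sqr_sqrtr; first by field.
by rewrite nmulr_rge0 ?ltW// oppr_lt0.
Qed.
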